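(* Let $n\ge 2$, let $\Omega\subset\mathbb{R}^n$ be an open set, let $0<K_1<+\infty$ and $0\le K_2<+\infty$, and let $f:\Omega\to\mathbb{R}^n$ be a $(K_1,K_2)$-quasiregular mapping (identified with its continuous representative). Then for almost all $x\in\Omega$ the linear mapping $Df(x)$ is the differential of $f$ at the point $x$.
   Context: For an $n\times n$ matrix $A$, $|A|=\sup_{|\xi|=1}|A\xi|$. $W^{1,n}(\Omega,\mathbb{R}^n)$ is the Sobolev space of mappings $f=(f^1,\dots,f^n):\Omega\to\mathbb{R}^n$ whose components and their first distributional derivatives belong to $L^n(\Omega)$. For such $f$, $Df(x)=(\partial f^i/\partial x_j)_{1\le i,j\le n}$ is the weak derivative matrix, defined for almost all $x\in\Omega$, and $\mathcal{J}(x,f)=\det Df(x)$ is the Jacobian. A function $u$ does not change sign in $\Omega$ if either $u\ge 0$ almost everywhere in $\Omega$ or $u\le 0$ almost everywhere in $\Omega$. A mapping $f:\Omega\to\mathbb{R}^n$ is $(K_1,K_2)$-quasiregular, with $0<K_1<+\infty$ and $0\le K_2<+\infty$, if (i) $f\in W^{1,n}(\Omega,\mathbb{R}^n)$; (ii) $\mathcal{J}(x,f)$ does not change sign in $\Omega$, and $|Df(x)|^n\le K_1|\mathcal{J}(x,f)|+K_2$ for almost all $x\in\Omega$. Every $(K_1,K_2)$-quasiregular mapping coincides almost everywhere with a continuous mapping, and is identified with it. A mapping $f:\Omega\to\mathbb{R}^n$ is differentiable at $a\in\Omega$ if there is a linear mapping $L:\mathbb{R}^n\to\mathbb{R}^n$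 such that $f(x)=f(a)+L(x-a)+\beta(x)|x-a|$ for all $x\in\Omega$, where $\beta(x)\to 0$ as $x\to a$; the mapping $L$ is called the differential of $f$ at $a$. *)

(* Defs.v *)
From HB Require Import structures.
From mathcomp Require Import all_boot all_order all_algebra.
From mathcomp Require Import all_classical all_reals all_analysis.

Set Implicit Arguments.
Unset Strict Implicit.
Unset Printing Implicit Defensive.
Import Order.TTheory GRing.Theory Num.Theory.
Import numFieldNormedType.Exports.
Local Open Scope classical_set_scope.
Local Open Scope ring_scope.

(* The points of R^n are the column vectors 'cV[R]_n, with coordinates x i 0,
   so that the matrix (d f^i / d x_j)_(i, j) acts on them by *m. *)

(* The sigma-algebra on R^n is the one generated by the coordinates, which is
   the Borel sigma-algebra; like the library's lebesgue_measure on R, the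
   measure below is the Borel (uncompleted) one.  Null sets are unaffected, and
   every Lebesgue measurable function has a Borel representative. *)
Definition cV_display : measure_display -> measure_display.
Proof. exact. Qed.

Section measurable_cV.
Context {d : measure_display} {T : measurableType d} (n : nat).

Definition cV_measurable : set (set 'cV[T]_n) :=
  g_sigma_preimage (fun (i : 'I_n) (x : 'cV[T]_n) => x i ord0).

Let cV_set0 : cV_measurable set0.
Proof. exact: sigma_algebra0. Qed.

Let cV_setC A : cV_measurable A -> cV_measurable (~` A).
Proof. exact: sigma_algebraC. Qed.

Let cV_bigcup (F : (set 'cV[T]_n)^nat) :
  (forall i, cV_measurable (F i)) -> cV_measurable (\bigcup_i F i).
Proof. exact: sigma_algebra_bigcup. Qed.

HB.instance Definition _ := @isMeasurable.Build (cV_display d) 'cV[T]_n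
  cV_measurable cV_set0 cV_setC cV_bigcup.

Lemma measurable_coord (i : 'I_n) :
  measurable_fun [set: 'cV[T]_n] (fun x : 'cV[T]_n => x i ord0).
Proof.
move=> _ Y mY; rewrite setTI; apply: sub_sigma_algebra => /=.
rewrite -bigcup_seq/=; exists i => /=; first by rewrite mem_index_enum.
by exists Y => //; rewrite setTI.
Qed.

Lemma measurable_fun_cVP d' (T' : measurableType d') (f : T' -> 'cV[T]_n) :
  measurable_fun [set: T'] f <->
  forall i, measurable_fun [set: T'] (fun x => f x i ord0).
Proof.
split=> [mf i|mf].
  exact: (measurableT_comp (measurable_coord i) mf).
move=> _ A mA; rewrite setTI.
suff : cV_measurable `<=` image_set_system setT f measurable.
  by move=> /(_ A mA); rewrite /image_set_system/= setTI.
apply: smallest_sub.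
  exact: (sigma_algebra_image _ (@sigma_algebra_measurable _ _)).
move=> B; rewrite -bigcup_seq/= => -[i _ [C mC <-]].
rewrite /image_set_system/= !setTI.
by have := mf i measurableT C mC; rewrite setTI.
Qed.

End measurable_cV.

Section cons_measure.
Context {R : realType} (n : nat).

Definition cV_cons (p : R * 'cV[R]_n) : 'cV[R]_n.+1 :=
  \col_i (if unlift ord0 i is Some j then p.2 j ord0 else p.1).

Lemma cV_cons0 p : cV_cons p ord0 ord0 = p.1.
Proof. by rewrite mxE unlift_none. Qed.

Lemma cV_consS p i : cV_cons p (lift ord0 i) ord0 = p.2 i ord0.
Proof. by rewrite mxE liftK. Qed.

Lemma measurable_cV_cons : measurable_fun [set: R * 'cV[R]_n] cV_cons.
Proof.
apply/measurable_fun_cVP => i; have [j ->|->] := unliftP ord0 i.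
  under eq_fun do rewrite cV_consS.
  exact: (measurableT_comp (measurable_coord j) measurable_snd).
under eq_fun do rewrite cV_cons0.
exact: measurable_fst.
Qed.

Variable m : {sigma_finite_measure set 'cV[R]_n -> \bar R}.

Definition cons_measure : set 'cV[R]_n.+1 -> \bar R :=
  pushforward (lebesgue_measure \x m)%E cV_cons.

Let cons_measure0 : cons_measure set0 = 0%E.
Proof. by rewrite /cons_measure /pushforward preimage_set0 measure0. Qed.

Let cons_measure_ge0 A : (0 <= cons_measure A)%E.
Proof. by rewrite /cons_measure /pushforward; exact: measure_ge0. Qed.

Let cons_measure_sigma_additive : semi_sigma_additive cons_measure.
Proof.
have mF A : measurable A -> measurable (cV_cons @^-1` A).
  by move=> mA; rewrite -[X in measurable X]setTI; exact: measurable_cV_cons.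
move=> F mF' tF mUF; rewrite /cons_measure /pushforward preimage_bigcup.
apply: measure_semi_sigma_additive.
- by move=> k; exact: mF.
- apply/trivIsetP => /= i j _ _ ij; rewrite -preimage_setI.
  by move/trivIsetP : tF => /(_ _ _ _ _ ij) ->//; rewrite preimage_set0.
- by rewrite -preimage_bigcup; exact: mF.
Qed.

HB.instance Definition _ := isMeasure.Build _ _ _ cons_measure
  cons_measure0 cons_measure_ge0 cons_measure_sigma_additive.

Let cons_measure_sigma_finite : sigma_finite setT cons_measure.
Proof.
have /sigma_finiteP[F [TF ndF Foo]] := sigma_finiteT (@lebesgue_measure R).
have /sigma_finiteP[G [TG ndG Goo]] := sigma_finiteT m.
pose g (x : 'cV[R]_n.+1) : R * 'cV[R]_n :=
  (x ord0 ord0, \col_i x (lift ord0 i) ord0).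
have mg : measurable_fun setT g.
  apply/measurable_fun_pairP; split; first exact: (measurable_coord ord0).
  apply/measurable_fun_cVP => i /=; under eq_fun do rewrite mxE.
  exact: measurable_coord.
have gK p : g (cV_cons p) = p.
  rewrite /g cV_cons0; under eq_mx do rewrite cV_consS.
  case: p => a x /=; congr pair; apply/matrixP => i j.
  by rewrite mxE (ord1 j).
exists (fun k => g @^-1` (F k `*` G k)).
  rewrite -preimage_bigcup (_ : \bigcup_k _ = setT) ?preimage_setT//.
  apply/seteqP; split => // -[a x] _.
  have [k _ Fka] : (\bigcup_k F k) a by rewrite -TF.
  have [l _ Glx] : (\bigcup_l G l) x by rewrite -TG.
  exists (maxn k l) => //; split => /=.
  - by move: a Fka; exact/subsetPset/ndF/leq_maxl.
  - by move: x Glx; exact/subsetPset/ndG/leq_maxr.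
move=> k; have [mF Fk] := Foo k; have [mG Gk] := Goo k; split.
  by rewrite -[X in measurable X]setTI; apply: mg => //; exact: measurableX.
rewrite /cons_measure /pushforward -comp_preimage.
rewrite (_ : g \o cV_cons = id); last exact/funext.
by rewrite preimage_id product_measure1E// lte_mul_pinfty// ge0_fin_numE.
Qed.

HB.instance Definition _ := Measure_isSigmaFinite.Build _ _ _ cons_measure
  cons_measure_sigma_finite.

End cons_measure.

(* Lebesgue measure on R^n: the n-fold product of lebesgue_measure, starting
   from the unit mass on the one-point space R^0. *)
Fixpoint lebesgue_cV {R : realType} (n : nat) :
    {sigma_finite_measure set 'cV[R]_n -> \bar R} :=
  match n with
  | 0%N => \d_(0 : 'cV[R]_0)
  | n'.+1 => cons_measure (lebesgue_cV n')
  end.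

Lemma lebesgue_cV_box {R : realType} (n : nat) (A : 'I_n -> set R) :
  (forall i, measurable (A i)) ->
  lebesgue_cV n [set x : 'cV[R]_n | forall i, A i (x i ord0)] =
  (\prod_(i < n) lebesgue_measure (A i))%E.
Proof.
elim: n A => [|n IHn] A mA.
  rewrite big_ord0 /= diracE mem_set//; by case.
pose B := [set x : 'cV[R]_n | forall i, A (lift ord0 i) (x i ord0)].
have mB : measurable B.
  rewrite (_ : B = \bigcap_(i in [set: 'I_n])
      ((fun x : 'cV[R]_n => x i ord0) @^-1` A (lift ord0 i))).
    apply: fin_bigcap_measurable => // i _.
    by rewrite -[X in measurable X]setTI; exact: measurable_coord.
  by apply/seteqP; split => x Bx i *; exact: Bx.
rewrite big_ord_recl -IHn//= /cons_measure /pushforward.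
rewrite (_ : _ @^-1` _ = A ord0 `*` B) ?product_measure1E//.
  exact: (mA ord0).
apply/seteqP; split => -[a x] /=.
  move=> Aax; split; first by have := Aax ord0; rewrite cV_cons0.
  by move=> i; have := Aax (lift ord0 i); rewrite cV_consS.
move=> [Aa Ax] i; have [j ->|->] := unliftP ord0 i; first by rewrite cV_consS.
by rewrite cV_cons0.
Qed.

Section sobolev.
Context {R : realType} {n : nat}.
Implicit Types (Omega : set 'cV[R]_n) (u g phi : 'cV[R]_n -> R) (i j : 'I_n).

Local Notation mu := (@lebesgue_cV R n).

(* The library's norm `|x| on matrices is the sup norm, hence the following. *)
Definition enorm (x : 'cV[R]_n) : R := Num.sqrt (\sum_i x i ord0 ^+ 2).

Definition opnorm (A : 'M[R]_n) : R :=
  sup [set enorm (A *m xi) | xi in [set xi : 'cV[R]_n | enorm xi = 1]].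

Definition unit_cV j : 'cV[R]_n := delta_mx j ord0.

Definition partial j u : 'cV[R]_n -> R := fun x => 'D_(unit_cV j) u x.

(* C^oo: the iterated partial derivatives of all orders exist and are
   continuous. *)
Definition smooth phi : Prop := forall s : seq 'I_n,
  let psi := foldr partial phi s in
  continuous psi /\ forall j x, derivable psi x (unit_cV j).

Definition test_function Omega phi : Prop :=
  [/\ smooth phi, compact (closure [set x | phi x != 0])
     & closure [set x | phi x != 0] `<=` Omega].

(* A function on Omega is represented by a function on R^n whose values outside Omega
   are irrelevant: u \_ Omega is u on Omega and 0 elsewhere. *)
Definition Lp_on (p : \bar R) Omega u : Prop := u \_ Omega \in Lfun mu p.

Definition weak_partial Omega j u g : Prop := forall phi, test_function Omega phi ->
  \int[mu]_(x in Omega) (u x * partial j phi x) =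
  - \int[mu]_(x in Omega) (g x * phi x).

(* f belongs to W^{1,p}(Omega, R^n) and Df is (a representative of) its weak
   derivative matrix. *)
Definition sobolev_with (p : \bar R) Omega (f : 'cV[R]_n -> 'cV[R]_n)
    (Df : 'cV[R]_n -> 'M[R]_n) : Prop :=
  [/\ forall i, Lp_on p Omega (fun x => f x i ord0),
      forall i j, Lp_on p Omega (fun x => Df x i j)
    & forall i j,
        weak_partial Omega j (fun x => f x i ord0) (fun x => Df x i j)].

Definition sobolev p Omega f : Prop := exists Df, sobolev_with p Omega f Df.

Definition no_sign_change Omega u : Prop :=
  (\forall x \ae mu, Omega x -> 0 <= u x) \/ (\forall x \ae mu, Omega x -> u x <= 0).

(* Weak derivatives are unique up to null sets, so that the choice of the
   representative Df is immaterial. *)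
Definition quasiregular (K1 K2 : R) Omega f : Prop :=
  sobolev n%:R%:E Omega f /\
  forall Df, sobolev_with n%:R%:E Omega f Df ->
    no_sign_change Omega (fun x => \det (Df x)) /\
    \forall x \ae mu, Omega x ->
      opnorm (Df x) ^+ n <= K1 * `|\det (Df x)| + K2.

End sobolev.

(* Main.v *)
From HB Require Import structures.
Require Import Defs.
From mathcomp Require Import all_boot all_order all_algebra.
From mathcomp Require Import all_fingroup.
From mathcomp Require Import all_classical all_reals all_analysis.
From mathcomp Require Import measurable_realfun.
From mathcomp Require Import ring lra.

(** Differentiability almost everywhere of quasiregular mappings.

    Two estimates for the coordinates [f^i] are combined.  Cubes replace balls
    throughout, because the norm on column vectors is the sup norm; [Q(x, r)] is
    the cube of centre [x] and radius [r].

    The first ([sup_estimate]) bounds an oscillation by a mean: there is a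
    constant [C] with
    [|f^i(x0) - c|^n <= C (r^n + r^(-n) int_Q(x0, r) |f^i - c|^n)]
    for all numbers [c] and all cubes with [Q(x0, 2 r)] inside [Omega].  The second
    ([mean_differentiable]) says that at every point [x] that is a Lebesgue point,
    for n-th powers, of all entries of [Df],
    [int_Q(x, r) |f^i(y) - f^i(x) - (Df(x) (y - x))^i|^n dy = o(r^(2 n))].
    By [lebesgue_points] almost every [x] is of this kind.  For small [h], apply the
    first estimate at [x0 = x + h] with radius [t |h|] and with
    [c = f^i(x) + (Df(x) h)^i], and bound the integral with the second:
    [|f^i(x + h) - c|^n] is at most [(C' t^n + o(1) t^(-n)) |h|^n].  Choosing [t] small
    and then [h] small shows that [Df(x)] is the differential ([pointwise_diff]).

    The sup estimate is proved by Moser iteration.  Let [u = (f^i - c) / r], let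
    [eta] be a cut-off function of the cube and [D] the norm of [Df].  Since
    [D^n <= a1 |J| + a2] and the Jacobian [J] has a constant sign, the integral of
    [eta^q u^m D^n], with [m] even, is controlled by the absolute value of the
    integral of [eta^q u^m J].  The Jacobian is a null Lagrangian: the determinant
    of [Df], with row [i] replaced by the gradient of a function of compact
    support, has integral zero ([null_lagrangian]).  For the function
    [eta^q u^(m + 1)] this trades the integral of [eta^q u^m J] for one in which [D]
    has power [n - 1] and the gradient of [eta] appears, and Young's inequality
    turns this into a Caccioppoli inequality ([caccioppoli]).  A Sobolev
    inequality which triples the exponent ([sobolev_ineq]) closes the loop: the
    integrals of the powers [3^k n] of [u] satisfy a recursion ([moser_step])
    whose solution grows like a fixed number to the power [3^k]
    ([moser_iteration]), which bounds [u] at the centre.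

    The null Lagrangian identity and the Sobolev inequality need differentiable
    functions.  They are applied to mollifications of [f], whose gradients are,
    well inside [Omega], the mollifications of [Df] ([dmol_mol]).  These converge at
    Lebesgue points, and the passage to the limit under the integral sign uses a
    form of dominated convergence in which the majorants vary ([pratt]).

    Mean differentiability follows from the fundamental theorem of calculus on
    the segments issuing from [x], integrated over a cube ([ray_ineq]). *)

Set Implicit Arguments.
Unset Strict Implicit.
Unset Printing Implicit Defensive.
Import Order.TTheory GRing.Theory Num.Theory.
Import numFieldNormedType.Exports.
Local Open Scope classical_set_scope.
Local Open Scope ring_scope.

(** * Lebesgue measure on cubes and affine changes of variables *)

Section euclidean_space.
Context {R : realType} {n : nat}.
Local Notation E := 'cV[R]_n.
Local Notation mu := (@lebesgue_cV R n).

(** The norm of [E] is the sup norm, so that balls are cubes. *)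
Lemma ballcVP (x : E) (r : R) (y : E) : 0 < r ->
  ball x r y <-> forall i, `|x i ord0 - y i ord0| < r.
Proof.
move=> r0; rewrite /ball/= /mx_ball/=; split=> [[_ h] i|h]; first exact: h.
by split => // i j; rewrite (ord1 j); exact: h.
Qed.

Lemma norm_coord_le (x : E) i : `|x i ord0| <= `|x|.
Proof. by rewrite [leRHS]/Num.norm/= mx_normrE; apply/bigmax_geP; right; exists (i, ord0). Qed.

Lemma norm_cV_le (x : E) (M : R) : 0 <= M ->
  (forall i, `|x i ord0| <= M) -> `|x| <= M.
Proof.
move=> M0 h; rewrite /Num.norm/= mx_normrE; apply/bigmax_leP; split => //= -[i j] _ /=.
by rewrite (ord1 j); exact: h.
Qed.

Lemma measurable_box (A : 'I_n -> set R) : (forall i, measurable (A i)) ->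
  measurable [set x : E | forall i, A i (x i ord0)].
Proof.
move=> mA; rewrite (_ : mkset _ = \bigcap_(i in [set: 'I_n])
    ((fun x : E => x i ord0) @^-1` A i)).
  apply: fin_bigcap_measurable => // i _.
  by rewrite -[X in measurable X]setTI; exact: measurable_coord.
by apply/seteqP; split => x Bx i *; exact: Bx.
Qed.

Lemma ball_box (x : E) (r : R) : 0 < r ->
  ball x r = [set y : E | forall i, `]x i ord0 - r, x i ord0 + r[%classic (y i ord0)].
Proof.
move=> r0; apply/seteqP; split => y /=.
  move=> /(ballcVP _ _ r0) h i; rewrite in_itv/=.
  by have := h i; rewrite ltr_distlC.
by move=> h; apply/(ballcVP _ _ r0) => i; have := h i; rewrite in_itv/= ltr_distlC.
Qed.

Lemma measurable_ball_cV (x : E) (r : R) : measurable (ball x r).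
Proof.
have [r0|r0] := ltP 0 r.
  rewrite ball_box//.
  by apply: (@measurable_box (fun i => `]x i ord0 - r, x i ord0 + r[%classic)) => i; exact: measurable_itv.
rewrite (_ : ball x r = set0) //; apply/seteqP; split => // y.
by move=> /= [r1]; move: r0; rewrite leNgt r1.
Qed.

Lemma lebesgue_cV_ball (x : E) (r : R) : 0 < r ->
  mu (ball x r) = ((2 * r) ^+ n)%:E.
Proof.
move=> r0; rewrite ball_box//.
rewrite (@lebesgue_cV_box _ _ (fun i => `]x i ord0 - r, x i ord0 + r[%classic)); last first.
  by move=> i; exact: measurable_itv.
under eq_bigr do rewrite lebesgue_measure_itv/= lte_fin.
rewrite (eq_bigr (fun=> (2 * r)%:E)); last first.
  move=> i _; rewrite ifT; last by rewrite ltrBlDr -addrA ltrDl addr_gt0.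
  by congr (_%:E); ring.
by rewrite prodEFin prodr_const card_ord.
Qed.

(** Cubes with rational data form a countable base, so they turn
    uncountable unions of cubes into countable ones. *)
Definition ratcube (k : 'cV[rat]_n * rat) : set E :=
  ball (\col_i ratr (k.1 i ord0) : E) (ratr k.2 : R).

Lemma ratcube_between (x : E) (r : R) : 0 < r ->
  exists k, [/\ ratcube k x, ratcube k `<=` ball x r & 0 < ratr k.2 :> R].
Proof.
move=> r0.
have [s /andP[rs sr]] : exists s : rat, (r / 4 < ratr s < r / 2)%R.
  have : r / 4 < r / 2 by lra.
  by move=> /rat_in_itvoo[s]; rewrite in_itv/= => ?; exists s.
have h i : exists q : rat, `|ratr q - x i ord0| < ratr s.
  have : x i ord0 - ratr s < x i ord0 + ratr s by lra.
  move=> /rat_in_itvoo[q]; rewrite in_itv/= => /andP[? ?].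
  by exists q; rewrite ltr_norml; apply/andP; split; lra.
have [q hq] := choice h.
have s0 : 0 < ratr s :> R by lra.
exists (\col_i q i, s); split => //=.
- by apply/ballcVP => //= i; rewrite !mxE; exact: hq.
- move=> y /(ballcVP _ _ s0) hy; apply/ballcVP => // i.
  have := hy i; have := hq i; rewrite !mxE distrC => h1 h2.
  rewrite -(subrK (ratr (q i)) (x i ord0)) -addrA.
  by rewrite (le_lt_trans (ler_normD _ _))//; lra.
Qed.

Lemma open_measurable_cV (A : set E) : open A -> measurable A.
Proof.
move=> oA.

pose F k := if `[< ratcube k `<=` A >] then ratcube k else set0.
rewrite (_ : A = \bigcup_k F k).
  apply: countable_bigcupT_measurable; first exact: countableP.
  by move=> k; rewrite /F; case: ifP => // _; exact: measurable_ball_cV.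
apply/seteqP; split => [x Ax|x [k _]]; last first.
  by rewrite /F; case: ifP => // /asboolP h /h.
have /nbhs_ballP[r /= r0 rA] : nbhs x A by exact: open_nbhs_nbhs.
have [k [kx kr _]] := ratcube_between x r0.
by exists k => //; rewrite /F ifT//; apply/asboolP; exact: subset_trans rA.
Qed.

Lemma continuous_measurable_cV (u : E -> R) :
  continuous u -> measurable_fun [set: E] u.
Proof.
move=> /continuousP cu; apply: (measurability _ (measurable_realfun.RGenOpens.measurableE R)).
move=> _ [_ [a [b ->] <-]]; rewrite setTI; apply: open_measurable_cV.
exact/cu/interval_open.
Qed.

Lemma lebesgue_affine1 (c t : R) (A : set R) : 0 < t -> measurable A ->
  (t%:E * lebesgue_measure ((fun x => (c + t * x)%R) @^-1` A))%E = lebesgue_measure A.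
Proof.
move=> t0 mA.
have mf : measurable_fun setT ((fun x => (c + t * x)%R) : measurableTypeR R -> measurableTypeR R).
  by apply: measurable_funD => //; apply: measurable_funM.
pose f : {mfun (measurableTypeR R) >-> (measurableTypeR R)} := HB.pack (fun x : R => (c + t * x)%R) (isMeasurableFun.Build _ _ _ _ _ mf).
rewrite [RHS](@lebesgue_measure_unique R (mscale (NngNum (ltW t0)) (pushforward lebesgue_measure f)))//.
move=> _ [[a b]] _ <-.
transitivity (t%:E * lebesgue_measure ((fun x => (c + t * x)%R) @^-1` `]a, b]))%E; last by [].
rewrite (_ : _ @^-1` _ = `](a - c) / t, (b - c) / t]%classic); last first.
  apply/seteqP; split => x /=; rewrite !in_itv/= ltr_pdivrMr// ler_pdivlMr// => /andP[? ?];
  by apply/andP; split; lra.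
rewrite !lebesgue_measure_itv/= !lte_fin ltr_pdivrMr// divfK ?gt_eqF// ltrD2r.
case: ifPn => [ab|_]; last by rewrite mule0.
by rewrite -EFinD -EFinM; congr (_%:E); field; rewrite gt_eqF.
Qed.

Lemma measurable_affine (c : E) (t : R) :
  measurable_fun [set: E] (fun x : E => c + t *: x).
Proof.
apply/measurable_fun_cVP => i.
under eq_fun do rewrite !mxE.
apply: measurable_funD => //; apply: measurable_funM => //.
exact: measurable_coord.
Qed.

Lemma lebesgue_cV_affine (c : E) (t : R) (A : set E) : 0 < t -> measurable A ->
  ((t ^+ n)%:E * mu ((fun x : E => (c + t *: x)%R) @^-1` A))%E = mu A.
Proof.
move=> t0 mA.
have mf := measurable_affine c t.
have t0' : 0 <= t ^+ n by rewrite exprn_ge0// ltW.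
pose m2' : {measure set E -> \bar R} :=
  mscale (NngNum t0') (pushforward mu (fun x : E => c + t *: x)).
pose m2 : {measure set E -> \bar R} := m2' mf.
pose G := [set B | exists A : 'I_n -> set R, (forall i, measurable (A i)) /\
   B = [set x : E | forall i, A i (x i ord0)]].
pose g k : set E := [set x : E | forall i, `[-(k%:R), k%:R]%classic (x i ord0)].
have gG k : G (g k).
  exists (fun=> `[-(k%:R), k%:R]%classic); split => // i; exact: measurable_itv.
symmetry; apply: (@measure_unique _ _ _ G g _ _ gG _ mu m2 _ _ A mA).
- apply/seteqP; split.
    apply: smallest_sub; first exact: smallest_sigma_algebra.
    move=> B; rewrite -bigcup_seq/= => -[i _ [C mC <-]].
    apply: sub_sigma_algebra; exists (fun j => if j == i then C else setT); split.
      by move=> j; case: ifP.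
    rewrite setTI; apply/seteqP; split => x /=.
      by move=> Cx j; case: eqP => // ->.
    by move=> /(_ i); rewrite eqxx.
  apply: smallest_sub; first exact: sigma_algebra_measurable.
  by move=> _ [B [mB ->]]; exact: measurable_box.
- move=> _ _ [B [mB ->]] [C [mC ->]]; exists (fun i => B i `&` C i); split.
    by move=> i; exact: measurableI.
  apply/seteqP; split => x /=; first by move=> [h1 h2] i; split; [exact: h1|exact: h2].
  by move=> h; split => i; have [] := h i.
- apply/seteqP; split => // x _; exists (Num.truncn `|x|).+1 => //= i.
  rewrite /= in_itv/= -ler_norml (le_trans (norm_coord_le _ _))// ltW// truncnS_gt//.
- move=> _ [B [mB ->]]; 
  rewrite -[RHS]/((t ^+ n)%:E * mu ((fun x : E => c + t *: x)%R @^-1`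
    [set x : E | forall i, B i (x i ord0)]))%E.
  rewrite (_ : _ @^-1` _ = [set x : E | forall i, ((fun y => c i ord0 + t * y) @^-1` B i) (x i ord0)]); last first.
    by apply/seteqP; split => x /= h i; have := h i; rewrite !mxE.
  have mB' i : measurable ((fun y => c i ord0 + t * y) @^-1` B i).
    rewrite -[X in measurable X]setTI.
    have : measurable_fun setT (fun y => c i ord0 + t * y) by apply: measurable_funD => //; exact: measurable_funM.
    exact.
  apply: (etrans (lebesgue_cV_box mB)); apply: esym.
  apply: (etrans (congr1 (fun z => (t ^+ n)%:E * z)%E (lebesgue_cV_box mB'))); apply: esym.
  rewrite (eq_bigr (fun i => t%:E * lebesgue_measure ((fun y => (c i ord0 + t * y)%R) @^-1` B i)))%E; last first.
    by move=> i _; rewrite (lebesgue_affine1 (c i ord0) t0).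
  rewrite big_split/=; congr (_ * _)%E.
  by rewrite prodEFin prodr_const card_ord.
- move=> k.
  pose I : set R := `[-(k%:R), k%:R]%classic.
  have mI (i : 'I_n) : measurable I by exact: measurable_itv.
  suff : (\prod_(i < n) lebesgue_measure I < +oo)%E by rewrite -(lebesgue_cV_box mI).
  rewrite /I.
  under eq_bigr do rewrite lebesgue_measure_itv/=.
  case: ifP => _; last by rewrite prodEFin ltry.
  by under eq_bigr do rewrite -EFinD; rewrite prodEFin ltry.
Qed.

Lemma integral_affine (c : E) (t : R) (D : set E) (h : E -> \bar R) : 0 < t ->
  measurable D -> measurable_fun D h -> (forall x, D x -> (0 <= h x)%E) ->
  ((t ^+ n)%:E * \int[mu]_(x in (fun x : E => (c + t *: x)%R) @^-1` D) h (c + t *: x)%R)%E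
  = (\int[mu]_(x in D) h x)%E.
Proof.
move=> t0 mD mh h0.
have mf := measurable_affine c t.
have t0' : 0 <= t ^+ n by rewrite exprn_ge0// ltW.
pose m2' : {measure set E -> \bar R} :=
  mscale (NngNum t0') (pushforward mu (fun x : E => c + t *: x)).
pose m2 : {measure set E -> \bar R} := m2' mf.
rewrite [RHS](@eq_measure_integral _ _ _ _ m2); last first.
  by move=> A mA AD; rewrite /m2/= /mscale/= /pushforward/= lebesgue_cV_affine.
rewrite /m2 ge0_integral_mscale//=; congr (_ * _)%E.
by rewrite ge0_integral_pushforward// => x /set_mem; exact: h0.
Qed.

End euclidean_space.

(** * Jensen inequality and limits of integrals *)

Section jensen.
Context d (T : measurableType d) (R : realType).
Variable m : {measure set T -> \bar R}.

(** A convex power lies above its tangent line at [a]. *)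
Lemma tangent_pow (a t : R) N : 0 <= a -> 0 <= t ->
  N.+1%:R * a ^+ N * t <= t ^+ N.+1 + N%:R * a ^+ N.+1.
Proof.
move=> a0 t0; elim: N => [|N IH]; first by rewrite !expr0 !expr1 !mul1r mul0r addr0.
have h := ler_wpM2r t0 IH.
have aN : 0 <= a ^+ N by exact: exprn_ge0.
have h2 : 0 <= N.+1%:R * a ^+ N * (t - a) ^+ 2 by rewrite mulr_ge0 ?sqr_ge0// mulr_ge0.
move: h h2; rewrite !exprS -!natr1; set x := a ^+ N; set y := t ^+ N; nra.
Qed.

Lemma tangent_powe (a : R) (t : \bar R) N : 0 <= a -> (0 <= t)%E ->
  ((N.+1%:R * a ^+ N)%:E * t <= t ^+ N.+1 + (N%:R * a ^+ N.+1)%:E)%E.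
Proof.
move=> a0; case: t => [t| |//].
  by rewrite lee_fin => t0; rewrite -EFin_expe -EFinM -EFinD lee_fin; exact: tangent_pow.
by move=> _; rewrite expeS gt0_mulye ?expe_gt0// addye// leey.
Qed.

Lemma measurable_fun_expe D (h : T -> \bar R) N : measurable_fun D h ->
  measurable_fun D (fun x => h x ^+ N)%E.
Proof.
move=> mh; elim: N => [|N IH]; first by under eq_fun do rewrite expe0; exact: measurable_cst.
by under eq_fun do rewrite expeS; exact: emeasurable_funM.
Qed.

(** Jensen's inequality for powers, in weighted form: integrate the tangent
    line inequality at the mean value. *)
Lemma jensen_pow (D : set T) (w : T -> R) (h : T -> \bar R) N : (0 < N)%N ->
  measurable D -> measurable_fun D w -> (forall x, D x -> 0 <= w x) ->
  measurable_fun D h -> (forall x, D x -> (0 <= h x)%E) ->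
  (\int[m]_(x in D) (w x)%:E = 1)%E ->
  ((\int[m]_(x in D) ((w x)%:E * h x)) ^+ N <=
    \int[m]_(x in D) ((w x)%:E * h x ^+ N))%E.
Proof.
case: N => // N _ mD mw w0 mh h0 w1.
have mw' : measurable_fun D (fun x => (w x)%:E) by exact/measurable_EFinP.
have mwh : measurable_fun D (fun x => (w x)%:E * h x)%E by exact: emeasurable_funM.
have mhN := measurable_fun_expe N.+1 mh.
have mwhN : measurable_fun D (fun x => (w x)%:E * h x ^+ N.+1)%E by exact: emeasurable_funM.
have key a : 0 <= a -> ((N.+1%:R * a ^+ N)%:E * (\int[m]_(x in D) ((w x)%:E * h x)) <=
   \int[m]_(x in D) ((w x)%:E * h x ^+ N.+1) + (N%:R * a ^+ N.+1)%:E)%E.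
  move=> a0.
  have c0 : 0 <= N.+1%:R * a ^+ N by rewrite mulr_ge0// exprn_ge0.
  have c1 : 0 <= N%:R * a ^+ N.+1 by rewrite mulr_ge0// exprn_ge0.
  have wh0 x : D x -> (0 <= (w x)%:E * h x)%E.
    by move=> Dx; rewrite mule_ge0 ?lee_fin ?w0// h0.
  have w0' x : D x -> (0 <= (w x)%:E)%E by move=> Dx; rewrite lee_fin w0.
  rewrite -(ge0_integralZl_EFin m mD wh0 mwh c0).
  rewrite -[X in (_ <= _ + X)%E]mule1 -[X in (_ <= _ + _ * X)%E]w1.
  rewrite -(ge0_integralZl_EFin m mD w0' mw' c1).
  have whN0 x : D x -> (0 <= (w x)%:E * h x ^+ N.+1)%E.
    by move=> Dx; rewrite mule_ge0 ?lee_fin ?w0// expe_ge0// h0.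
  have cw0 x : D x -> (0 <= (N%:R * a ^+ N.+1)%:E * (w x)%:E)%E.
    by move=> Dx; rewrite mule_ge0 ?lee_fin ?w0.
  have mcw : measurable_fun D (fun x => (N%:R * a ^+ N.+1)%:E * (w x)%:E)%E.
    exact: emeasurable_funM.
  rewrite -(ge0_integralD m mD whN0 mwhN cw0 mcw).
  apply: ge0_le_integral => //.
  - by move=> x Dx; rewrite !mule_ge0 ?lee_fin ?w0// h0.
  - exact: emeasurable_funM.
  - by apply: emeasurable_funD => //; exact: emeasurable_funM.
  - move=> x Dx; rewrite muleCA.
    rewrite [X in (_ <= _ + X)%E]muleC -ge0_muleDr ?expe_ge0 ?h0 ?lee_fin//.
    by rewrite lee_wpmul2l ?lee_fin ?w0// tangent_powe// h0.
have A0 : (0 <= \int[m]_(x in D) ((w x)%:E * h x))%E.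
  by apply: integral_ge0 => x Dx; rewrite mule_ge0 ?lee_fin ?w0// h0.
move: A0 key; case: (\int[m]_(x in D) ((w x)%:E * h x))%E => [a| |//] a0 key.
- have := key a a0.
  rewrite -EFinM -mulrA -exprSr -natr1 mulrDl mul1r EFinD addeC leeD2rE//.
  by rewrite EFin_expe.
- have := key 1 ler01; rewrite !expr1n !mulr1 gt0_muley ?lte_fin//.
  rewrite leye_eq; case: (\int[m]_(x in D) _)%E => // _.
  by rewrite leey.
Qed.

End jensen.

Section integrable_real.
Context d (T : measurableType d) (R : realType).
Variables (m : {measure set T -> \bar R}) (D : set T) (mD : measurable D).
Implicit Types f g : T -> R.

Lemma integrable_realB f g : m.-integrable D (EFin \o f) ->
  m.-integrable D (EFin \o g) -> m.-integrable D (EFin \o (fun x => f x - g x)).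
Proof.
move=> hf hg; have := integrableB mD hf hg; exact: eq_integrable.
Qed.

Lemma integrable_realD f g : m.-integrable D (EFin \o f) ->
  m.-integrable D (EFin \o g) -> m.-integrable D (EFin \o (fun x => f x + g x)).
Proof.
move=> hf hg; have := (integrableD mD hf hg); exact: eq_integrable.
Qed.

Lemma integrable_realZ c f : m.-integrable D (EFin \o f) ->
  m.-integrable D (EFin \o (fun x => c * f x)).
Proof.
move=> hf; have := (integrableZl mD c hf); exact: eq_integrable.
Qed.

Lemma integrable_real_le f g : measurable_fun D f -> m.-integrable D (EFin \o g) ->
  (forall x, D x -> `|f x| <= g x) -> m.-integrable D (EFin \o f).
Proof.
move=> mf hg fg; apply: (le_integrable mD _ _ hg); first exact/measurable_EFinP.
by move=> x Dx /=; rewrite lee_fin (le_trans (fg x Dx))// ler_norm.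
Qed.

Lemma integrable_cst_lty (c : R) : (m D < +oo)%E -> m.-integrable D (EFin \o cst c).
Proof.
move=> Doo; apply/integrableP; split; first by apply/measurable_EFinP.
by rewrite /= integral_cst// lte_mul_pinfty.
Qed.

Lemma integrable_real_sum I (s : seq I) (f : I -> T -> R) :
  (forall i, m.-integrable D (EFin \o f i)) ->
  m.-integrable D (EFin \o (fun x => \sum_(i <- s) f i x)).
Proof.
move=> hf; elim: s => [|i s IH].
  by have := (integrable0 m D); apply: eq_integrable => // x _ /=; rewrite big_nil.
have := (integrable_realD (hf i) IH); apply: eq_integrable => // x _ /=.
by rewrite big_cons.
Qed.

Lemma Rintegral_sum I (s : seq I) (f : I -> T -> R) :
  (forall i, m.-integrable D (EFin \o f i)) ->
  \int[m]_(x in D) (\sum_(i <- s) f i x) = \sum_(i <- s) \int[m]_(x in D) f i x.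
Proof.
move=> hf; elim: s => [|i s IH].
  rewrite big_nil (@eq_Rintegral _ _ _ _ _ (cst 0)); last by move=> x _; rewrite big_nil.
  by rewrite /Rintegral integral0.
under eq_Rintegral do rewrite big_cons.
by rewrite RintegralD ?IH ?big_cons//; exact: integrable_real_sum.
Qed.

Lemma Rintegral_EFin f : m.-integrable D (EFin \o f) ->
  (\int[m]_(x in D) f x)%:E = (\int[m]_(x in D) (f x)%:E)%E.
Proof. by move=> hf; rewrite /Rintegral fineK//; exact: integrable_fin_num. Qed.

End integrable_real.

Lemma cvg_EFinr (R : realType) (u : nat -> R) (l : R) :
  u k @[k --> \oo] --> l -> (u k)%:E @[k --> \oo] --> l%:E.
Proof. by move=> h; apply: cvg_EFin => //; exact: nearW. Qed.

Section pratt.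
Context d (T : measurableType d) (R : realType).
Variable m : {measure set T -> \bar R}.

(** Fatou's lemma for a bound that holds eventually. *)
Lemma fatou_le (D : set T) (F : nat -> T -> \bar R) (F0 : T -> \bar R) (C : \bar R) :
  measurable D -> (forall k, measurable_fun D (F k)) ->
  (forall k x, D x -> (0 <= F k x)%E) ->
  {ae m, forall x, D x -> F k x @[k --> \oo] --> F0 x} ->
  measurable_fun D F0 -> (forall x, D x -> (0 <= F0 x)%E) ->
  (\forall k \near \oo, (\int[m]_(x in D) F k x <= C)%E) ->
  (\int[m]_(x in D) F0 x <= C)%E.
Proof.
move=> mD mF F_ge0 FF0 mF0 F0_ge0 FC.
have -> : (\int[m]_(x in D) F0 x = \int[m]_(x in D) limn_einf (F^~ x))%E.
  apply: ae_eq_integral => //.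
    apply: (@emeasurable_fun_cvg _ _ _ _ (fun k x => einfs (F^~ x) k)).
      by move=> k; exact: measurable_fun_einfs.
    by move=> x Dx; rewrite limn_einf_lim; exact: is_cvg_einfs.
  apply: filterS FF0 => x h Dx.
  by rewrite (cvg_limn_einf_sup (h Dx)).1.
apply: le_trans (fatou m mD mF F_ge0) _.
have [N _ hN] := FC.
rewrite limn_einf_lim; apply: lime_le.
  exact: is_cvg_einfs.
exists N => // k /= Nk.
apply: (le_trans (ereal_inf_lbound _) (hN k Nk)).
by exists k => /=.
Qed.

(** Dominated convergence with varying majorants (Pratt): clip the functions
    at the limit majorant; the clipping error is at most the integral of
    the positive part of [D k - D0], which equals that of the positive part of
    [D0 - D k] because the majorants have equal integrals, and the latter is
    dominated by [D0]. *)
Lemma pratt (F : nat -> T -> R) (F0 : T -> R) (D : nat -> T -> R) (D0 : T -> R) :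
  (forall k, measurable_fun setT (F k)) -> measurable_fun setT F0 ->
  (forall k, measurable_fun setT (D k)) -> m.-integrable setT (EFin \o D0) ->
  (forall x, 0 <= D0 x) ->
  (forall k, \int[m]_x (D k x)%:E = \int[m]_x (D0 x)%:E)%E ->
  (forall k x, `|F k x| <= D k x) ->
  {ae m, forall x, F k x @[k --> \oo] --> F0 x} ->
  {ae m, forall x, D k x @[k --> \oo] --> D0 x} ->
  m.-integrable setT (EFin \o F0) /\
  (\int[m]_x F k x)%R @[k --> \oo] --> (\int[m]_x F0 x)%R.
Proof.
move=> mF mF0 mD iD0 D0_ge0 eqD FD cvF cvD.
have mD0 : measurable_fun setT D0 by apply/measurable_EFinP; exact: measurable_int iD0.
have Dk0 k x : 0 <= D k x by exact: le_trans (FD k x).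
have iD k : m.-integrable setT (EFin \o D k).
  apply/integrableP; split; first exact/measurable_EFinP.
  under eq_integral do rewrite /= ger0_norm//.
  rewrite eqD; have /integrableP[_] := iD0.
  by under eq_integral do rewrite /= ger0_norm//.
have iF k : m.-integrable setT (EFin \o F k).
  apply: le_integrable (iD k) => //; first exact/measurable_EFinP.
  by move=> x _ /=; rewrite lee_fin (ger0_norm (Dk0 k x)).
pose P k x := Num.max 0 (D0 x - D k x).
pose P' k x := Num.max 0 (D k x - D0 x).
have mP k : measurable_fun setT (P k).
  by apply: measurable_maxr => //; exact: measurable_funB.
have mP' k : measurable_fun setT (P' k).
  by apply: measurable_maxr => //; exact: measurable_funB.
have P0 k x : 0 <= P k x by rewrite le_max lexx.
have P'0 k x : 0 <= P' k x by rewrite le_max lexx.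
have PD k x : P k x <= D0 x by rewrite ge_max D0_ge0 lerBlDr lerDl Dk0.
have P'D k x : P' k x <= D k x by rewrite ge_max Dk0 lerBlDr lerDl D0_ge0.
have iP k : m.-integrable setT (EFin \o P k).
  apply: le_integrable iD0 => //; first exact/measurable_EFinP.
  by move=> x _ /=; rewrite lee_fin !ger0_norm.
have iP' k : m.-integrable setT (EFin \o P' k).
  apply: le_integrable (iD k) => //; first exact/measurable_EFinP.
  by move=> x _ /=; rewrite lee_fin !ger0_norm.
have PP' k : (\int[m]_x P' k x = \int[m]_x P k x)%R.
  have : (\int[m]_x (P' k x + D0 x) = \int[m]_x (P k x + D k x))%R.
    apply: eq_Rintegral => x _; rewrite /P /P'.
    by have [h1|h1] := leP 0 (D k x - D0 x); have [h2|h2] := leP 0 (D0 x - D k x); lra.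
  rewrite !RintegralD// => h.
  have h' : (\int[m]_x D k x = \int[m]_x D0 x)%R by rewrite /Rintegral eqD.
  by move: h; rewrite h' => /addIr.
have cvP : (\int[m]_x P k x)%R @[k --> \oo] --> (0 : R).
  have [|||||_ _ h] := @dominated_convergence _ _ _ m setT measurableT
      (fun k x => (P k x)%:E) (cst 0%E) (EFin \o D0).
  - by move=> k; exact/measurable_EFinP.
  - exact: measurable_cst.
  - apply: filterS cvD => x h _; apply: cvg_EFinr.
    apply/cvgr0Pnorm_le => e e0; move/cvgrPdist_le : h => /(_ e e0).
    apply: filterS => k; rewrite (ger0_norm (P0 k x)) /P ge_max (ltW e0)/=.
    exact/le_trans/ler_norm.
  - exact: iD0.
  - by apply: aeW => x k _ /=; rewrite lee_fin ger0_norm.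
  - by move: h; rewrite integral0 => /fine_cvg.
(* The clipped functions are dominated by [D0]. *)
pose Fh k x := Num.max (- D0 x) (Num.min (D0 x) (F k x)).
have mFh k : measurable_fun setT (Fh k).
  apply: measurable_maxr; first exact: measurable_funN.
  exact: measurable_minr.
have FhD k x : `|Fh k x| <= D0 x.
  rewrite ler_norml; apply/andP; split; first by rewrite le_max lexx.
  rewrite ge_max ge_min lexx andbT.
  by have := D0_ge0 x; lra.
have FFh k x : `|F k x - Fh k x| <= P' k x.
  have := FD k x; have := D0_ge0 x; rewrite ler_norml /Fh /P' => ? /andP[? ?].
  rewrite ler_norml.
  have [h1|h1] := leP (D0 x) (F k x); have [h2|h2] := leP 0 (D k x - D0 x);
    [have [h3|h3] := leP (- D0 x) (D0 x)|have [h3|h3] := leP (- D0 x) (D0 x)|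
     have [h3|h3] := leP (- D0 x) (F k x)|have [h3|h3] := leP (- D0 x) (F k x)];
     lra.
have [|||||iF0 _ cvFh] := @dominated_convergence _ _ _ m setT measurableT
      (fun k x => (Fh k x)%:E) (EFin \o F0) (EFin \o D0).
- by move=> k; exact/measurable_EFinP.
- exact/measurable_EFinP.
- apply: filterS2 cvF cvD => x hF hD _; apply: cvg_EFinr.
  have F0D : `|F0 x| <= D0 x.
    by apply: (ler_cvg_to (cvg_norm hF) hD); exact: nearW.
  apply/cvgrPdist_le => e e0; move/cvgrPdist_le : hF => /(_ e e0).
  apply: filterS => k; move: F0D; rewrite !ler_norml /Fh => /andP[? ?] /andP[? ?].
  by have [?|?] := leP (D0 x) (F k x);
    [have [?|?] := leP (- D0 x) (D0 x)|have [?|?] := leP (- D0 x) (F k x)];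
    apply/andP; split; lra.
- exact: iD0.
- by apply: aeW => x k _ /=; rewrite lee_fin.
split => //.
have iFh k : m.-integrable setT (EFin \o Fh k).
  apply: le_integrable iD0 => //; first exact/measurable_EFinP.
  by move=> x _ /=; rewrite lee_fin (ger0_norm (D0_ge0 x)).
have {}cvFh : (\int[m]_x Fh k x)%R @[k --> \oo] --> (\int[m]_x F0 x)%R.
  by apply: fine_cvg; rewrite fineK//; exact: integrable_fin_num.
have -> : (fun k => \int[m]_x F k x)%R =
    (fun k => (\int[m]_x Fh k x)%R + ((\int[m]_x F k x)%R - (\int[m]_x Fh k x)%R)).
  by apply/funext => k; ring.
rewrite -[X in _ --> X]addr0; apply: cvgD => //.
apply/cvgr0Pnorm_le => e e0.
move/cvgr0_norm_le : cvP => /(_ _ e0); apply: filterS => k /=.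
rewrite -PP' ger0_norm ?Rintegral_ge0// => h.
rewrite -RintegralB// (le_trans _ h)//.
have iFF := integrable_realB measurableT (iF k) (iFh k).
apply: le_trans (le_normr_Rintegral measurableT iFF) _.
apply: le_Rintegral => //.
exact: integrable_norm.
Qed.

End pratt.

(** * Vitali coverings and the maximal function *)

Section vitali.
Context {R : realType} {n : nat}.
Local Notation E := 'cV[R]_n.
Local Notation mu := (@lebesgue_cV R n).

Lemma ball_normP (x : E) r y : ball x r y <-> `|x - y| < r.
Proof. by rewrite -ball_normE. Qed.

Lemma ball_subset_triple (x y : E) (r s : R) : r <= s ->
  ball x r `&` ball y s !=set0 -> ball x r `<=` ball y (3 * s).
Proof.
move=> rs [z [/ball_normP xz /ball_normP yz]] w /ball_normP xw; apply/ball_normP.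
have -> : y - w = (y - z) - (x - z) + (x - w).
  by apply/matrixP => i j; rewrite !mxE; ring.
have := ler_normD ((y - z) - (x - z)) (x - w).
have := ler_normB (y - z) (x - z).
lra.
Qed.

(** Greedy selection by decreasing radius. *)
Lemma vitali_cubes (I : eqType) (c : I -> E) (rho : I -> R) (s : seq I) :
  exists D : seq I, [/\ uniq D, {subset D <= s},
    trivIset [set` D] (fun i => ball (c i) (rho i)) &
    forall i, i \in s -> 0 < rho i ->
      exists2 j, j \in D & ball (c i) (rho i) `<=` ball (c j) (3 * rho j)].
Proof.
pose LE i j := rho i <= rho j.
have LEtr : transitive LE by move=> x y z; exact: le_trans.
suff H : forall s, sorted LE s -> exists D : seq I, [/\ uniq D, {subset D <= s},
    trivIset [set` D] (fun i => ball (c i) (rho i)) &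
    forall i, i \in s -> 0 < rho i ->
      exists2 j, j \in D & ball (c i) (rho i) `<=` ball (c j) (3 * rho j)].
  have [D [uD Ds tD hD]] := H (sort LE s) (sort_sorted (fun x y => le_total _ _) s).
  exists D; split => //; first by move=> i /Ds; rewrite mem_sort.
  by move=> i; rewrite -(mem_sort LE); exact: hD.
elim => [_|i t IH /= it]; first by exists [::]; split => // i j.
have [D [uD Ds tD hD]] := IH (path_sorted it).
have [h|/existsNP[j /not_implyP[jD /eqP/set0P ij]]] :=
    pselect (forall j, j \in D -> ball (c i) (rho i) `&` ball (c j) (rho j) = set0).
- have [iD|iD] := boolP (i \in D).
    exists D; split => //; first by move=> j /Ds; rewrite inE orbC => ->.
    move=> j; rewrite inE => /predU1P[->|]; last exact: hD.
    by move=> r0; exists i => //; apply: le_ball; lra.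
  exists (i :: D); split => //=; first by rewrite iD.
  + by move=> j; rewrite !inE => /predU1P[->|/Ds ->]; rewrite ?eqxx ?orbT.
  + move=> j k /=; rewrite !inE => /predU1P[->|jD] /predU1P[->|kD] //.
    * by rewrite h// => -[].
    * by rewrite setIC h// => -[].
    * exact: tD.
  + move=> j; rewrite inE => /predU1P[->|jt] r0.
      by exists i; rewrite ?mem_head//; apply: le_ball; lra.
    by have [k kD jk] := hD j jt r0; exists k => //; rewrite inE kD orbT.
- exists D; split => //; first by move=> k /Ds; rewrite inE orbC => ->.
  move=> k; rewrite inE => /predU1P[->|]; last exact: hD.
  move=> r0; exists j => //; apply: ball_subset_triple => //.
  by have /allP/(_ _ (Ds _ jD)) := order_path_min LEtr it.
Qed.

Lemma cube_enumeration : exists (c : nat -> E) (rho : nat -> R),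
  forall (x : E) (r : R), 0 < r ->
  exists k, [/\ ball x r `<=` ball (c k) (rho k), 0 < rho k & rho k <= 2 * r].
Proof.
pose q k := odflt (0, 0) (unpickle k : option ('cV[rat]_n * rat)).
exists (fun k => \col_i ratr ((q k).1 i ord0)), (fun k => ratr (q k).2) => x r r0.
have [s /andP[rs sr]] : exists s : rat, (3 / 2 * r < ratr s < 2 * r)%R.
  have : 3 / 2 * r < 2 * r by lra.
  by move=> /rat_in_itvoo[s]; rewrite in_itv/= => ?; exists s.
have h i : exists p : rat, `|ratr p - x i ord0| < r / 2.
  have : x i ord0 - r / 2 < x i ord0 + r / 2 by lra.
  move=> /rat_in_itvoo[p]; rewrite in_itv/= => /andP[? ?].
  by exists p; rewrite ltr_norml; apply/andP; split; lra.
have [p hp] := choice h.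
have s0 : 0 < ratr s :> R by lra.
exists (pickle (\col_i p i, s)); rewrite /q pickleK; split; [|exact: s0|exact: ltW].
move=> y /(ballcVP _ _ r0) hy; apply/ballcVP => // i; rewrite mxE /= mxE.
have := hy i; have := hp i => h1 h2.
rewrite -(subrK (x i ord0) (ratr (p i))) -addrA.
by rewrite (le_lt_trans (ler_normD _ _))//; lra.
Qed.

(** Weak-type bound for the maximal function.  The set of large averages is
    covered by countably many rational cubes, to finitely many of which the
    covering lemma applies. *)
Lemma maximal_inequality (h : E -> R) (l : R) : 0 < l ->
  mu.-integrable setT (EFin \o h) ->
  exists A : set E, [/\ measurable A,
    [set x | exists2 r, 0 < r &
       ((l * r ^+ n)%:E < \int[mu]_(y in ball x r) `|h y|%:E)%E] `<=` A &
    (mu A <= (12 ^+ n / l)%:E * \int[mu]_y `|h y|%:E)%E].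
Proof.
move=> l0 ih.
have mh : measurable_fun setT (fun y => `|h y|%:E).
  apply/measurable_EFinP; apply: measurableT_comp => //.
  by apply/measurable_EFinP; exact: measurable_int ih.
have [c [rho hc]] := cube_enumeration.
pose Q k : set E := ball (c k) (rho k).
pose bad k := `[< 0 < rho k /\
   ((l * (rho k / 2) ^+ n)%:E < \int[mu]_(y in Q k) `|h y|%:E)%E >].
pose s N := [seq k <- iota 0 N | bad k].
pose F N : set E := \big[setU/set0]_(k <- s N) Q k.
have mQ k : measurable (Q k) by exact: measurable_ball_cV.
have mF N : measurable (F N) by apply: bigsetU_measurable => k _; exact: mQ.
have sP N k : k \in s N -> bad k by rewrite mem_filter => /andP[].
have C0 : 0 <= 12 ^+ n / l by rewrite divr_ge0// ?exprn_ge0// ltW.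
exists (\bigcup_N F N); split; first exact: bigcup_measurable.
- move=> x [r r0 hr]; have [k [xk k0 k2]] := hc x r r0.
  have bk : bad k.
    apply/asboolP; split; first exact: k0.
    have e1 : ((l * (rho k / 2) ^+ n)%:E <= (l * r ^+ n)%:E)%E.
      rewrite lee_fin ler_pM2l//; apply: lerXn2r; rewrite ?nnegrE; lra.
    have e2 : (\int[mu]_(y in ball x r) `|h y|%:E <= \int[mu]_(y in Q k) `|h y|%:E)%E.
      apply: ge0_subset_integral => //; first exact: measurable_ball_cV.
      exact: measurable_funTS.
    exact: le_lt_trans e1 (lt_le_trans hr e2).
  exists k.+1 => //; rewrite /F -bigcup_seq; exists k => //=; last by apply: xk; exact: ballxx.
  by rewrite mem_filter bk mem_iota add0n ltnS leqnn.
(* The disjoint cubes selected from [s N] have total volume controlled by the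
   integral of [|h|], and their triples cover [F N]. *)
have FN N : (mu (F N) <= (12 ^+ n / l)%:E * \int[mu]_y `|h y|%:E)%E.
  have [D [uD Ds tD hD]] := vitali_cubes c rho (s N).
  pose B k : set E := ball (c k) (3 * rho k).
  have mB k : measurable (B k) by exact: measurable_ball_cV.
  have FB : F N `<=` \big[setU/set0]_(k <- D) B k.
    move=> x; rewrite /F -!bigcup_seq => -[k /= ks xk].
    have /asboolP[k0 _] := sP _ _ ks.
    by have [j jD kj] := hD k ks k0; exists j => //; exact: kj.
  apply: (@le_trans _ _ (\sum_(k <- D) mu (B k))%E).
    have mBD : measurable (\big[setU/set0]_(k <- D) B k) by exact: bigsetU_measurable.
    apply: le_trans (le_measure mu _ _ FB) _; rewrite ?inE//.
    elim: D {uD Ds tD hD FB mBD} => [|k D IH]; first by rewrite !big_nil measure0.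
    rewrite !big_cons (le_trans (measureU2 _ _ _))//; first exact: bigsetU_measurable.
    by rewrite leeD2l.
  apply: (@le_trans _ _ (\sum_(k <- D) ((12 ^+ n / l)%:E * \int[mu]_(y in Q k) `|h y|%:E))%E).
    rewrite !big_seq; apply: lee_sum => k kD.
    have /asboolP[k0 kb] := sP _ _ (Ds _ kD).
    rewrite /B lebesgue_cV_ball ?mulr_gt0//.
    rewrite [leLHS](_ : _ = (12 ^+ n / l)%:E * (l * (rho k / 2) ^+ n)%:E)%E; last first.
      rewrite -EFinM; congr (_%:E); rewrite -mulrA (mulrA l^-1) mulVf ?gt_eqF// mul1r -exprMn.
      by congr (_ ^+ _); field.
    by apply: lee_wpmul2l; [rewrite lee_fin|exact: ltW].
  rewrite -ge0_sume_distrr; last by move=> k _; exact: integral_ge0.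
  apply: lee_wpmul2l; first by rewrite lee_fin.
  rewrite -ge0_integral_bigsetU//; last exact: measurable_funTS.
  by apply: ge0_subset_integral => //; exact: bigsetU_measurable.
have ndF : nondecreasing_seq F.
  move=> N M NM; apply/subsetPset => x.
  rewrite /F -!bigcup_seq => -[k /= ks xk]; exists k => //=.
  move: ks; rewrite !mem_filter => /andP[-> ]/=; rewrite !mem_iota !add0n/= => h'.
  exact: leq_trans h' NM.
have := nondecreasing_cvg_mu (mu := mu) mF (bigcup_measurable (fun N _ => mF N)) ndF.
move=> /cvg_lim <-//; apply: lime_le; last exact: nearW.
apply: ereal_nondecreasing_is_cvgn => N M NM.
by apply: le_measure; rewrite ?inE//; apply/subsetPset; exact: ndF.
Qed.

End vitali.

(** * Lebesgue points *)

Section lebesgue_points.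
Context {R : realType} {n : nat}.
Local Notation E := 'cV[R]_n.
Local Notation mu := (@lebesgue_cV R n).

(** Lebesgue points in the sense of N-th powers: the mean of [|g - g x| ^+ N]
    over small cubes tends to zero.  The factor [2 ^+ n] of the volume is left
    out. *)
Definition leb_pt N (g : E -> R) x := forall e, 0 < e -> \forall r \near 0^'+,
  (\int[mu]_(y in ball x r) (`|g y - g x| ^+ N)%:E <= (e * r ^+ n)%:E)%E.

Definition ae_leb (g : E -> R) := {ae mu, forall x, leb_pt 1 g x}.

Lemma negligible_small (B : set E) :
  (forall d : R, 0 < d -> exists A, [/\ measurable A, B `<=` A & (mu A <= d%:E)%E]) ->
  mu.-negligible B.
Proof.
move=> h.
have h' k : exists A, [/\ measurable A, B `<=` A & (mu A <= (k.+1%:R^-1)%:E)%E].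
  by apply: h; rewrite invr_gt0.
have [A hA] := choice h'.
have mA : measurable (\bigcap_k A k) by apply: bigcapT_measurable => k; have [] := hA k.
exists (\bigcap_k A k); split => //; last by move=> x Bx k _; have [_ BA _] := hA k; exact: BA.
apply/eqP; rewrite -measure_le0; apply/lee_addgt0Pr => e e0; rewrite add0e.
have [k hk] : exists k : nat, (k.+1%:R^-1 : R) < e.
  by have [k _ /(_ _ (leqnn k))] := near_infty_natSinv_lt (PosNum e0); exists k.
have [_ _ muA] := hA k; apply: (@le_trans _ _ (mu (A k))); last by rewrite (le_trans muA)// lee_fin ltW.
by apply: le_measure; rewrite ?inE//; [have [] := hA k|move=> x; exact].
Qed.

Lemma cts_measurable_norm (D : set E) (g : E -> R) (c : R) : measurable_fun D g ->
  measurable_fun D (fun y => `|g y - c|%:E).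
Proof.
move=> mg; apply/measurable_EFinP; apply: measurableT_comp => //.
exact: measurable_funB.
Qed.

(** The good functions form a closed subset of [L^1]: up to a null set, the bad
    points of [g] at level [l] lie in the set where the maximal function of [g - h],
    or [g - h] itself, is of order [l]. *)
Lemma ae_leb_closed (g : E -> R) : mu.-integrable setT (EFin \o g) ->
  (forall d, 0 < d -> exists h, [/\ mu.-integrable setT (EFin \o h), ae_leb h &
     (\int[mu]_y `|g y - h y|%:E <= d%:E)%E]) -> ae_leb g.
Proof.
move=> ig gh.
have mg : measurable_fun setT g by apply/measurable_EFinP; exact: measurable_int ig.
pose bad l := [set x | ~ \forall r \near 0^'+,
  (\int[mu]_(y in ball x r) (`|g y - g x|)%:E <= (l * r ^+ n)%:E)%E].
suff H l : 0 < l -> mu.-negligible (bad l).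
  have : mu.-negligible (\bigcup_k bad k.+1%:R^-1).
    by apply: negligible_bigcup => k; apply: H; rewrite invr_gt0.
  apply: negligibleS => x /= /existsNP[e /not_implyP[e0 he]].
  have [k hk] : exists k : nat, (k.+1%:R^-1 : R) <= e.
    by have [k _ /(_ _ (leqnn k))/ltW] := near_infty_natSinv_lt (PosNum e0); exists k.
  exists k => //= h; apply: he; near=> r.
  under eq_integral do rewrite expr1.
  have r0 : 0 <= r ^+ n by rewrite exprn_ge0// ltW//; near: r; exact: nbhs_right_gt.
  by apply: (@le_trans _ _ (k.+1%:R^-1 * r ^+ n)%:E); [near: r|rewrite lee_fin ler_wpM2r].
move=> l0; apply: negligible_small => d d0.
pose l1 := l / 3.
have l10 : 0 < l1 by rewrite divr_gt0.
pose c1 : R := 12 ^+ n / l1. pose c2 : R := 2 ^+ n / l1.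
have c10 : 0 < c1 by rewrite divr_gt0// exprn_gt0.
have c20 : 0 < c2 by rewrite divr_gt0// exprn_gt0.
have d10 : 0 < d / (c1 + c2) by rewrite divr_gt0// addr_gt0.
have [h [ih [N [mN N0 hN]] hgh]] := gh _ d10.
have mh : measurable_fun setT h by apply/measurable_EFinP; exact: measurable_int ih.
have igh := integrable_realB measurableT ig ih.
have mgh : measurable_fun setT (fun y => g y - h y) by exact: measurable_funB.
have [A [mA hA muA]] := maximal_inequality l10 igh.
pose B := [set x | ((l1 / 2 ^+ n)%:E <= `|(g x - h x)%:E|)%E].
have mB : measurable B.
  rewrite -[X in measurable X]setTI.
  apply: emeasurable_fun_c_infty => //.
  by apply: measurableT_comp => //; exact/measurable_EFinP.
have muB : (mu B <= c2%:E * \int[mu]_y `|g y - h y|%:E)%E.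
  have l2 : 0 < l1 / 2 ^+ n by rewrite divr_gt0// exprn_gt0.
  have := le_integral_abse mu measurableT (measurable_int mu igh) l2.
  rewrite setTI => hle.
  rewrite -(@lee_pmul2l _ (l1 / 2 ^+ n)%:E)// ?lte_fin// muleA -EFinM.
  rewrite (_ : l1 / 2 ^+ n * c2 = 1) ?mul1e//.
  by rewrite /c2 mulrA divfK ?mulfV ?gt_eqF// exprn_gt0.
exists (N `|` A `|` B); split.
- by apply: measurableU => //; exact: measurableU.
- move=> x badx; apply: contrapT; rewrite /setU/= => /not_orP[/not_orP[Nx Ax] Bx]; apply: badx.
  have hx : leb_pt 1 h x by apply: contrapT => hx; apply: Nx; apply: hN.
  have Ax' r : 0 < r -> (\int[mu]_(y in ball x r) `|g y - h y|%:E <= (l1 * r ^+ n)%:E)%E.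
    by move=> r0; rewrite leNgt; apply/negP => hlt; apply: Ax; apply: hA; exists r.
  have Bx' : `|g x - h x| <= l1 / 2 ^+ n.
    by rewrite leNgt; apply/negP => hlt; apply: Bx; rewrite /B/= lee_fin ltW.
  near=> r.
  have r0 : 0 < r by near: r; exact: nbhs_right_gt.
  have mb : measurable (ball x r) by exact: measurable_ball_cV.
  have h1 : (\int[mu]_(y in ball x r) (`|h y - h x|)%:E <= (l1 * r ^+ n)%:E)%E.
    by near: r; have := hx _ l10; apply: filterS => r; under eq_integral do rewrite expr1.
  have h3 : (\int[mu]_(y in ball x r) (`|g x - h x|)%:E <= (l1 * r ^+ n)%:E)%E.
    rewrite integral_cst// [X in (_ * X)%E]lebesgue_cV_ball// -EFinM lee_fin.
    rewrite exprMn mulrA ler_pM2r ?exprn_gt0//.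
    by rewrite -ler_pdivlMr ?exprn_gt0.
  have -> : l * r ^+ n = l1 * r ^+ n + l1 * r ^+ n + l1 * r ^+ n by rewrite /l1; field.
  rewrite 2!EFinD; apply: le_trans (leeD (leeD (Ax' r r0) h1) h3).
  have m1 := cts_measurable_norm (h x) (measurable_funTS (D := ball x r) mh).
  have m2 : measurable_fun (ball x r) (fun y => `|g y - h y|%:E).
    apply/measurable_EFinP; apply: measurableT_comp => //; exact: measurable_funTS.
  rewrite -ge0_integralD//.
  rewrite -ge0_integralD//; try by [exact: emeasurable_funD|move=> *; exact: adde_ge0].
  apply: ge0_le_integral => //.
  + by apply: cts_measurable_norm; exact: measurable_funTS.
  + by apply: emeasurable_funD => //; exact: emeasurable_funD.
  + move=> y _; rewrite -!EFinD lee_fin.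
    have -> : g y - g x = (g y - h y) + (h y - h x) - (g x - h x) by ring.
    by rewrite (le_trans (ler_normB _ _))// lerD2r ler_normD.
- apply: (@le_trans _ _ (mu (N `|` A) + mu B)%E).
    by apply: measureU2 => //; exact: measurableU.
  apply: (@le_trans _ _ (mu A + mu B)%E).
    by rewrite leeD2r// (le_trans (measureU2 _ _ _))// [X in (X + _)%E]N0 add0e.
  apply: le_trans (leeD muA muB) _.
  have -> : (((12 ^+ n / l1)%:E * (\int[mu]_y `|g y - h y|%:E) + c2%:E * (\int[mu]_y `|g y - h y|%:E)) =
      (c1 + c2)%:E * (\int[mu]_y `|g y - h y|%:E))%E.
    by rewrite EFinD ge0_muleDl// lee_fin ltW.
  have -> : d%:E = ((c1 + c2)%:E * (d / (c1 + c2))%:E)%E.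
    by rewrite -EFinM mulrC divfK// gt_eqF// addr_gt0.
  by apply: lee_wpmul2l; [rewrite lee_fin ltW// addr_gt0|exact: hgh].
Unshelve. all: end_near. Qed.

Lemma leb_pt_near (g : E -> R) x (c : R) :
  (\forall y \near x, g y = c) -> leb_pt 1 g x.
Proof.
move=> h e e0; have gx : g x = c by exact: nbhs_singleton h.
have /nbhs_ballP[d /= d0 hd] := h.
near=> r; have r0 : 0 < r by near: r; exact: nbhs_right_gt.
rewrite integral0_eq ?lee_fin ?mulr_ge0 ?exprn_ge0 ?ltW// => y xy.
rewrite expr1 gx hd ?subrr ?normr0//; apply: le_ball xy.
by near: r; exact: nbhs_right_le.
Unshelve. all: end_near. Qed.

Lemma leb_ptB (g h : E -> R) x : measurable_fun setT g -> measurable_fun setT h ->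
  leb_pt 1 g x -> leb_pt 1 h x -> leb_pt 1 (fun y => g y - h y) x.
Proof.
move=> mg mh hg hh e e0; near=> r.
have r0 : 0 < r by near: r; exact: nbhs_right_gt.
have mb : measurable (ball x r) by exact: measurable_ball_cV.
under eq_integral do rewrite expr1.
have hg' : (\int[mu]_(y in ball x r) (`|g y - g x|)%:E <= (e / 2 * r ^+ n)%:E)%E.
  near: r; have e2 : 0 < e / 2 by rewrite divr_gt0.
  by have := hg _ e2; apply: filterS => r; under eq_integral do rewrite expr1.
have hh' : (\int[mu]_(y in ball x r) (`|h y - h x|)%:E <= (e / 2 * r ^+ n)%:E)%E.
  near: r; have e2 : 0 < e / 2 by rewrite divr_gt0.
  by have := hh _ e2; apply: filterS => r; under eq_integral do rewrite expr1.
rewrite (splitr e) mulrDl EFinD; apply: le_trans (leeD hg' hh').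
have m1 := cts_measurable_norm (h x) (measurable_funTS (D := ball x r) mh).
have m2 := cts_measurable_norm (g x) (measurable_funTS (D := ball x r) mg).
rewrite -ge0_integralD//.
apply: ge0_le_integral => //.
- apply: cts_measurable_norm; apply: measurable_funTS; exact: measurable_funB.
- exact: emeasurable_funD.
- move=> y _; rewrite -EFinD lee_fin.
  have -> : g y - h y - (g x - h x) = (g y - g x) - (h y - h x) by ring.
  exact: ler_normB.
Unshelve. all: end_near. Qed.

Lemma leb_ptZ (g : E -> R) k x : measurable_fun setT g ->
  leb_pt 1 g x -> leb_pt 1 (fun y => k * g y) x.
Proof.
move=> mg hg e e0; have k0 : 0 < `|k| + 1 by rewrite ltr_wpDl.
have ek : 0 < e / (`|k| + 1) by rewrite divr_gt0.
near=> r.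
have r0 : 0 < r by near: r; exact: nbhs_right_gt.
have mb : measurable (ball x r) by exact: measurable_ball_cV.
have hg' : (\int[mu]_(y in ball x r) (`|g y - g x|)%:E <= (e / (`|k| + 1) * r ^+ n)%:E)%E.
  near: r; have := hg _ ek; apply: filterS => r.
  by under eq_integral do rewrite expr1.
have m2 := cts_measurable_norm (g x) (measurable_funTS (D := ball x r) mg).
rewrite (_ : e * r ^+ n = (`|k| + 1) * (e / (`|k| + 1) * r ^+ n)); last first.
  by field; rewrite gt_eqF.
rewrite EFinM; apply: le_trans (lee_wpmul2l _ hg'); last by rewrite lee_fin ltW.
rewrite -ge0_integralZl//.
under [leLHS]eq_integral do rewrite expr1.
apply: ge0_le_integral => //.
- apply: cts_measurable_norm; apply: measurable_funTS; exact: measurable_funM.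
- exact: emeasurable_funM.
- move=> y _; rewrite -EFinM lee_fin -mulrBr normrM ler_wpM2r// lerDl//.
Unshelve. all: end_near. Qed.

(** Bundling integrability makes the class stable under linear combinations and
    dominated limits, so that it can be enlarged from boxes to measurable sets
    and to all integrable functions. *)
Definition good (g : E -> R) := mu.-integrable setT (EFin \o g) /\ ae_leb g.

Lemma good_mfun g : good g -> measurable_fun setT g.
Proof. by move=> [ig _]; apply/measurable_EFinP; exact: measurable_int ig. Qed.

Lemma goodB g h : good g -> good h -> good (fun x => g x - h x).
Proof.
move=> gg gh; split; first by apply: integrable_realB => //; [exact: gg.1|exact: gh.1].
apply: filterS2 gg.2 gh.2 => x hg hh.
by apply: leb_ptB => //; exact: good_mfun.
Qed.

Lemma goodZ k g : good g -> good (fun x => k * g x).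
Proof.
move=> gg; split; first by apply: integrable_realZ => //; exact: gg.1.
by apply: filterS gg.2 => x hg; apply: leb_ptZ => //; exact: good_mfun.
Qed.

Lemma good0 : good (fun=> 0).
Proof.
split; first exact: integrable0.
by apply: aeW => x; apply: (@leb_pt_near (fun=> 0) x 0); near=> y.
Unshelve. all: end_near. Qed.

Lemma goodD g h : good g -> good h -> good (fun x => g x + h x).
Proof.
move=> gg gh; rewrite (_ : (fun x => _) = (fun x => g x - (0 - h x))).
  by apply: goodB => //; apply: goodB => //; exact: good0.
by apply/funext => x; rewrite sub0r opprK.
Qed.

Lemma good_sum (I : Type) (s : seq I) (g : I -> E -> R) :
  (forall i, good (g i)) -> good (fun x => \sum_(i <- s) g i x).
Proof.
move=> hg; elim: s => [|i s IH].
  by under eq_fun do rewrite big_nil; exact: good0.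
by under eq_fun do rewrite big_cons; exact: goodD.
Qed.

Lemma good_lim (g : nat -> E -> R) (g0 D : E -> R) :
  (forall k, good (g k)) -> mu.-integrable setT (EFin \o D) ->
  (forall k x, `|g k x| <= D x) -> (forall x, g k x @[k --> \oo] --> g0 x) -> good g0.
Proof.
move=> hg iD gD cv.
have mg k := good_mfun (hg k).
have mg0 : measurable_fun setT g0.
  apply/measurable_EFinP.
  apply: (@emeasurable_fun_cvg _ _ _ _ (fun k x => (g k x)%:E)).
    by move=> k; exact/measurable_EFinP.
  by move=> x _; apply: cvg_EFinr.
have [|||||ig0 h _] := @dominated_convergence _ _ _ mu setT measurableT
      (fun k x => (g k x)%:E) (EFin \o g0) (EFin \o D).
- by move=> k; exact/measurable_EFinP.
- exact/measurable_EFinP.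
- by apply: aeW => x _; apply: cvg_EFinr.
- exact: iD.
- by apply: aeW => x k _ /=; rewrite lee_fin.
split => //; apply: ae_leb_closed => // d d0.
have /fine_cvgP[_ /cvgrPdist_le/(_ _ d0)[K _ /(_ K (leqnn K))]] := h.
rewrite /= sub0r normrN => hK.
exists (g K); split; [exact: (hg K).1|exact: (hg K).2|].
have igK := integrable_realB measurableT ig0 (hg K).1.
have fin : (\int[mu]_x `|(g K x)%:E - (g0 x)%:E|)%E \is a fin_num.
  apply: integrable_fin_num => //; apply: (integrable_abse (f := fun x => ((g K x)%:E - (g0 x)%:E)%E)).
  have := integrable_realB measurableT (hg K).1 ig0.
  by apply: eq_integrable => // x _ /=; rewrite EFinB.
rewrite (eq_integral (fun x => `|(g K x)%:E - (g0 x)%:E|%E)); last first.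
  by move=> x _; rewrite -EFinB/= distrC.
rewrite -(fineK fin) lee_fin (le_trans _ hK)//; exact: ler_norm.
Qed.

Lemma integrable_indic_lty (A : set E) : measurable A -> (mu A < +oo)%E ->
  mu.-integrable setT (EFin \o \1_A).
Proof.
move=> mA Aoo; apply/integrableP; split.
  by apply/measurable_EFinP; exact: measurable_indic.
under eq_integral do rewrite /= ger0_norm//.
by rewrite integral_indic// setIT.
Qed.

(* Off the boundary, which is null since open and closed boxes have the same
   measure, the indicator of a box is locally constant. *)
Lemma good_box (a b : 'I_n -> R) :
  good \1_[set x : E | forall i, `]a i, b i[%classic (x i ord0)].
Proof.
set B := [set x | _].
pose C := [set x : E | forall i, `[a i, b i]%classic (x i ord0)].
have mB : measurable B by apply: (@measurable_box _ _ (fun i => `]a i, b i[%classic)) => i; exact: measurable_itv.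
have mC : measurable C by apply: (@measurable_box _ _ (fun i => `[a i, b i]%classic)) => i; exact: measurable_itv.
have muB : mu B = (\prod_(i < n) lebesgue_measure `]a i, b i[%classic)%E.
  by apply: (@lebesgue_cV_box _ _ (fun i => `]a i, b i[%classic)) => i; exact: measurable_itv.
have muC : mu C = (\prod_(i < n) lebesgue_measure `[a i, b i]%classic)%E.
  by apply: (@lebesgue_cV_box _ _ (fun i => `[a i, b i]%classic)) => i; exact: measurable_itv.
have BC : B `<=` C by move=> x Bx i; apply: subset_itv_oo_cc; exact: Bx.
have muBC : mu B = mu C.
  by rewrite muB muC; apply: eq_bigr => i _; rewrite !lebesgue_measure_itv.
have muBfin : (mu B < +oo)%E.
  rewrite muB; under eq_bigr do rewrite lebesgue_measure_itv/=.
  rewrite (eq_bigr (fun i => (if a i < b i then b i - a i else 0)%:E)).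
    by rewrite prodEFin ltry.
  by move=> i _; rewrite lte_fin; case: ifP.
split; first exact: integrable_indic_lty.
exists (C `\` B); split; first exact: measurableD.
  have Bfin : mu B \is a fin_num by rewrite ge0_fin_numE.
  have Coo : (mu C < +oo)%E by rewrite -muBC.
  have -> : mu (C `\` B) = (mu C - mu (C `&` B))%E by exact: measureD.
  by rewrite setIidr// -muBC subee.
move=> x /= hx; split.
  apply: contrapT => Cx; apply: hx; apply: (@leb_pt_near _ _ 0).
  have /existsNP[i xi] := Cx.
  have : nbhs x [set y : E | ~ `[a i, b i]%classic (y i ord0)].
    have oc : open (~` `[a i, b i]%classic) by rewrite openC; exact: itv_closed.
    have /(_ _ (open_nbhs_nbhs (conj oc xi))) := @coord_continuous _ _ _ i ord0 x.
    by [].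
  apply: filterS => y yi; rewrite indicE memNset// => By.
  by apply: yi; exact: BC.
move=> Bx; apply: hx; apply: (@leb_pt_near _ _ 1).
have : nbhs x [set y : E | forall i, `]a i, b i[%classic (y i ord0)].
  apply: (@filter_forall _ _ (fun i (y : E) => `]a i, b i[%classic (y i ord0)) (nbhs x)) => i.
  have oc : open `]a i, b i[%classic by exact: itv_open.
  have /(_ _ (open_nbhs_nbhs (conj oc (Bx i)))) := @coord_continuous _ _ _ i ord0 x.
  by [].
by apply: filterS => y yi; rewrite indicE mem_set.
Qed.

Lemma measurable_cV_boxes : (@measurable _ E) = <<s [set B | exists a b : 'I_n -> R,
   B = [set x : E | forall i, `]a i, b i[%classic (x i ord0)]] >>.
Proof.
set G := [set B | _]; apply/seteqP; split; last first.
  apply: smallest_sub; first exact: sigma_algebra_measurable.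
  move=> _ [a [b ->]]; apply: (@measurable_box _ _ (fun i => `]a i, b i[%classic)) => i.
  exact: measurable_itv.
apply: smallest_sub; first exact: smallest_sigma_algebra.
move=> B; rewrite -bigcup_seq/= => -[i _ [C mC <-]]; rewrite setTI.
have mi : measurable_fun [set: g_sigma_algebraType G] (fun x : g_sigma_algebraType G => (x : E) i ord0).
  apply: (measurability _ (measurable_realfun.RGenOpens.measurableE R)).
  move=> _ [_ [a [b ->] <-]]; rewrite setTI.
  pose A k : set E := [set x : E | forall j, `]if j == i then a else - k%:R,
     if j == i then b else k%:R[%classic (x j ord0)].
  rewrite (_ : _ @^-1` _ = \bigcup_k A k).
    apply: bigcup_measurable => k _; apply: sub_sigma_algebra.
    by exists (fun j => if j == i then a else - k%:R), (fun j => if j == i then b else k%:R).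
  apply/seteqP; split => x /=.
    move=> xi; exists (Num.truncn `|x|).+1 => // j /=; case: eqP => [->//|_].
    rewrite in_itv/= -ltr_norml (le_lt_trans (norm_coord_le _ _))// truncnS_gt//.
  by move=> [k _ /(_ i)]; rewrite /= eqxx.
by have := mi measurableT C mC; rewrite setTI.
Qed.

(** Boxes are closed under intersection and generate the Borel sets, and
    [good_lim] makes the good sets a Dynkin system inside a fixed cube. *)
Lemma good_indic (S : set E) (M : R) : measurable S -> 0 < M -> good \1_(S `&` ball 0 M).
Proof.
move=> mS M0; pose Q : set E := ball 0 M.
have mQ : measurable Q by exact: measurable_ball_cV.
have Qoo : (mu Q < +oo)%E by rewrite lebesgue_cV_ball// ltry.
have QE : Q = [set x : E | forall i, `](- M), M[%classic (x i ord0)].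
  by rewrite /Q ball_box//; apply/seteqP; split => x /= h i; have := h i; rewrite mxE sub0r add0r.
have goodQ : good \1_Q by rewrite QE; exact: good_box.
move: mS; rewrite measurable_cV_boxes => gS.
apply: (@dynkin_induction _ _ _ (fun S : set E => good \1_(S `&` ball 0 M))
  measurable_cV_boxes _ _ _ _ _ S gS).
- move=> _ _ [a [b ->]] [c [d ->]].
  exists (fun i => Num.max (a i) (c i)), (fun i => Num.min (b i) (d i)).
  apply/seteqP; split => x /=.
    move=> [h1 h2] i; have := h1 i; have := h2 i; rewrite !in_itv/= => /andP[? ?] /andP[? ?].
    by rewrite gt_max lt_min; apply/andP; split; apply/andP; split.
  move=> h; split => i; have := h i; rewrite !in_itv/= gt_max lt_min => /andP[/andP[? ?] /andP[? ?]];
  by apply/andP.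
- by rewrite setTI.
- move=> _ [a [b ->]]; rewrite -/Q QE.
  rewrite (_ : _ `&` _ = [set x : E | forall i,
      `]Num.max (a i) (- M), Num.min (b i) M[%classic (x i ord0)]); first exact: good_box.
  apply/seteqP; split => x /=.
    move=> [h1 h2] i; have := h1 i; have := h2 i; rewrite !in_itv/= => /andP[? ?] /andP[? ?].
    by rewrite gt_max lt_min; apply/andP; split; apply/andP; split.
  move=> h; split => i; have := h i; rewrite !in_itv/= gt_max lt_min => /andP[/andP[? ?] /andP[? ?]];
  by apply/andP.
- move=> A mA gA; rewrite (_ : \1_ _ = (fun x => \1_Q x - \1_(A `&` Q) x)); first exact: goodB.
  apply/funext => x; rewrite -/Q !indicE !in_setI in_setC.
  by case: (x \in A); case: (x \in Q); rewrite /= ?subr0 ?subrr.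
- move=> F mF tF gF; rewrite -/Q.
  pose g k x := \sum_(i <- iota 0 k) \1_(F i `&` Q) x : R.
  have gk k : good (g k) by apply: good_sum => i; exact: gF.
  have Fx i j x : F i x -> F j x -> i = j.
    by move=> Fi Fj; apply: (tF i j) => //; exists x.
  have g0 k x : (forall i, (i < k)%N -> ~ F i x) -> g k x = 0.
    move=> h; rewrite /g big_seq big1// => i; rewrite mem_iota/= add0n => ik.
    by rewrite indicE memNset// => -[/(h i ik)].
  have g1 k x i : (i < k)%N -> F i x -> g k x = \1_Q x.
    move=> ik Fi; rewrite /g (bigD1_seq i) ?iota_uniq ?mem_iota//= big1 ?addr0.
      by rewrite !indicE in_setI mem_set.
    move=> j ji; rewrite indicE memNset// => -[Fj _].
    by move/eqP : ji; apply; exact: Fx Fj Fi.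
  apply: (@good_lim g _ \1_Q gk) => //; first exact: integrable_indic_lty.
    move=> k x; have [[i [ik Fi]]|h] := pselect (exists i, (i < k)%N /\ F i x).
      by rewrite (g1 k x i)// indicE ger0_norm.
    by rewrite g0 ?normr0// => i ik Fi; apply: h; exists i.
  move=> x; have [[i _ Fi]|h] := pselect ((\bigcup_k F k) x).
    apply: cvg_near_cst; exists i.+1 => // k /= ik.
    by rewrite (g1 k x i)// !indicE in_setI [x \in \bigcup_k F k]mem_set//; exists i.
  apply: cvg_near_cst; apply: nearW => k.
  rewrite g0; last by move=> i _ Fi; apply: h; exists i.
  by rewrite indicE memNset// => -[].
Qed.

Lemma leb_pt_local N (g h : E -> R) x : (\forall y \near x, g y = h y) ->
  leb_pt N g x -> leb_pt N h x.
Proof.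
move=> gh hg e e0; have gx : g x = h x by exact: nbhs_singleton gh.
have /nbhs_ballP[d /= d0 hd] := gh.
near=> r; have <- : (\int[mu]_(y in ball x r) (`|g y - g x| ^+ N)%:E =
   \int[mu]_(y in ball x r) (`|h y - h x| ^+ N)%:E)%E.
  apply: eq_integral => y /set_mem xy; rewrite gx hd//; apply: le_ball xy.
  by near: r; exact: nbhs_right_le.
by near: r; exact: hg.
Unshelve. all: end_near. Qed.

Import HBSimple.

(** Truncated to a cube, [g] is a limit of simple functions, for which the
    assertion is [good_indic]; the truncation is invisible near each point of
    the cube. *)
Lemma lebesgue_points_L1 (g : E -> R) : measurable_fun setT g ->
  (forall M, 0 < M -> mu.-integrable (ball 0 M) (EFin \o g)) -> ae_leb g.
Proof.
move=> mg ig.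
suff H M : 0 < M -> good (fun x => \1_(ball 0 M) x * g x).
  have : {ae mu, forall x (k : nat), leb_pt 1 (fun x => \1_(ball 0 k.+1%:R) x * g x) x}.
    by apply: ae_foralln => k; have [] := H k.+1%:R (ltr0Sn _ _).
  apply: filterS => x hx; apply: leb_pt_local (hx (Num.truncn `|x|)).
  have xb : ball (0 : E) (Num.truncn `|x|).+1%:R x.
    by apply/ball_normP; rewrite sub0r normrN truncnS_gt.
  have ob : open (ball (0 : E) (Num.truncn `|x|).+1%:R) by exact: ball_open.
  have : nbhs x (ball (0 : E) (Num.truncn `|x|).+1%:R) by exact: open_nbhs_nbhs.
  by apply: filterS => y yb; rewrite indicE mem_set// mul1r.
move=> M0; set Q : set E := ball 0 M.
have mQ : measurable Q by exact: measurable_ball_cV.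
have iQ : mu.-integrable setT (EFin \o (fun x => \1_Q x * g x)).
  have /(integrable_mkcond _ mQ) := ig M M0.
  apply: eq_integrable => // x _; rewrite /= patchE indicE.
  by case: ifPn => _; rewrite ?mul1r ?mul0r.
split => //; apply: ae_leb_closed => // d d0.
have [h_ [ih _ hcv0]] := approximation_sfun_integrable mQ (ig M M0).
have /fine_cvgP[hfin /cvgrPdist_le/(_ _ d0) hcv] := hcv0.
have [K _ hK] := (filterI hfin hcv).
have [/= hf hd] := hK K (leqnn K).
pose h := h_ K.
have goodh : good (fun x => \1_Q x * h x).
  rewrite (_ : (fun x => _) = (fun x => \sum_(y <- finmap.enum_fset (fset_set (range h))) y * \1_(h @^-1` [set y] `&` Q) x)).
    by apply: good_sum => y; apply: goodZ; apply: good_indic => //; rewrite -[X in measurable X]setTI; exact: measurable_funP.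
  apply/funext => x; rewrite [in LHS](fimfunE h) fsbig_finite// mulr_sumr.
  apply: eq_bigr => y _; rewrite mulrCA; congr (_ * _).
  by rewrite !indicE in_setI -natrM mulnb andbC.
exists (fun x => \1_Q x * h x); split; [exact: goodh.1|exact: goodh.2|].
rewrite (_ : (\int[mu]_y _ = \int[mu]_(x in Q) `|(g x - h x)%:E|)%E); last first.
  rewrite [RHS]integral_mkcond; apply: eq_integral => x _.
  by rewrite patchE indicE; case: ifPn => _ /=; rewrite ?mul1r// !mul0r subrr normr0.
rewrite -(fineK hf) lee_fin (le_trans _ hd)// sub0r normrN; exact: ler_norm.
Qed.

(** Approximating the value [g x] by rationals [q], whose powers [|g - q|^N] have almost every
    point as Lebesgue point simultaneously, upgrades to N-th powers. *)
Lemma lebesgue_points N (g : E -> R) : (0 < N)%N -> measurable_fun setT g ->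
  mu.-integrable setT (EFin \o (fun x => `|g x| ^+ N)) ->
  {ae mu, forall x, leb_pt N g x}.
Proof.
move=> N0 mg ig.
have mgq (q : R) : measurable_fun setT (fun x => `|g x - q| ^+ N).
  apply: measurable_funX; apply: measurableT_comp => //; exact: measurable_funB.
have pow2 (a b : R) : `|a + b| ^+ N <= 2 ^+ N * (`|a| ^+ N + `|b| ^+ N).
  have h : `|a + b| <= 2 * Num.max `|a| `|b|.
    rewrite (le_trans (ler_normD _ _))// mulr2n mulrDl !mul1r.
    by apply: lerD; rewrite le_max lexx ?orbT.
  apply: (@le_trans _ _ ((2 * Num.max `|a| `|b|) ^+ N)).
    by rewrite lerXn2r ?nnegrE ?mulr_ge0// le_max normr_ge0.
  rewrite exprMn ler_wpM2l ?exprn_ge0//.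
  by have [h1|h1] := leP `|a| `|b|; rewrite ?lerDl ?lerDr exprn_ge0.
have H (q : rat) : ae_leb (fun x => `|g x - ratr q| ^+ N).
  apply: lebesgue_points_L1 => // M M0.
  have mQ : measurable (ball (0 : E) M) by exact: measurable_ball_cV.
  apply: (@integrable_real_le _ _ _ _ _ mQ _ (fun x => 2 ^+ N * (`|g x| ^+ N + `|ratr q| ^+ N))).
  - exact: measurable_funTS.
  - apply: integrable_realZ => //; apply: integrable_realD => //.
      exact: integrableS ig.
    by apply: (integrable_cst_lty mQ); rewrite [X in (X < _)%E](lebesgue_cV_ball 0 M0) ltry.
  - move=> x _; rewrite normrX normr_id.
    by apply: le_trans (pow2 (g x) (- ratr q)) _; rewrite normrN.
have : {ae mu, forall x (k : nat), leb_pt 1 (fun x => `|g x - ratr (odflt 0 (unpickle k))| ^+ N) x}.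
  by apply: ae_foralln => k; exact: H.
apply: filterS => x hx e e0.
have [q hq] : exists q : rat, `|g x - ratr q| ^+ N <= e / (2 ^+ N * (1 + 2 * 2 ^+ n)).
  have c0 : 0 < e / (2 ^+ N * (1 + 2 * 2 ^+ n)).
    by rewrite divr_gt0// mulr_gt0 ?exprn_gt0// ltr_pwDl// mulr_ge0// exprn_ge0.
  set c := e / _ in c0 *; pose c1 := Num.min 1 c.
  have c10 : 0 < c1 by rewrite lt_min ltr01.
  have : g x - c1 < g x + c1 by lra.
  move=> /rat_in_itvoo[q]; rewrite in_itv/= => /andP[q1 q2]; exists q.
  have hq : `|g x - ratr q| <= c1 by rewrite ler_norml; apply/andP; split; lra.
  move: hq; rewrite le_min => /andP[hq1 hqc].
  apply: le_trans hqc; case: (N) N0 => // k _; rewrite exprS ler_piMr//.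
  exact: exprn_ile1.
have := hx (pickle q); rewrite pickleK/= => {}hx.
set h := (fun x => _) in hx.
have mh : measurable_fun setT h by exact: mgq.
have d0 : 0 < 2 ^+ N * (1 + 2 * 2 ^+ n) :> R.
  by rewrite mulr_gt0 ?exprn_gt0// ltr_pwDl// mulr_ge0// exprn_ge0.
set c := e / _ in hq.
have c0 : 0 < c by rewrite divr_gt0.
near=> r.
have r0 : 0 < r by near: r; exact: nbhs_right_gt.
have mb : measurable (ball x r) by exact: measurable_ball_cV.
have hr : (\int[mu]_(y in ball x r) (`|h y - h x|)%:E <= (c * r ^+ n)%:E)%E.
  near: r; have := hx _ c0; apply: filterS => r.
  by under eq_integral do rewrite expr1.
have m2 := cts_measurable_norm (h x) (measurable_funTS (D := ball x r) mh).
have h0 : 0 <= h x by rewrite exprn_ge0.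
apply: (@le_trans _ _ (\int[mu]_(y in ball x r) ((2 ^+ N)%:E * (`|h y - h x|%:E + (2 * h x)%:E)))%E).
  apply: ge0_le_integral => //.
  - by apply/measurable_EFinP; exact: measurable_funTS.
  - by apply: emeasurable_funM => //; exact: emeasurable_funD.
  - move=> y _; rewrite -EFinD -EFinM lee_fin.
    have -> : g y - g x = (g y - ratr q) + (ratr q - g x) by ring.
    apply: le_trans (pow2 _ _) _; rewrite ler_wpM2l ?exprn_ge0//.
    rewrite (distrC (ratr q)) -/(h y) -/(h x).
    by have := ler_norm (h y - h x); lra.
rewrite ge0_integralZl//; last 2 first.
- exact: emeasurable_funD.
- by move=> y _; rewrite -EFinD lee_fin addr_ge0// mulr_ge0.
rewrite ge0_integralD//; last by move=> y _; rewrite lee_fin mulr_ge0.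
rewrite integral_cst// [X in (_ + _ * X)%E]lebesgue_cV_ball// -EFinM.
have e1 : (\int[mu]_(y in ball x r) `|h y - h x|%:E + (2 * h x * (2 * r) ^+ n)%:E <=
   (c * r ^+ n + 2 * c * (2 * r) ^+ n)%:E)%E.
  rewrite EFinD; apply: leeD => //; rewrite lee_fin.
  by apply: ler_wpM2r; [rewrite exprn_ge0// mulr_ge0// ltW|rewrite ler_pM2l].
apply: le_trans (lee_wpmul2l _ e1) _; first by rewrite lee_fin exprn_ge0.
rewrite -EFinM lee_fin exprMn le_eqVlt; apply/orP; left; apply/eqP.
rewrite /c; field; rewrite gt_eqF//= ?gt_eqF// ?exprn_gt0//.
Unshelve. all: end_near. Qed.

End lebesgue_points.

(** * Smooth kernels of compact support *)

Section lines.
Context {R : realType} {V : normedModType R}.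

Lemma continuousMf (f g : V -> R) : continuous f -> continuous g ->
  continuous (fun x => f x * g x).
Proof. by move=> cf cg x; apply: cvgM; [exact: cf|exact: cg]. Qed.

Lemma continuousDf (f g : V -> R) : continuous f -> continuous g ->
  continuous (fun x => f x + g x).
Proof. by move=> cf cg x; apply: cvgD; [exact: cf|exact: cg]. Qed.

Lemma continuousXf (h : V -> R) N : continuous h ->
  continuous (fun x => h x ^+ N).
Proof.
move=> ch; elim: N => [|N IH]; first by under eq_fun do rewrite expr0; exact: cst_continuous.
by under eq_fun do rewrite exprS; exact: continuousMf.
Qed.

Lemma continuous_normf (f : V -> R) :
  continuous f -> continuous (fun x => `|f x|).
Proof. by move=> cf x; apply: cvg_norm; exact: cf. Qed.

Lemma continuous_subr (f : V -> R) (c : V) : continuous f ->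
  continuous (fun x => f (x - c)).
Proof.
move=> cf x; apply: (@continuous_comp _ _ _ (fun x : V => x - c)); last exact: cf.
by apply: continuousB; [move=> ?; exact: cvg_id|exact: cst_continuous].
Qed.

Lemma is_derive_along (f : V -> R) (x v : V) (t : R) (d : R) :
  is_derive (x + t *: v) v f d <-> is_derive t (1 : R) (fun s => f (x + s *: v)) d.
Proof.
have e : (fun h : R => h^-1 *: (((fun s => f (x + s *: v)) \o shift t) (h *: (1 : R)) - f (x + t *: v))) =
   (fun h : R => h^-1 *: ((f \o shift (x + t *: v)) (h *: v) - f (x + t *: v))).
  apply/funext => h /=; congr (_ *: (f _ - _)).
  by rewrite [h *: 1]mulr1 scalerDl addrCA addrA.
pose g := fun s : R => f (x + s *: v).
have eD : 'D_1 g t = 'D_v f (x + t *: v) by rewrite /derive e.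
have eC : derivable g t 1 = derivable f (x + t *: v) v by rewrite /derivable e.
split=> -[h1 h2]; apply: DeriveDef.
- by rewrite -/g eC; exact: h1.
- by rewrite -/g eD; exact: h2.
- by rewrite -eC; exact: h1.
- by rewrite -eD; exact: h2.
Qed.

Lemma is_derive_sub (f : V -> R) (x y v : V) (d : R) :
  is_derive (y - x) v f d -> is_derive y v (fun z => f (z - x)) d.
Proof.
have e : (fun h : R => h^-1 *: (((fun z => f (z - x)) \o shift y) (h *: v) - f (y - x))) =
   (fun h : R => h^-1 *: ((f \o shift (y - x)) (h *: v) - f (y - x))).
  by apply/funext => h /=; rewrite addrA.
pose g := fun z => f (z - x).
have eD : 'D_v g y = 'D_v f (y - x) by rewrite /derive e.
have eC : derivable g y v = derivable f (y - x) v by rewrite /derivable e.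
by move=> [h1 h2]; apply: DeriveDef; [rewrite -/g eC; exact: h1|rewrite -/g eD; exact: h2].
Qed.

Lemma is_derive_eqr (f : V -> R) (x v : V) (d d' : R) :
  is_derive x v f d -> d = d' -> is_derive x v f d'.
Proof. by move=> h <-. Qed.

Lemma is_derive_prodseq (I : eqType) (s : seq I) (f : I -> V -> R) (d : I -> R) (x v : V) :
  uniq s -> (forall i, is_derive x v (f i) (d i)) ->
  is_derive x v (fun y => \prod_(i <- s) f i y)
    (\sum_(j <- s) \prod_(i <- s) (if i == j then d i else f i x)).
Proof.
move=> + hf; elim: s => [_|a s IH /= /andP[as_ us]].
  under eq_fun do rewrite big_nil.
  rewrite big_nil; exact: is_derive_cst.
under eq_fun do rewrite big_cons.
apply: is_derive_eqr (is_deriveM (hf a) (IH us)) _.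
rewrite big_cons big_cons eqxx addrC /=; congr (_ + _).
  rewrite [LHS]mulrC; congr (_ * _); rewrite big_seq [RHS]big_seq.
  by apply: eq_bigr => i si; case: eqP => // ia; move: as_; rewrite -ia si.
rewrite [LHS]mulr_sumr [LHS]big_seq [RHS]big_seq; apply: eq_bigr => j js.
rewrite big_cons; case: eqP => // aj; by move: as_; rewrite aj js.
Qed.

(** Used at the end points of the support, where a bump vanishes to second order. *)
Lemma is_derive_quadratic (f : R -> R) (t C : R) :
  (forall h, `|f (t + h) - f t| <= C * h ^+ 2) -> is_derive t (1 : R) f 0.
Proof.
move=> hf.
have C0 : 0 <= C by have := hf 1; rewrite expr1n mulr1; exact: le_trans.
have cv : h^-1 *: ((f \o shift t) (h *: (1 : R)) - f t) @[h --> 0^'] --> (0 : R).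
  apply/cvgr0Pnorm_le => e e0; near=> h.
  have h0 : h != 0 by near: h; exact: nbhs_dnbhs_neq.
  have hh : 0 < `|h| by rewrite normr_gt0.
  rewrite /= [h *: 1]mulr1 normrZ normfV ler_pdivrMl// [h + t]addrC.
  apply: le_trans (hf h) _; rewrite -[h ^+ 2]ger0_norm ?sqr_ge0// normrX expr2 mulrCA.
  rewrite ler_pM2l//.
  have : `|h| <= e / (C + 1).
    near: h; apply: dnbhs0_le; by rewrite divr_gt0// ltr_wpDl.
  rewrite ler_pdivlMr ?ltr_wpDl// mulrDr mulr1 mulrC; lra.
apply: DeriveDef; first by apply/cvg_ex; exists 0.
exact/cvg_lim.
Unshelve. all: end_near. Qed.

End lines.

Section bump.
Context {R : realType}.

Lemma sqnormr (x : R) : `|x| ^+ 2 = x ^+ 2. Proof. exact/real_normK/num_real. Qed.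

(** The functions obtained from [exp (-1 / (1 - t^2))] by repeated
    differentiation; a pair holds the polynomial factor and the order of the
    pole. *)
Definition bump1 (p : {poly R} * nat) (t : R) : R :=
  if `|t| < 1 then p.1.[t] / (1 - t ^+ 2) ^+ p.2 * expR (- (1 - t ^+ 2)^-1) else 0.

(** The derivative of a bump, as an operation on the encoding. *)
Definition dbump1 (p : {poly R} * nat) : {poly R} * nat :=
  (p.1^`() * (1 - 'X^2) ^+ 2 + (2 * p.2%:R) *: ('X * p.1 * (1 - 'X^2)) - 2 *: ('X * p.1),
   (p.2 + 2)%N).

Lemma expR_inv_flat (y : R) k : 0 < y -> expR (- y^-1) <= (k%:R * y) ^+ k.
Proof.
case: k => [|k] y0.
  by rewrite mul0r expr0 expR_le1 oppr_le0 invr_ge0 ltW.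
have k0 : 0 < k.+1%:R :> R by [].
have h : (k.+1%:R * y)^-1 ^+ k.+1 <= expR y^-1.
  have -> : y^-1 = (k.+1%:R * y)^-1 * k.+1%:R.
    by rewrite invfM mulrAC mulVf ?mul1r// gt_eqF.
  rewrite expRM_natr lerXn2r ?nnegrE ?invr_ge0 ?mulr_ge0 ?expR_ge0 ?ltW//.
  by apply: lt_le_trans (expR_ge1Dx _); rewrite ltrDr.
rewrite expRN -[leRHS]invrK lef_pV2 ?posrE ?expR_gt0 ?invr_gt0 ?exprn_gt0 ?mulr_gt0//.
by rewrite -exprVn.
Qed.

Lemma poly_bounded1 (q : {poly R}) : exists2 C, 0 <= C & forall t, `|t| < 1 -> `|q.[t]| <= C.
Proof.
exists (\sum_(i < size q) `|q`_i|); first exact: sumr_ge0.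
move=> t t1; rewrite horner_coef (le_trans (ler_norm_sum _ _ _))// ler_sum// => i _.
by rewrite normrM ler_piMr// normrX exprn_ile1// ltW.
Qed.

(* Flatness of exp(-1/y) at 0 absorbs the pole. *)
Lemma bump1_flat p : exists2 C, 0 <= C &
  forall t, `|t| < 1 -> `|bump1 p t| <= C * (1 - t ^+ 2) ^+ 2.
Proof.
have [C C0 hC] := poly_bounded1 p.1.
exists (C * (p.2 + 2)%:R ^+ (p.2 + 2)); first by rewrite mulr_ge0// exprn_ge0.
move=> t t1; rewrite /bump1 t1.
have y0 : 0 < 1 - t ^+ 2 by rewrite subr_gt0 -sqnormr expr_lt1.
set y := 1 - t ^+ 2 in y0 *.
rewrite !normrM normfV (ger0_norm (expR_ge0 _)) (@ger0_norm _ (y ^+ _)) ?(exprn_ge0 _ (ltW y0))//.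
have := expR_inv_flat (p.2 + 2) y0.
rewrite exprMn => h.
have -> : C * (p.2 + 2)%:R ^+ (p.2 + 2) * y ^+ 2 =
   C / y ^+ p.2 * ((p.2 + 2)%:R ^+ (p.2 + 2) * y ^+ (p.2 + 2)).
  by rewrite (exprD y); field; rewrite expf_neq0// gt_eqF.
have yp : 0 <= (y ^+ p.2)^-1 by rewrite invr_ge0 exprn_ge0// ltW.
apply: ler_pM; [exact: mulr_ge0|exact: expR_ge0| |exact: h].
by apply: ler_wpM2r => //; exact: hC.
Qed.

Lemma bump1_bounded p : exists2 C, 0 <= C & forall t, `|bump1 p t| <= C.
Proof.
have [C C0 hC] := bump1_flat p; exists C => // t.
have [t1|t1] := ltP `|t| 1; last by rewrite /bump1 ltNge t1/= normr0.
apply: le_trans (hC t t1) _; rewrite ler_piMr//.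
have : t ^+ 2 < 1 by rewrite -sqnormr expr_lt1.
by have := sqr_ge0 t => ? ?; rewrite exprn_ile1//; lra.
Qed.

Lemma is_derive_bump1 p t : is_derive t (1 : R) (bump1 p) (bump1 (dbump1 p) t).
Proof.
have [t1|t1] := ltP `|t| 1; last first.
  rewrite [X in is_derive _ _ _ X]/bump1 ltNge t1/=.
  have [C C0 hC] := bump1_flat p.
  apply: (@is_derive_quadratic _ _ _ (C * (`|t| + 1) ^+ 2)) => h.
  rewrite [bump1 p t]/bump1 [`|t| < 1]ltNge t1/= subr0.
  have [th|th] := ltP `|t + h| 1; last first.
    by rewrite /bump1 ltNge th/= normr0 mulr_ge0 ?sqr_ge0// mulr_ge0 ?sqr_ge0.
  apply: le_trans (hC _ th) _; rewrite -mulrA ler_wpM2l// -exprMn.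
  have e1 : 1 - (t + h) ^+ 2 <= `|t| ^+ 2 - `|t + h| ^+ 2.
    by have : 1 <= `|t| ^+ 2 by [rewrite expr_ge1]; rewrite -(sqnormr (t + h)); lra.
  have e2 : `|t| - `|t + h| <= `|h|.
    by rewrite lerBlDl -{1}(addrK h t) ler_normB.
  have e3 : 0 <= `|t| - `|t + h| by lra.
  have y0 : 0 <= 1 - (t + h) ^+ 2 by rewrite subr_ge0 -sqnormr ltW// expr_lt1.
  rewrite -(sqnormr ((`|t| + 1) * h)) lerXn2r ?nnegrE//.
  have -> : `|(`|t| + 1) * h| = (`|t| + 1) * `|h|.
    by rewrite normrM (@ger0_norm _ (_ + 1)) ?addr_ge0.
  apply: le_trans e1 _; rewrite subr_sqr mulrC.
  by apply: ler_pM => //; rewrite lerD2l ltW.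
have y0 : 1 - t ^+ 2 != 0.
  by rewrite gt_eqF// subr_gt0 -sqnormr expr_lt1.
pose g := fun s : R => p.1.[s] / (1 - s ^+ 2) ^+ p.2 * expR (- (1 - s ^+ 2)^-1).
have : is_derive t (1 : R) g (bump1 (dbump1 p) t).
  pose y : R -> R := horner (1 - 'X^2).
  have yE s : y s = 1 - s ^+ 2 by rewrite /y !hornerE.
  pose z : R -> R := fun s => (y s)^-1.
  have dy : is_derive t (1 : R) y (- (2 * t)).
    apply: is_derive_eqr (is_derive_poly _ _) _.
    have -> : (1 - 'X^2 : {poly R})^`() = - ('X *+ 2).
      by rewrite derivB derivXn expr1 -[1]/(1%:P) derivC sub0r.
    by rewrite !hornerE/=; ring.
  have yt : y t != 0 by rewrite yE.
  have dz : is_derive t (1 : R) z (2 * t / y t ^+ 2).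
    apply: is_derive_eqr (is_deriveV yt dy) _.
    by rewrite /GRing.scale/=; field.
  have de : is_derive t (1 : R) (expR \o (- z)) (expR (- z t) * (- (2 * t / y t ^+ 2))).
    by apply: is_derive1_comp; exact: is_deriveN.
  have := is_deriveM (is_deriveM (is_derive_poly p.1 t) (is_deriveX p.2 dz)) de.
  rewrite (_ : _ * _ = g); last first.
    by apply/funext => s; rewrite !fctE /g -yE -exprVn.
  move=> h; apply: is_derive_eqr h _.
  rewrite /bump1 t1 /dbump1/= !hornerE/= /GRing.scale/= -!exprVn !fctE -yE -/(z t).
  have zE : y t = (z t)^-1 by rewrite /z invrK.
  have z0 : z t != 0 by rewrite /z invr_eq0.
  have hm : p.2%:R * z t ^+ p.2.-1 * z t ^+ 2 = p.2%:R * z t ^+ p.2 * z t.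
    by case: (p.2) => [|m]; rewrite ?mul0r// -!mulrA -!exprSr -exprD addn2.
  rewrite exprD zE; set a := z t ^+ p.2 in hm *; set zz := z t in hm z0 *; set e := expR _.
  have -> : p.1.[t] * (p.2%:R * zz ^+ p.2.-1 * (2 * t * zz ^+ 2)) =
     2 * t * p.1.[t] * (p.2%:R * zz ^+ p.2.-1 * zz ^+ 2) by ring.
  by rewrite hm; field.
have : \forall s \near t, g s = bump1 p s.
  have : \forall s \near t, `|s| < 1.
    by apply: (@cvgr_norm_lt _ _ _ (nbhs t) _ id t) => //; exact: cvg_id.
  by apply: filterS => s s1; rewrite /bump1 s1.
by move=> h1 h2; exact: near_eq_is_derive h1 h2.
Qed.

End bump.

Section kernels.
Context {R : realType} {n : nat}.
Local Notation E := 'cV[R]_n.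
Local Notation mu := (@lebesgue_cV R n).
Implicit Types (p : 'I_n -> {poly R} * nat).

(** Products of one-dimensional bumps at scale [eps]: a class of compactly supported
    functions that is closed under partial derivatives. *)
Definition kern p (eps : R) (z : E) : R := \prod_(i < n) bump1 (p i) (z i ord0 / eps).

Definition dkern (eps : R) (j : 'I_n) p : 'I_n -> {poly R} * nat :=
  fun i => if i == j then (eps^-1 *: (dbump1 (p i)).1, (dbump1 (p i)).2) else p i.

Lemma bump1Z (c : R) (q : {poly R}) m t : bump1 (c *: q, m) t = c * bump1 (q, m) t.
Proof. by rewrite /bump1/=; case: ifP => _; rewrite ?mulr0// hornerZ !mulrA. Qed.

Lemma dkernC eps j k p : dkern eps j (dkern eps k p) = dkern eps k (dkern eps j p).
Proof.
apply/funext => i; rewrite /dkern; case: (i =P j) => [ij|]//; case: (i =P k) => [ik|]//.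
Qed.

Lemma is_derive_coord (z v : E) i : is_derive z v (fun y : E => y i ord0) (v i ord0).
Proof.
rewrite -[z]addr0 -(scale0r v); apply/is_derive_along.
rewrite (_ : (fun s => _) = (cst (z i ord0) + idfun * cst (v i ord0))); last first.
  by apply/funext => s; rewrite !mxE.
apply: is_derive_eqr (is_deriveD _ (is_deriveM (is_derive_id (0 : R) 1) (is_derive_cst (v i ord0) (0 : R) 1))) _.
by rewrite scaler0 !add0r [LHS]mulr1.
Qed.

Lemma is_derive_kern p eps (z v : E) :
  is_derive z v (kern p eps) (\sum_j kern (dkern eps j p) eps z * v j ord0).
Proof.
have h i : is_derive z v (fun y : E => bump1 (p i) (y i ord0 / eps))
    (bump1 (dkern eps i p i) (z i ord0 / eps) * v i ord0).
  rewrite -[z in is_derive z]addr0 -(scale0r v); apply/is_derive_along.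
  pose L := (fun s : R => (z + s *: v) i ord0) * cst eps^-1.
  rewrite -[X in is_derive _ _ X]/(bump1 (p i) \o L).
  have d1 : is_derive (0 : R) (1 : R) L (v i ord0 / eps).
    have /is_derive_along d0 : is_derive (z + 0 *: v) v (fun y : E => y i ord0) (v i ord0).
      exact: is_derive_coord.
    apply: is_derive_eqr (is_deriveM d0 (is_derive_cst eps^-1 (0 : R) 1)) _.
    by rewrite scaler0 add0r [LHS]mulrC.
  apply: is_derive_eqr (is_derive1_comp (is_derive_bump1 _ _) d1) _.
  have -> : L 0 = z i ord0 / eps by rewrite /L !fctE scale0r addr0.
  rewrite /dkern eqxx bump1Z; case: (dbump1 (p i)) => q m /=.
  by ring.
apply: is_derive_eqr (is_derive_prodseq (index_enum_uniq _) h) _.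
apply: eq_bigr => j _; rewrite /kern.
rewrite (bigD1 j)//= eqxx [in RHS](bigD1 j)//= mulrAC; congr (_ * _ * _).
by apply: eq_bigr => i ij; rewrite (negbTE ij) /dkern (negbTE ij).
Qed.

Lemma continuous_bump1 (q : {poly R} * nat) : continuous (bump1 q).
Proof.
move=> t; apply: differentiable_continuous; apply/derivable1_diffP.
by have [] := is_derive_bump1 q t.
Qed.

Lemma continuous_kern p eps : continuous (kern p eps).
Proof.
rewrite /kern; elim: (index_enum _) => [|i s IH].
  rewrite (_ : (fun _ => _) = cst 1); last by apply/funext => y; rewrite big_nil.
  exact: cst_continuous.
under eq_fun do rewrite big_cons; apply: continuousMf; last exact: IH.
move=> z; apply: (@continuous_comp _ _ _ (fun y : E => y i ord0 / eps)); last exact: continuous_bump1.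
by apply: continuousMf; [exact: coord_continuous|exact: cst_continuous].
Qed.

Lemma kern_bounded p eps : exists2 C, 0 <= C & forall z, `|kern p eps z| <= C.
Proof.
have h i : exists C, 0 <= C /\ forall t, `|bump1 (p i) t| <= C.
  by have [C C0 hC] := bump1_bounded (p i); exists C.
have [C hC] := choice h.
exists (\prod_i C i); first by apply: prodr_ge0 => i _; have [] := hC i.
move=> z; rewrite /kern normr_prod; apply: ler_prod => i _.
by rewrite normr_ge0/=; have [_ ->] := hC i.
Qed.

Lemma kern_supp p eps z : 0 < eps -> eps <= `|z| -> kern p eps z = 0.
Proof.
move=> e0 ze.
have [h|/existsNP[i hi]] := pselect (forall i, `|z i ord0| < eps).
  have : ball (0 : E) eps z by apply/ballcVP => // i; rewrite mxE sub0r normrN.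
  by move=> /ball_normP; rewrite sub0r normrN ltNge ze.
rewrite /kern (bigD1 i)//= /bump1 ifF ?mul0r//.
rewrite normrM normfV (gtr0_norm e0) ltr_pdivrMr// mul1r.
by apply/negP => /hi.
Qed.

Lemma smooth_kern p eps x s : foldr partial (fun y => kern p eps (y - x)) s =
  (fun y => kern (foldr (dkern eps) p s) eps (y - x)).
Proof.
elim: s => [//|j s /= ->]; apply/funext => y; rewrite /partial.
have : is_derive y (unit_cV j) (fun y => kern (foldr (dkern eps) p s) eps (y - x))
    (kern (dkern eps j (foldr (dkern eps) p s)) eps (y - x)).
  apply: is_derive_sub.
  apply: is_derive_eqr (is_derive_kern _ _ _ _) _.
  rewrite (bigD1 j)//= big1 ?addr0; first by rewrite mxE !eqxx mulr1.
  by move=> i ij; rewrite mxE (negbTE ij) mulr0.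
by move=> [_ ->].
Qed.

Lemma cV_compact_cball (x : E) (r : R) : compact [set y : E | `|x - y| <= r].
Proof.
have [r0|r0] := ltP r 0.
  rewrite (_ : [set y | _] = set0); first exact: compact0.
  by apply/seteqP; split => // y /= h; have := le_lt_trans h r0; rewrite ltNge normr_ge0.
pose K : set 'rV[R]_n := [set v | forall i, `[x i ord0 - r, x i ord0 + r]%classic (v ord0 i)].
have cK : compact K.
  by apply: (@rV_compact _ _ (fun i => `[x i ord0 - r, x i ord0 + r]%classic)) => i; exact: segment_compact.
have ct : continuous (trmx : 'rV[R]_n -> E).
  move=> v B /= /nbhs_ballP[e /= e0 eB]; apply/nbhs_ballP; exists e => //= w [_ vw].
  by apply: eB; split => // i j; rewrite !mxE; exact: vw.
rewrite (_ : [set y | _] = trmx @` K).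
  by apply: continuous_compact => //; exact: continuous_subspaceT.
apply/seteqP; split => [y /= xy|_ [v Kv <-]] /=.
  exists y^T; rewrite ?trmxK// => i /=; rewrite mxE in_itv/= -ler_distlC.
  by apply: le_trans xy; have := norm_coord_le (x - y) i; rewrite !mxE.
apply: norm_cV_le => // i; rewrite !mxE; have := Kv i.
by rewrite /= in_itv/= -ler_distlC.
Qed.

(** Translated kernels may be inserted in the definition of weak derivatives. *)
Lemma test_function_kern p eps (x : E) (Omega : set E) : 0 < eps ->
  [set y : E | `|x - y| <= eps] `<=` Omega ->
  test_function Omega (fun y => kern p eps (y - x)).
Proof.
move=> e0 hO; pose K := [set y : E | `|x - y| <= eps].
have cK : compact K by exact: cV_compact_cball.
have clK : closure [set y : E | kern p eps (y - x) != 0] `<=` K.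
  rewrite closureE => y /=; apply; split.
    by apply: compact_closed cK; exact: norm_hausdorff.
  move=> z /= /eqP hz; rewrite /K/= leNgt; apply/negP => xz; apply: hz.
  by apply: kern_supp => //; rewrite distrC ltW.
split; last exact: subset_trans hO.
- move=> s /=; rewrite smooth_kern; split.
    by apply: continuous_subr; exact: continuous_kern.
  by move=> j y; have [] := is_derive_sub (is_derive_kern (foldr (dkern eps) p s) eps (y - x) (unit_cV j)).
- by apply: subclosed_compact cK clK; exact: closed_closure.
Qed.

End kernels.

(** * Functions with a continuous gradient *)

Section gradients.
Context {R : realType} {n : nat}.
Local Notation E := 'cV[R]_n.
Local Notation mu := (@lebesgue_cV R n).

(** Continuously differentiable functions, with gradient [g]; stated with
    directional derivatives, which restrict well to lines. *)
Definition C1grad (u : E -> R) (g : 'I_n -> E -> R) :=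
  [/\ forall x v, is_derive x v u (\sum_j g j x * v j ord0),
      continuous u & forall j, continuous (g j)].

Lemma C1grad_kern p eps x : C1grad (fun y => kern p eps (y - x))
  (fun j y => kern (dkern eps j p) eps (y - x)).
Proof.
split => [y v||j].
- by apply: is_derive_sub; exact: is_derive_kern.
- by apply: continuous_subr; exact: continuous_kern.
- by apply: continuous_subr; exact: continuous_kern.
Qed.

Lemma C1gradM u g w h : C1grad u g -> C1grad w h ->
  C1grad (fun x => u x * w x) (fun j x => u x * h j x + w x * g j x).
Proof.
move=> [du cu cg] [dw cw ch]; split => [x v||j].
- apply: is_derive_eqr (is_deriveM (du x v) (dw x v)) _.
  rewrite /GRing.scale/= !mulr_sumr -big_split/=; apply: eq_bigr => j _; ring.
- exact: continuousMf.
- by apply: continuousDf; exact: continuousMf.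
Qed.

Lemma C1grad_cst c : C1grad (fun=> c) (fun=> fun=> 0).
Proof.
split => [x v||j]; [|exact: cst_continuous|exact: cst_continuous].
by apply: is_derive_eqr (is_derive_cst c x v) _; rewrite big1// => j _; rewrite mul0r.
Qed.

Lemma C1gradX u g m : C1grad u g ->
  C1grad (fun x => u x ^+ m) (fun j x => m%:R * u x ^+ m.-1 * g j x).
Proof.
move=> ug; elim: m => [|m IH].
  have := C1grad_cst 1.
  by congr C1grad; apply/funext => x; rewrite ?expr0//; apply/funext => y; rewrite !mul0r.
have := C1gradM ug IH.
congr C1grad; first by apply/funext => x; rewrite exprS.
apply/funext => j; apply/funext => x /=; rewrite -natr1.
by case: m {IH} => [|m]/=; rewrite ?exprS ?expr0; ring.
Qed.

Lemma C1gradZ c u g : C1grad u g -> C1grad (fun x => c * u x) (fun j x => c * g j x).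
Proof.
move=> /(C1gradM (C1grad_cst c)); congr C1grad.
by apply/funext => j; apply/funext => x; rewrite mulr0 addr0.
Qed.

Lemma C1gradD u g w h : C1grad u g -> C1grad w h ->
  C1grad (fun x => u x + w x) (fun j x => g j x + h j x).
Proof.
move=> [du cu cg] [dw cw ch]; split => [x v||j]; [|exact: continuousDf|exact: continuousDf].
apply: is_derive_eqr (is_deriveD (du x v) (dw x v)) _.
by rewrite -big_split/=; apply: eq_bigr => j _; ring.
Qed.

Lemma C1grad_along u g (x v : E) (t : R) : C1grad u g ->
  is_derive t (1 : R) (fun s => u (x + s *: v)) (\sum_j g j (x + t *: v) * v j ord0).
Proof. by move=> [du _ _]; have [h _] := is_derive_along u x v t (\sum_j g j (x + t *: v) * v j ord0); apply: h. Qed.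

Lemma C1grad_mvt u g (x v : E) : C1grad u g -> exists2 c : R, 0 <= c <= 1 &
  u (x + v) - u x = \sum_j g j (x + c *: v) * v j ord0.
Proof.
move=> ug; have d t := C1grad_along x v t ug.
have [|c c01] := @MVT R (fun s => u (x + s *: v)) _ 0 1 ltr01 (fun t _ => d t).
  apply: continuous_subspaceT => t; apply: differentiable_continuous; apply/derivable1_diffP.
  by have [] := d t.
rewrite scale1r scale0r addr0 subr0 mulr1 => ->; exists c => //.
by move: c01; rewrite in_itv/= => /andP[c0 c1]; rewrite !ltW.
Qed.

Lemma sum_coord_le (a : 'I_n -> R) (v : E) C : (forall j, `|a j| <= C) ->
  `|\sum_j a j * v j ord0| <= n%:R * C * `|v|.
Proof.
move=> aC; rewrite (le_trans (ler_norm_sum _ _ _))//.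
rewrite -mulrA mulr_natl -[X in _ *+ X](card_ord n) -sumr_const ler_sum// => j _.
by rewrite normrM ler_pM//; exact: norm_coord_le.
Qed.

Lemma C1grad_lipschitz u g (C : R) : C1grad u g ->
  (forall j x, `|g j x| <= C) -> forall x v, `|u (x + v) - u x| <= n%:R * C * `|v|.
Proof.
by move=> ug gC x v; have [c _ ->] := C1grad_mvt x v ug; apply: sum_coord_le.
Qed.

Lemma C1grad_taylor u g (C : R) : C1grad u g ->
  (forall j x v, `|g j (x + v) - g j x| <= C * `|v|) -> forall x v,
  `|u (x + v) - u x - \sum_j g j x * v j ord0| <= n%:R * C * `|v| ^+ 2.
Proof.
move=> ug gC x v; have [c /andP[c0 c1] ->] := C1grad_mvt x v ug.
rewrite -sumrB; under eq_bigr do rewrite -mulrBl.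
rewrite expr2 mulrA -[n%:R * C * _]mulrA; apply: sum_coord_le => j.
have C0 : 0 <= C * `|v| by apply: le_trans (gC j x v).
by rewrite (le_trans (gC _ _ _))// normrZ ger0_norm// mulrCA ler_piMl.
Qed.

End gradients.

(** * Convolutions *)

Section lipschitz.
Context {R : realType} {V : normedModType R}.

Lemma lipschitz_cts (f : V -> R) (C : R) :
  (forall x v, `|f (x + v) - f x| <= C * `|v|) -> continuous f.
Proof.
move=> hf x; apply/cvgrPdist_le => e e0.
have D0 : 0 < `|C| + 1 by rewrite ltr_wpDl.
near=> y.
have -> : y = x + (y - x) by rewrite addrC subrK.
rewrite distrC (le_trans (hf _ _))// (@le_trans _ _ ((`|C| + 1) * `|y - x|))//.
  by rewrite ler_wpM2r// (le_trans (ler_norm _))// lerDl.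
rewrite mulrC -ler_pdivlMr// distrC.
near: y; apply: cvgr_dist_le; [exact: cvg_id|exact: divr_gt0].
Unshelve. all: by end_near. Qed.

Lemma is_derive_of_taylor (f : V -> R) (x v : V) (d C : R) :
  (forall h, `|f (x + h *: v) - f x - h * d| <= C * h ^+ 2) -> is_derive x v f d.
Proof.
move=> hf.
have e0 : x = x + (0 : R) *: v by rewrite scale0r addr0.
rewrite [X in is_derive X]e0; apply: (is_derive_along _ _ _ _ _).2.
have q : is_derive (0 : R) (1 : R) (fun s => f (x + s *: v) - s * d) 0.
  apply: (@is_derive_quadratic _ _ _ C) => h; have := hf h; congr (`|_| <= _).
  by rewrite -e0 add0r mul0r subr0 addrAC.
have := is_deriveD q (is_deriveM (is_derive_id (0 : R) 1) (is_derive_cst d (0 : R) 1)).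
have -> : (fun s => f (x + s *: v) - s * d) + (idfun * cst d) = (fun s => f (x + s *: v)).
  by apply/funext => s; rewrite !fctE /= subrK.
by move=> h; apply: is_derive_eqr h _; rewrite scaler0 !add0r [LHS]mulr1.
Qed.

Lemma continuousNf (f : V -> R) : continuous f -> continuous (fun x => - f x).
Proof. by move=> cf x; apply: cvgN; exact: cf. Qed.

End lipschitz.

Section convolution.
Context {R : realType} {n : nat} (n0 : (0 < n)%N).
Local Notation E := 'cV[R]_n.
Local Notation mu := (@lebesgue_cV R n).
Implicit Types (g : E -> R) (p : 'I_n -> {poly R} * nat).

Definition conv p eps g (x : E) : R := \int[mu]_y (kern p eps (y - x) * g y).

(** Uniform local integrability, over cubes of a fixed size: a class containing
    the zero extensions of all [L^p] functions, and closed under truncation, on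
    which convolution with a small kernel is defined everywhere. *)
Definition uloc (C : R) g := measurable_fun setT g /\
  forall x, (\int[mu]_(y in ball x 1%R) `|g y|%:E <= C%:E)%E.

Lemma measurable_kern p eps x : measurable_fun setT (fun y : E => kern p eps (y - x)).
Proof. by apply: continuous_measurable_cV; apply: continuous_subr; exact: continuous_kern. Qed.

(** The support of [phi] lies in two cubes of radius [1]; the second one is for
    differences of two translated kernels. *)
Lemma uloc_le C g (phi : E -> R) (K : R) (a b : E) : uloc C g ->
  measurable_fun setT phi -> (forall y, `|phi y| <= K) ->
  (forall y, 1 <= `|a - y| -> 1 <= `|b - y| -> phi y = 0) ->
  mu.-integrable setT (EFin \o (fun y => phi y * g y)) /\
  `|\int[mu]_y (phi y * g y)| <= K * (2 * C).
Proof.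
move=> [mg gC] mphi hK h0.
have K0 : 0 <= K by apply: le_trans (hK 0).
pose H z y : R := `|g y| * \1_(ball z (1 : R)) y.
have mb z : measurable (ball z (1 : R) : set E) by exact: measurable_ball_cV.
have mH z : measurable_fun setT (H z).
  by apply: measurable_funM; [exact: measurableT_comp|exact: measurable_indic].
have H0 z y : 0 <= H z y by rewrite mulr_ge0// indicE.
have iHE z : (\int[mu]_y (H z y)%:E <= C%:E)%E.
  apply: le_trans (gC z); rewrite [leRHS]integral_mkcond le_eqVlt; apply/orP; left.
  apply/eqP/eq_integral => y _; rewrite patchE /H indicE.
  by case: ifP => _; rewrite ?mulr1 ?mulr0.
have iH z : mu.-integrable setT (EFin \o H z).
  apply/integrableP; split; first exact/measurable_EFinP.
  apply: le_lt_trans (ltry C); apply: le_trans (iHE z).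
  rewrite le_eqVlt; apply/orP; left; apply/eqP/eq_integral => y _.
  by rewrite /= ger0_norm.
have iS : mu.-integrable setT (EFin \o (fun y => K * (H a y + H b y))).
  by apply: integrable_realZ => //; exact: integrable_realD.
have le y : `|phi y * g y| <= K * (H a y + H b y).
  rewrite normrM.
  have [ya|ya] := ltP `|a - y| 1.
    have yA : y \in (ball a (1 : R) : set E) by apply/mem_set/ball_normP.
    apply: ler_pM => //; rewrite {1}/H indicE yA mulr1 lerDl; exact: H0.
  have [yb|yb] := ltP `|b - y| 1.
    have yB : y \in (ball b (1 : R) : set E) by apply/mem_set/ball_normP.
    apply: ler_pM => //; rewrite {2}/H indicE yB mulr1 lerDr; exact: H0.
  by rewrite h0// normr0 mul0r mulr_ge0// addr_ge0.
have ig : mu.-integrable setT (EFin \o (fun y => phi y * g y)).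
  by apply: (integrable_real_le measurableT _ iS) => //; exact: measurable_funM.
split=> //.
rewrite -lee_fin EFin_normr_Rintegral//.
apply: le_trans (le_abse_integral _ measurableT (measurable_int _ ig)) _.
apply: (@le_trans _ _ (\int[mu]_y (K%:E * ((H a y)%:E + (H b y)%:E)))%E).
  apply: ge0_le_integral => //.
  - by apply: measurableT_comp => //; exact: measurable_int ig.
  - exact: measurable_int iS.
  - by move=> y _; rewrite -EFinD -EFinM lee_fin; exact: le.
rewrite ge0_integralZl//; last 2 first.
- by apply/measurable_EFinP; exact: measurable_funD.
- by move=> y _; rewrite -EFinD lee_fin addr_ge0.
rewrite EFinM lee_wpmul2l// ge0_integralD//; try by move=> *; rewrite lee_fin.
- by rewrite mulr_natl mulr2n EFinD; apply: leeD; exact: iHE.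
- exact/measurable_EFinP.
- exact/measurable_EFinP.
Qed.

Lemma kern_supp1 p eps (x y : E) : 0 < eps -> eps <= 1 -> 1 <= `|x - y| -> kern p eps (y - x) = 0.
Proof.
by move=> e0 e1 h; rewrite kern_supp// distrC (le_trans e1).
Qed.

Lemma conv_integrable p eps g C x : 0 < eps -> eps <= 1 -> uloc C g ->
  mu.-integrable setT (EFin \o (fun y => kern p eps (y - x) * g y)).
Proof.
move=> e0 e1 gC; have [K K0 hK] := kern_bounded p eps.
apply: (uloc_le (a := x) (b := x) gC (measurable_kern p eps x) (fun y => hK (y - x)) _).1 => y h _.
exact: kern_supp1 h.
Qed.

Lemma C1grad_kern0 p eps : C1grad (@kern R n p eps) (fun j => kern (dkern eps j p) eps).
Proof. by split => [y v||j]; [exact: is_derive_kern|exact: continuous_kern|exact: continuous_kern]. Qed.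

Lemma kern_lipschitz p eps : exists2 C : R, 0 <= C &
  forall (x v : E), `|kern p eps (x + v) - kern p eps x| <= C * `|v|.
Proof.
have bd' j : exists K, 0 <= K /\ forall z : E, `|kern (dkern eps j p) eps z| <= K.
  by have [K K0 hK] := kern_bounded (dkern eps j p) eps; exists K.
have [K hK] := choice bd'.
exists (n%:R * \sum_j K j); first by rewrite mulr_ge0// sumr_ge0// => j _; case: (hK j).
move=> x v; apply: (C1grad_lipschitz (C1grad_kern0 p eps)) => j z.
apply: le_trans ((hK j).2 z) _; rewrite (bigD1 j)//= lerDl sumr_ge0// => i _.
by case: (hK i).
Qed.

Lemma kern_taylor p eps : exists2 C : R, 0 <= C & forall (x v : E),
  `|kern p eps (x + v) - kern p eps x - \sum_j kern (dkern eps j p) eps x * v j ord0|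
    <= C * `|v| ^+ 2.
Proof.
have bd' j : exists K, 0 <= K /\ forall x v : E,
    `|kern (dkern eps j p) eps (x + v) - kern (dkern eps j p) eps x| <= K * `|v|.
  by have [K K0 hK] := kern_lipschitz (dkern eps j p) eps; exists K.
have [K hK] := choice bd'.
exists (n%:R * \sum_j K j); first by rewrite mulr_ge0// sumr_ge0// => j _; case: (hK j).
move=> x v; apply: (C1grad_taylor (C1grad_kern0 p eps)) => j z w.
apply: le_trans ((hK j).2 z w) _; rewrite ler_wpM2r// (bigD1 j)//= lerDl sumr_ge0// => i _.
by case: (hK i).
Qed.

Lemma conv_lipschitz p eps g C : 0 < eps -> eps <= 1 -> uloc C g ->
  exists D, forall x v, `|conv p eps g (x + v) - conv p eps g x| <= D * `|v|.
Proof.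
move=> e0 e1 gC; have [K K0 hK] := kern_lipschitz p eps.
exists (K * (2 * C)) => x v.
have ix := conv_integrable p x e0 e1 gC.
have iv := conv_integrable p (x + v) e0 e1 gC.
rewrite -RintegralB//; under eq_Rintegral do rewrite -mulrBl.
rewrite mulrAC; apply: (uloc_le (a := x) (b := x + v) gC _ _ _).2.
- by apply: measurable_funB; exact: measurable_kern.
- move=> y; have := hK (y - x) (- v); rewrite normrN.
  by have -> : y - (x + v) = y - x - v by rewrite opprD addrA.
- by move=> y h h'; rewrite !(kern_supp1 _ e0 e1)// subrr.
Qed.

Lemma is_derive_conv p eps g C x v : 0 < eps -> eps <= 1 -> uloc C g ->
  is_derive x v (conv p eps g) (\sum_j - conv (dkern eps j p) eps g x * v j ord0).
Proof.
move=> e0 e1 gC; have [K K0 hK] := kern_taylor p eps.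
pose d : R := \sum_j - conv (dkern eps j p) eps g x * v j ord0.
rewrite -/d.
apply: (@is_derive_of_taylor _ _ _ _ _ _ (K * (2 * C) * `|v| ^+ 2)) => h.
  have ix := conv_integrable p x e0 e1 gC.
  have iv := conv_integrable p (x + h *: v) e0 e1 gC.
  have id j := conv_integrable (dkern eps j p) x e0 e1 gC.
  have -> : conv p eps g (x + h *: v) - conv p eps g x - h * d =
    \int[mu]_y ((kern p eps (y - (x + h *: v)) - kern p eps (y - x) -
      \sum_j kern (dkern eps j p) eps (y - x) * (- (h *: v)) j ord0) * g y).
    have is_ : mu.-integrable setT (EFin \o (fun y => \sum_j (h * v j ord0) * (kern (dkern eps j p) eps (y - x) * g y))).
      by apply: integrable_real_sum => // j; exact: integrable_realZ.
    transitivity (conv p eps g (x + h *: v) - conv p eps g x +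
      \int[mu]_y \sum_j (h * v j ord0) * (kern (dkern eps j p) eps (y - x) * g y)).
      rewrite Rintegral_sum//; last by move=> j; exact: integrable_realZ.
      rewrite /d; congr (_ - _ + _).
      rewrite mulr_sumr -sumrN; apply: eq_bigr => j _; rewrite RintegralZl// /conv; ring.
    rewrite /conv -RintegralB// -RintegralD//; last exact: integrable_realB.
    apply: eq_Rintegral => y _; rewrite mulrBl mulrBl; congr (_ + _).
    rewrite mulr_suml -sumrN; apply: eq_bigr => j _; rewrite !mxE; ring.
  rewrite mulrAC -mulrA mulrAC -mulrA; apply: le_trans (_ : K * `|h *: v| ^+ 2 * (2 * C) <= _); last first.
    by rewrite normrZ exprMn sqnormr le_eqVlt; apply/orP; left; apply/eqP; ring.
  apply: (uloc_le (a := x) (b := x + h *: v) gC _ _ _).2.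
  - apply: measurable_funB; first by apply: measurable_funB; exact: measurable_kern.
    apply: measurable_sum => j; apply: measurable_funM => //; exact: measurable_kern.
  - move=> y; have := hK (y - x) (- (h *: v)); rewrite normrN.
    by have -> : y - (x + h *: v) = y - x - h *: v by rewrite opprD addrA.
  - move=> y h1 h2; rewrite !(kern_supp1 _ e0 e1)// subrr sub0r big1 ?oppr0// => j _.
    by rewrite (kern_supp1 _ e0 e1)// mul0r.
Qed.

(** The kernel has a Taylor expansion with uniform quadratic remainder, which
    may be integrated against [g]; no differentiation under the integral sign is
    involved. *)
Lemma C1grad_conv p eps g C : 0 < eps -> eps <= 1 -> uloc C g ->
  C1grad (conv p eps g) (fun j x => - conv (dkern eps j p) eps g x).
Proof.
move=> e0 e1 gC.
have ct p' : continuous (conv p' eps g).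
  by have [D hD] := conv_lipschitz p' e0 e1 gC; apply: lipschitz_cts hD.
split => [x v||j].
- exact: (is_derive_conv p x v e0 e1 gC).
- exact: ct.
- exact: continuousNf.
Qed.

End convolution.

(** * Mollification kernels *)

Section mollifier.
Context {R : realType} {n : nat} (n0 : (0 < n)%N).
Local Notation E := 'cV[R]_n.
Local Notation mu := (@lebesgue_cV R n).
Implicit Types (g : E -> R).

Lemma integral_translate (c : E) (h : E -> \bar R) : measurable_fun setT h ->
  (forall x, (0 <= h x)%E) -> (\int[mu]_x h (x + c)%R = \int[mu]_x h x)%E.
Proof.
move=> mh h0; have := @integral_affine R n c 1 setT h ltr01 measurableT mh (fun x _ => h0 x).
rewrite expr1n mul1e preimage_setT => <-; apply: eq_integral => x _.
by rewrite scale1r addrC.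
Qed.

Lemma measurable_translate (c : E) d (T : measurableType d) (h : E -> T) :
  measurable_fun setT h -> measurable_fun setT (fun x : E => h (x + c)).
Proof.
move=> mh; apply: (measurableT_comp mh).
have := measurable_affine c (1 : R); apply: eq_measurable_fun => x _.
by rewrite scale1r addrC.
Qed.

Definition bump_profile : 'I_n -> {poly R} * nat := fun=> (1, 0%N).

Lemma bump1E (t : R) : bump1 (1, 0%N) t = if `|t| < 1 then expR (- (1 - t ^+ 2)^-1) else 0.
Proof. by rewrite /bump1/= hornerE expr0 divr1 mul1r. Qed.

Lemma bump1_ge0 (t : R) : 0 <= bump1 (1, 0%N) t.
Proof. by rewrite bump1E; case: ifP => // _; exact: expR_ge0. Qed.

Lemma kern0_ge0 eps (z : E) : 0 <= kern bump_profile eps z.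
Proof. by apply: prodr_ge0 => i _; exact: bump1_ge0. Qed.

Lemma kern0_le1 eps (z : E) : kern bump_profile eps z <= 1.
Proof.
rewrite /kern.
apply: (@le_trans _ _ (\prod_(i < n) 1)); last by rewrite !big1.
apply: ler_prod => i _; rewrite bump1_ge0/= bump1E; case: ifP => // t1.
rewrite expR_le1 oppr_le0 invr_ge0 subr_ge0 -sqnormr.
by rewrite exprn_ile1// ltW.
Qed.

Lemma kern0N eps (z : E) : kern bump_profile eps (- z) = kern bump_profile eps z.
Proof.
apply: eq_bigr => i _; rewrite mxE mulNr /bump_profile !bump1E normrN.
by rewrite sqrrN.
Qed.

Lemma kern0_lb eps (z : E) : `|z| < eps / 2 -> expR (- 2) ^+ n <= kern bump_profile eps z.
Proof.
move=> zr; have e0 : 0 < eps by have := normr_ge0 z; lra.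
rewrite -[X in _ ^+ X]card_ord -prodr_const; apply: ler_prod => i _.
rewrite expR_ge0/= /bump_profile bump1E.
have h : `|z i ord0 / eps| < 2^-1.
  rewrite normrM normfV [`|eps|]gtr0_norm// ltr_pdivrMr//.
  by rewrite mulrC; apply: le_lt_trans (norm_coord_le z i) _.
rewrite ifT; last by lra.
rewrite ler_expR lerN2 -[leRHS]invrK lef_pV2 ?posrE//; last first.
  rewrite subr_gt0 -sqnormr; have := normr_ge0 (z i ord0 / eps); nra.
rewrite -sqnormr; have := normr_ge0 (z i ord0 / eps); nra.
Qed.

Definition mass eps : R := \int[mu]_z kern bump_profile eps z.

Lemma kern0_integrable eps : 0 < eps -> mu.-integrable setT (EFin \o kern bump_profile eps).
Proof.
move=> e0.
have mb : measurable (ball (0 : E) eps) by exact: measurable_ball_cV.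
have ib : mu.-integrable setT (EFin \o \1_(ball (0 : E) eps)).
  apply: integrable_indic_lty => //; rewrite [X in (X < _)%E]lebesgue_cV_ball//; exact: ltry.
apply: (integrable_real_le measurableT _ ib).
  by apply: continuous_measurable_cV; exact: continuous_kern.
move=> z _; rewrite ger0_norm ?kern0_ge0//.
have [ze|ze] := ltP `|z| eps.
  have zb : z \in (ball (0 : E) eps : set E) by apply/mem_set/ball_normP; rewrite sub0r normrN.
  by rewrite indicE zb kern0_le1.
by rewrite kern_supp.
Qed.

Lemma mass_lb eps : 0 < eps -> expR (- 2) ^+ n * eps ^+ n <= mass eps.
Proof.
move=> e0; have ik := kern0_integrable e0.
rewrite -lee_fin /mass Rintegral_EFin//.
have mb : measurable (ball (0 : E) (eps / 2)) by exact: measurable_ball_cV.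
have e2 : 0 < eps / 2 by rewrite divr_gt0.
apply: (@le_trans _ _ (\int[mu]_z (expR (-2) ^+ n * \1_(ball (0 : E) (eps / 2)) z)%:E)%E).
  under eq_integral do rewrite EFinM.
  rewrite ge0_integralZl//.
  - rewrite integral_indic// setIT [X in (_ * X)%E]lebesgue_cV_ball//.
    by rewrite EFinM mulrC divfK.
  - exact/measurable_EFinP/measurable_indic.
apply: ge0_le_integral => //.
- by apply/measurable_EFinP; apply: measurable_funM => //; exact: measurable_indic.
- exact: measurable_int ik.
move=> z _; rewrite lee_fin indicE; have [zb|_] := boolP (_ \in _); last first.
  by rewrite mulr0 kern0_ge0.
rewrite mulr1; apply: kern0_lb.
by move: zb => /set_mem/ball_normP; rewrite sub0r normrN.
Qed.

Lemma mass_gt0 eps : 0 < eps -> 0 < mass eps.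
Proof.
move=> e0; apply: lt_le_trans (mass_lb e0).
by rewrite mulr_gt0// exprn_gt0// expR_gt0.
Qed.

Definition mker eps (z : E) : R := (mass eps)^-1 * kern bump_profile eps z.

Definition mol eps g (x : E) : R := \int[mu]_y (mker eps (y - x) * g y).

Lemma mker_ge0 eps z : 0 < eps -> 0 <= mker eps z.
Proof. by move=> e0; rewrite mulr_ge0 ?kern0_ge0// invr_ge0 ltW// mass_gt0. Qed.

Lemma mkerN eps z : mker eps (- z) = mker eps z.
Proof. by rewrite /mker kern0N. Qed.

Lemma mker_supp eps z : 0 < eps -> eps <= `|z| -> mker eps z = 0.
Proof. by move=> e0 ez; rewrite /mker kern_supp// mulr0. Qed.

Lemma mker_le eps z : 0 < eps -> mker eps z <= expR 2 ^+ n * eps ^- n.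
Proof.
move=> e0; rewrite /mker -[leRHS]mulr1; apply: ler_pM; rewrite ?kern0_ge0 ?kern0_le1//.
  by rewrite invr_ge0 ltW// mass_gt0.
rewrite -[leRHS]invrK lef_pV2 ?posrE ?mass_gt0//.
  by rewrite invfM invrK -exprVn -expRN; exact: mass_lb.
by rewrite invr_gt0 mulr_gt0 ?exprn_gt0 ?expR_gt0// invr_gt0 exprn_gt0.
Qed.

Lemma measurable_mker eps : measurable_fun setT (mker eps).
Proof.
by apply: measurable_funM => //; apply: continuous_measurable_cV; exact: continuous_kern.
Qed.

Lemma measurable_mkersub eps x : measurable_fun setT (fun y : E => mker eps (y - x)).
Proof. by apply: measurable_translate; exact: measurable_mker. Qed.

Lemma mker_int eps x : 0 < eps -> (\int[mu]_y (mker eps (y - x))%:E = 1)%E.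
Proof.
move=> e0.
rewrite (@integral_translate (- x) (EFin \o mker eps)); last 2 first.
- by apply/measurable_EFinP; exact: measurable_mker.
- by move=> y; rewrite lee_fin mker_ge0.
rewrite /comp /mker; under eq_integral do rewrite EFinM.
rewrite ge0_integralZl//; last 3 first.
- exact: measurable_int (kern0_integrable e0).
- by move=> y _; rewrite lee_fin kern0_ge0.
- by rewrite lee_fin invr_ge0 ltW// mass_gt0.
rewrite -Rintegral_EFin//; last exact: kern0_integrable.
by rewrite -EFinM mulVf// gt_eqF// mass_gt0.
Qed.

(** The kernel has mass one, so mollification is an average. *)
Lemma mker_jensen eps (h : E -> \bar R) N x : (0 < N)%N -> 0 < eps ->
  measurable_fun setT h -> (forall y, 0 <= h y)%E ->
  ((\int[mu]_y ((mker eps (y - x))%:E * h y)) ^+ N <=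
    \int[mu]_y ((mker eps (y - x))%:E * h y ^+ N))%E.
Proof.
move=> N0 e0 mh h0.
exact: (@jensen_pow _ _ R mu setT (fun y => mker eps (y - x)) h N N0
  measurableT (measurable_mkersub eps x) (fun y _ => mker_ge0 _ e0) mh (fun y _ => h0 y) (mker_int x e0)).
Qed.

Lemma mker_int_le eps (h : E -> \bar R) x : 0 < eps ->
  measurable_fun setT h -> (forall y, 0 <= h y)%E ->
  (\int[mu]_y ((mker eps (y - x))%:E * h y) <=
    (expR 2 ^+ n * eps ^- n)%:E * \int[mu]_(y in ball x eps) h y)%E.
Proof.
move=> e0 mh h0.
have mb : measurable (ball x eps : set E) by exact: measurable_ball_cV.
have B0 : 0 <= expR 2 ^+ n * eps ^- n.
  by rewrite mulr_ge0 ?exprn_ge0 ?expR_ge0// invr_ge0 exprn_ge0// ltW.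
rewrite -ge0_integralZl//; last exact: measurable_funTS.
rewrite [leRHS]integral_mkcond; apply: ge0_le_integral => //.
- by move=> y _; rewrite mule_ge0// lee_fin mker_ge0.
- by apply: emeasurable_funM => //; apply/measurable_EFinP; exact: measurable_mkersub.
- apply/(measurable_restrictT _ mb); apply: measurable_funTS.
  by apply: emeasurable_funM => //; exact: measurable_cst.
move=> y _; rewrite patchE; case: ifPn => [_|/negP yb].
  by rewrite lee_wpmul2r// lee_fin mker_le.
rewrite mker_supp ?mul0e//; rewrite leNgt; apply/negP => yx; apply: yb.
by apply/mem_set/ball_normP; rewrite distrC.
Qed.

(** The integrand on the product space, for which measurability and Tonelli's theorem are stated. *)
Definition mker2 eps (h : E -> \bar R) (xy : E * E) := ((mker eps (xy.2 - xy.1))%:E * h xy.2)%E.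

Lemma measurable_mker2 eps (h : E -> \bar R) : measurable_fun setT h ->
  measurable_fun setT (mker2 eps h).
Proof.
move=> mh.
have msub : measurable_fun setT (fun xy : E * E => (xy.2 - xy.1 : E)).
  apply/measurable_fun_cVP => i; under eq_fun do rewrite !mxE.
  apply: measurable_funB.
    exact: (measurableT_comp (measurable_coord i) measurable_snd).
  exact: (measurableT_comp (measurable_coord i) measurable_fst).
apply: emeasurable_funM; last exact: measurableT_comp.
apply/measurable_EFinP; exact: (measurableT_comp (measurable_mker eps) msub).
Qed.

Lemma mker2_ge0 eps h xy : 0 < eps -> (forall y, 0 <= h y)%E -> (0 <= mker2 eps h xy)%E.
Proof. by move=> e0 h0; rewrite mule_ge0// lee_fin mker_ge0. Qed.

Lemma measurable_mker_int eps (h : E -> \bar R) : 0 < eps ->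
  measurable_fun setT h -> (forall y, 0 <= h y)%E ->
  measurable_fun setT (fun x : E => \int[mu]_y ((mker eps (y - x))%:E * h y))%E.
Proof.
move=> e0 mh h0.
have := @measurable_fun_fubini_tonelli_F _ _ _ _ R mu (mker2 eps h) (measurable_mker2 eps mh) (fun xy => mker2_ge0 xy e0 h0).
by apply: eq_measurable_fun => x _.
Qed.

Lemma mker_tonelli eps (h : E -> \bar R) : 0 < eps ->
  measurable_fun setT h -> (forall y, 0 <= h y)%E ->
  (\int[mu]_x \int[mu]_y ((mker eps (y - x))%:E * h y) = \int[mu]_y h y)%E.
Proof.
move=> e0 mh h0.
have := @fubini_tonelli _ _ _ _ R mu mu (mker2 eps h) (measurable_mker2 eps mh) (fun xy => mker2_ge0 xy e0 h0).
rewrite [X in X = _ -> _](_ : _ = \int[mu]_x \int[mu]_y ((mker eps (y - x))%:E * h y))%E; last first.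
  by apply: eq_integral => x _; apply: eq_integral => y _.
move=> ->.
apply: eq_integral => y _; rewrite /mker2.
under eq_integral do rewrite /=.
rewrite ge0_integralZr//; last 2 first.
- apply/measurable_EFinP; have := measurable_mkersub eps y.
  by apply: eq_measurable_fun => x _; rewrite -mkerN opprB.
- by move=> x _; rewrite lee_fin mker_ge0.
rewrite [X in (X * _)%E](_ : _ = 1%E) ?mul1e//.
apply: etrans (mker_int y e0).
by apply: eq_integral => x _; rewrite -mkerN opprB.
Qed.

Lemma mker_tonelli_on eps (h : E -> \bar R) (D D' : set E) : 0 < eps ->
  measurable D -> measurable D' -> (forall x y, D x -> `|y - x| < eps -> D' y) ->
  measurable_fun setT h -> (forall y, 0 <= h y)%E ->
  (\int[mu]_(x in D) \int[mu]_y ((mker eps (y - x))%:E * h y) <= \int[mu]_(y in D') h y)%E.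
Proof.
move=> e0 mD mD' DD' mh h0.
have mh' : measurable_fun setT (h \_ D') by apply/(measurable_restrictT _ mD'); exact: measurable_funTS.
have h'0 y : (0 <= (h \_ D') y)%E by rewrite patchE; case: ifP.
rewrite [leRHS]integral_mkcond -(mker_tonelli e0 mh' h'0).
rewrite [leLHS]integral_mkcond; apply: ge0_le_integral => //.
- move=> x _; rewrite patchE; case: ifP => // _; apply: integral_ge0 => y _.
  by rewrite mule_ge0// lee_fin mker_ge0.
- apply/(measurable_restrictT _ mD); apply: measurable_funTS; exact: measurable_mker_int.
- exact: measurable_mker_int.
move=> x _; rewrite patchE; case: ifPn => [/set_mem Dx|_]; last first.
  by apply: integral_ge0 => y _; rewrite mule_ge0// lee_fin mker_ge0.
rewrite le_eqVlt; apply/orP; left; apply/eqP/eq_integral => y _.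
have [yx|yx] := ltP `|y - x| eps; last by rewrite mker_supp// !mul0e.
by rewrite patchE mem_set//; exact: DD' yx.
Qed.

End mollifier.

(** * Mollifications of locally integrable functions *)

Section continuity_at.
Context {R : realType} {V : normedModType R}.

Lemma continuous_at_ball (f : V -> R) x d : {for x, continuous f} -> 0 < d ->
  exists2 r, 0 < r & forall y, `|x - y| < r -> `|f x - f y| <= d.
Proof.
move=> cf d0; have /cvgrPdist_le/(_ _ d0)/nbhs_ballP[r /= r0 hr] := cf.
by exists r => // y xy; apply: hr; rewrite -ball_normE.
Qed.

End continuity_at.

Section local_integrability.
Context {R : realType} {n : nat}.
Local Notation E := 'cV[R]_n.
Local Notation mu := (@lebesgue_cV R n).
Local Notation mass := (@mass R n).
Implicit Types (g h : E -> R).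

Definition locint g := exists C, uloc C g.

Lemma locint_le g h : measurable_fun setT g -> locint h ->
  (forall x, `|g x| <= `|h x|) -> locint g.
Proof.
move=> mg [C [mh hC]] gh; exists C; split=> // x; apply: le_trans (hC x).
have mb : measurable (ball x (1 : R) : set E) by exact: measurable_ball_cV.
apply: ge0_le_integral => //.
- by apply/measurable_EFinP; apply: measurableT_comp => //; exact: measurable_funTS.
- by apply/measurable_EFinP; apply: measurableT_comp => //; exact: measurable_funTS.
- by move=> y _; rewrite lee_fin.
Qed.

Lemma locintD g h : locint g -> locint h -> locint (fun x => g x + h x).
Proof.
move=> [C [mg gC]] [C' [mh hC]]; exists (C + C'); split; first exact: measurable_funD.
move=> x; have mb : measurable (ball x (1 : R) : set E) by exact: measurable_ball_cV.
have mg' : measurable_fun (ball x (1 : R) : set E) (fun y => `|g y|%:E).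
  by apply/measurable_EFinP; apply: measurableT_comp => //; exact: measurable_funTS.
have mh' : measurable_fun (ball x (1 : R) : set E) (fun y => `|h y|%:E).
  by apply/measurable_EFinP; apply: measurableT_comp => //; exact: measurable_funTS.
apply: (@le_trans _ _ (\int[mu]_(y in ball x 1%R) (`|g y|%:E + `|h y|%:E))%E).
  apply: ge0_le_integral => //.
  - apply/measurable_EFinP; apply: measurableT_comp => //; apply: measurable_funTS.
    exact: measurable_funD.
  - exact: emeasurable_funD.
  - by move=> y _; rewrite -EFinD lee_fin ler_normD.
by rewrite ge0_integralD// EFinD leeD.
Qed.

Lemma locint_cst (c : R) : locint (fun=> c).
Proof.
exists (`|c| * 2 ^+ n); split => // x.
rewrite integral_cst//; last exact: measurable_ball_cV.
by rewrite [X in (_ * X)%E]lebesgue_cV_ball// mulr1 EFinM.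
Qed.

Lemma locint_norm g : locint g -> locint (fun x => `|g x|).
Proof.
move=> gl; have [C [mg _]] := gl; apply: (locint_le _ gl); first exact: measurableT_comp.
by move=> x; rewrite normr_id.
Qed.

Lemma locint_sum (I : Type) (s : seq I) (g : I -> E -> R) : (forall i, locint (g i)) ->
  locint (fun x => \sum_(i <- s) g i x).
Proof.
move=> gl; elim: s => [|i s IH].
  by under eq_fun do rewrite big_nil; exact: locint_cst.
by under eq_fun do rewrite big_cons; exact: locintD.
Qed.

Lemma locint_int g : mu.-integrable setT (EFin \o g) -> locint g.
Proof.
move=> ig; have mg : measurable_fun setT g by apply/measurable_EFinP; exact: measurable_int ig.
have /integrableP[_ goo] := ig.
exists (fine (\int[mu]_x `|g x|%:E)); split => // x.
have mb : measurable (ball x (1 : R) : set E) by exact: measurable_ball_cV.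
rewrite fineK; last by rewrite ge0_fin_numE//; exact: integral_ge0.
apply: ge0_subset_integral => //.
by apply/measurable_EFinP; exact: measurableT_comp.
Qed.

Lemma locint_pow g N : (0 < N)%N -> measurable_fun setT g ->
  mu.-integrable setT (EFin \o (fun x => `|g x| ^+ N)) -> locint g.
Proof.
move=> N0 mg /locint_int ig; apply: (locint_le mg (locintD (locint_cst 1) ig)) => x.
have g0 : 0 <= `|g x| ^+ N by rewrite exprn_ge0.
rewrite [leRHS]ger0_norm; last by rewrite addr_ge0.
have [g1|g1] := leP `|g x| 1; first by rewrite (le_trans g1)// lerDl.
by rewrite (@le_trans _ _ (`|g x| ^+ N))//; [rewrite ler_eXnr// ltW|rewrite lerDr].
Qed.

Lemma mol_integrable eps g C x : 0 < eps -> eps <= 1 -> uloc C g ->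
  mu.-integrable setT (EFin \o (fun y => mker eps (y - x) * g y)).
Proof.
move=> e0 e1 gC; have := integrable_realZ measurableT (mass eps)^-1 (conv_integrable bump_profile x e0 e1 gC).
by congr (_.-integrable _ (_ \o _)); apply/funext => y; rewrite /mker mulrA.
Qed.

Lemma molE eps g C : 0 < eps -> eps <= 1 -> uloc C g ->
  mol eps g = fun x => (mass eps)^-1 * conv bump_profile eps g x.
Proof.
move=> e0 e1 gC; apply/funext => x; rewrite /conv -RintegralZl//; last exact: conv_integrable gC.
by apply: eq_Rintegral => y _; rewrite /mker mulrA.
Qed.

Lemma locint_mol_integrable eps g x : 0 < eps -> eps <= 1 -> locint g ->
  mu.-integrable setT (EFin \o (fun y => mker eps (y - x) * g y)).
Proof. by move=> e0 e1 [C gC]; exact: mol_integrable gC. Qed.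

Lemma mol_EFin eps g x : 0 < eps -> eps <= 1 -> locint g ->
  ((mol eps g x)%:E = \int[mu]_y ((mker eps (y - x))%:E * (g y)%:E))%E.
Proof. by move=> e0 e1 gl; rewrite /mol Rintegral_EFin//; exact: locint_mol_integrable. Qed.

Lemma mol_norm_le eps g x : 0 < eps -> eps <= 1 -> locint g ->
  `|mol eps g x| <= mol eps (fun y => `|g y|) x.
Proof.
move=> e0 e1 gl; have ig := locint_mol_integrable x e0 e1 gl.
rewrite -lee_fin mol_EFin//; last exact: locint_norm.
rewrite EFin_normr_Rintegral//.
apply: le_trans (le_abse_integral _ measurableT (measurable_int _ ig)) _.
rewrite le_eqVlt; apply/orP; left; apply/eqP/eq_integral => y _.
by rewrite /= normrM ger0_norm// mker_ge0.
Qed.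

Lemma mol_sum eps (I : Type) (s : seq I) (g : I -> E -> R) x : 0 < eps -> eps <= 1 ->
  (forall i, locint (g i)) ->
  mol eps (fun y => \sum_(i <- s) g i y) x = \sum_(i <- s) mol eps (g i) x.
Proof.
move=> e0 e1 gl; rewrite /mol -Rintegral_sum//; last by move=> i; exact: locint_mol_integrable.
by apply: eq_Rintegral => y _; rewrite mulr_sumr.
Qed.

Lemma mol_subc eps g c x : 0 < eps -> eps <= 1 -> locint g ->
  mol eps (fun y => g y - c) x = mol eps g x - c.
Proof.
move=> e0 e1 gl.
have ik : mu.-integrable setT (EFin \o (fun y => mker eps (y - x))).
  have := locint_mol_integrable x e0 e1 (locint_cst 1).
  by congr (_.-integrable _ (_ \o _)); apply/funext => y; rewrite mulr1.
have mc : mol eps (fun=> c) x = c.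
  rewrite /mol RintegralZr//; apply: EFin_inj; rewrite EFinM Rintegral_EFin//.
  by rewrite mker_int// mul1e.
rewrite -[in RHS]mc /mol -RintegralB//; [|exact: locint_mol_integrable|].
  by apply: eq_Rintegral => y _; rewrite mulrBr.
by apply: locint_mol_integrable => //; exact: locint_cst.
Qed.

Lemma mol_pow_le eps g N x : (0 < N)%N -> 0 < eps -> eps <= 1 -> locint g ->
  ((`|mol eps g x| ^+ N)%:E <= \int[mu]_y ((mker eps (y - x))%:E * (`|g y| ^+ N)%:E))%E.
Proof.
move=> N0 e0 e1 gl.
have [_ [mg _]] := gl.
apply: (@le_trans _ _ ((mol eps (fun y => `|g y|) x)%:E ^+ N)%E).
  by rewrite -EFin_expe lee_fin lerXn2r ?nnegrE ?mol_norm_le// (le_trans _ (mol_norm_le x e0 e1 gl)).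
rewrite mol_EFin//; last exact: locint_norm.
apply: le_trans (mker_jensen (h := fun y => `|g y|%:E) x N0 e0 _ _) _ => //.
  by apply/measurable_EFinP; exact: measurableT_comp.
by rewrite le_eqVlt; apply/orP; left; apply/eqP/eq_integral => y _; rewrite EFin_expe.
Qed.

Definition mol_radius (k : nat) : R := k.+1%:R^-1.

Lemma mol_radius_gt0 k : 0 < mol_radius k. Proof. by rewrite invr_gt0. Qed.

Lemma mol_radius_le1 k : mol_radius k <= 1. Proof. by rewrite invf_le1// ler1n. Qed.

Lemma mol_radius_near r : 0 < r -> \forall k \near \oo, mol_radius k < r.
Proof.
move=> r0; near=> k; rewrite /mol_radius invf_plt ?posrE//.
apply: lt_trans (_ : k%:R < _); last by rewrite ltr_nat.
by near: k; exact: nbhs_infty_gtr.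
Unshelve. all: by end_near. Qed.

(** The kernel is at most a multiple of the indicator of a cube over its volume,
    and the mean of [|g - g x| ^+ N] over small cubes tends to zero. *)
Lemma mol_cvg g N x : (0 < N)%N -> locint g -> leb_pt N g x ->
  mol (mol_radius k) g x @[k --> \oo] --> g x.
Proof.
move=> N0 gl gx; apply/cvgrPdist_le => e e0.
have [_ [mg _]] := gl.
have B0 : 0 < expR 2 ^+ n :> R by rewrite exprn_gt0// expR_gt0.
have d0 : 0 < e ^+ N / expR 2 ^+ n by rewrite divr_gt0// exprn_gt0.
have [r /= r0 hr] := gx _ d0.
near=> k.
have ek0 := mol_radius_gt0 k; have ek1 := mol_radius_le1 k.
have epr : mol_radius k < r by near: k; exact: mol_radius_near.
rewrite distrC -mol_subc//.
have gl' : locint (fun y => g y - g x) by apply: locintD => //; exact: locint_cst.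
rewrite -(@ler_pXn2r _ N)// ?nnegrE ?(ltW e0)//.
rewrite -lee_fin; apply: le_trans (mol_pow_le x N0 ek0 ek1 gl') _.
apply: le_trans (mker_int_le (h := fun y => (`|g y - g x| ^+ N)%:E) x ek0 _ _) _.
- apply/measurable_EFinP; apply: measurable_funX; apply: measurableT_comp => //.
  exact: measurable_funB.
- by move=> y; rewrite lee_fin exprn_ge0.
have := hr (mol_radius k); rewrite /ball/= sub0r normrN gtr0_norm// => /(_ epr ek0) h.
apply: (@le_trans _ _ ((expR 2 ^+ n * mol_radius k ^- n)%:E * (e ^+ N / expR 2 ^+ n * mol_radius k ^+ n)%:E)%E).
  by apply: lee_wpmul2l => //; rewrite lee_fin mulr_ge0 ?(ltW B0)// invr_ge0 exprn_ge0// ltW.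
have ek : mol_radius k ^+ n != 0 by rewrite expf_neq0// gt_eqF.
rewrite -EFinM lee_fin le_eqVlt; apply/orP; left; apply/eqP.
by field; rewrite ek gt_eqF.
Unshelve. all: by end_near. Qed.

Lemma leb_pt_continuous g x : measurable_fun setT g -> {for x, continuous g} -> leb_pt 1 g x.
Proof.
move=> mg cg e e0.
have d0 : 0 < e / 2 ^+ n by rewrite divr_gt0// exprn_gt0.
have [r r0 hr] := continuous_at_ball cg d0.
near=> s; have s0 : 0 < s by near: s; exact: nbhs_right_gt.
have sr : s < r by near: s; exact: nbhs_right_lt.
have mb : measurable (ball x s : set E) by exact: measurable_ball_cV.
apply: (@le_trans _ _ (\int[mu]_(y in ball x s) (e / 2 ^+ n)%:E)%E); last first.
  rewrite integral_cst// [X in (_ * X)%E]lebesgue_cV_ball// -EFinM lee_fin exprMn.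
  by rewrite mulrA divfK// expf_neq0.
apply: ge0_le_integral => //.
- apply/measurable_EFinP; apply: measurable_funTS; apply: measurableT_comp => //.
  exact: measurable_funB.
- move=> y /ball_normP yx; rewrite lee_fin expr1 distrC; apply: hr => /=.
  exact: lt_trans sr.
Unshelve. all: by end_near. Qed.

(** The gradient of [mol eps g], for any locally integrable [g]: differentiation
    falls on the kernel, and [x] enters it through [y - x], whence the sign. *)
Definition dmol eps j g (x : E) : R := - (mass eps)^-1 * conv (dkern eps j bump_profile) eps g x.

Definition d2mol eps j k g (x : E) : R :=
  (mass eps)^-1 * conv (dkern eps j (dkern eps k bump_profile)) eps g x.

Lemma d2molC eps j k g x : d2mol eps j k g x = d2mol eps k j g x.
Proof. by rewrite /d2mol dkernC. Qed.

Lemma C1grad_mol eps g : 0 < eps -> eps <= 1 -> locint g ->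
  C1grad (mol eps g) (fun j => dmol eps j g).
Proof.
move=> e0 e1 [C gC]; rewrite (molE e0 e1 gC).
have := C1gradZ (mass eps)^-1 (C1grad_conv bump_profile e0 e1 gC).
by congr C1grad; apply/funext => j; apply/funext => x; rewrite /dmol mulrN mulNr.
Qed.

Lemma C1grad_dmol eps g j : 0 < eps -> eps <= 1 -> locint g ->
  C1grad (dmol eps j g) (fun k => d2mol eps k j g).
Proof.
move=> e0 e1 [C gC].
have := C1gradZ (- (mass eps)^-1) (C1grad_conv (dkern eps j bump_profile) e0 e1 gC).
by congr C1grad; apply/funext => k; apply/funext => x; rewrite /d2mol mulrNN.
Qed.

(** The weak derivative is tested against the mollification kernel centred at
    [x], which is a test function as soon as its support lies in [Omega]. *)
Lemma dmol_mol eps Omega u g j x : 0 < eps -> eps <= 1 -> locint (g \_ Omega) ->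
  [set y : E | `|x - y| <= eps] `<=` Omega ->
  measurable Omega -> weak_partial Omega j u g -> dmol eps j (u \_ Omega) x = mol eps (g \_ Omega) x.
Proof.
move=> e0 e1 gl xO mO wug.
have := wug _ (test_function_kern bump_profile e0 xO).
have eqI (q : E -> R) p : \int[mu]_y (kern p eps (y - x) * (q \_ Omega) y) =
    \int[mu]_(y in Omega) (q y * kern p eps (y - x)).
  rewrite [RHS]Rintegral_mkcond; apply: eq_Rintegral => y _; rewrite !patchE.
  by case: ifP => _; rewrite ?mulr0// mulrC.
have -> : partial j (fun y => kern bump_profile eps (y - x)) = fun y => kern (dkern eps j bump_profile) eps (y - x).
  by have /= := smooth_kern bump_profile eps x [:: j].
rewrite -[LHS]eqI -[X in _ = - X]eqI => h; rewrite /dmol /conv h mulrNN.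
by have [C gC] := gl; rewrite (molE e0 e1 gC).
Qed.

End local_integrability.

(** * Jacobians as null Lagrangians *)

Section compact_support.
Context {R : realType} {n : nat}.
Local Notation E := 'cV[R]_n.
Local Notation mu := (@lebesgue_cV R n).
Implicit Types (x c : E) (u w : E -> R) (g : 'I_n -> E -> R).

Definition csupp c r u := forall x, r <= `|c - x| -> u x = 0.

Lemma csuppM c r u w : csupp c r u -> csupp c r (fun x => u x * w x).
Proof. by move=> h x cx; rewrite h// mul0r. Qed.

Lemma csupp_bounded c r u : continuous u -> csupp c r u -> exists2 M, 0 <= M & forall x, `|u x| <= M.
Proof.
move=> cu su.
have [M0 hM] : exists M, forall x, [set y : E | `|c - y| <= r] x -> `|u x| <= M.
  have cK := @cV_compact_cball R n c r.
  have := continuous_compact (continuous_subspaceT cu) cK.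
  move=> /compact_bounded[M [_ hM]]; exists (M + 1) => x xK.
  by apply: (hM (M + 1)); rewrite ?ltrDl//; exists x.
exists (Num.max M0 0); first by rewrite le_max lexx orbT.
move=> x; have [h|h] := leP `|c - x| r.
  by rewrite le_max hM.
by rewrite su ?normr0 ?le_max ?lexx ?orbT// ltW.
Qed.

Lemma csupp_integrable c r u : 0 < r -> continuous u -> csupp c r u ->
  mu.-integrable setT (EFin \o u).
Proof.
move=> r0 cu su; have [M M0 hM] := csupp_bounded cu su.
have mb : measurable (ball c r : set E) by exact: measurable_ball_cV.
have ib : mu.-integrable setT (EFin \o (fun x => M * \1_(ball c r : set E) x)).
  apply: integrable_realZ => //; apply: integrable_indic_lty => //.
  by rewrite [X in (X < _)%E]lebesgue_cV_ball//; exact: ltry.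
apply: (integrable_real_le measurableT _ ib); first exact: continuous_measurable_cV.
move=> x _; rewrite indicE; have [xb|/negP xb] := boolP (_ \in _); first by rewrite mulr1.
rewrite su ?normr0 ?mulr0// leNgt; apply/negP => h; apply: xb.
exact/mem_set/ball_normP.
Qed.

Lemma integral_translate_signed (c : E) (h : E -> \bar R) : measurable_fun setT h ->
  (\int[mu]_x h (x + c)%R = \int[mu]_x h x)%E.
Proof.
move=> mh; rewrite [LHS]integralE [RHS]integralE; congr (_ - _)%E.
  by rewrite -(integral_translate c (measurable_funepos mh) (funepos_ge0 h)); apply: eq_integral => x _; rewrite !funeposE.
by rewrite -(integral_translate c (measurable_funeneg mh) (funeneg_ge0 h)); apply: eq_integral => x _; rewrite !funenegE.
Qed.

Lemma norm_unit_cV (j : 'I_n) : `|unit_cV j : E| <= 1.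
Proof.
apply: norm_cV_le => // i; rewrite mxE; case: (_ && _); rewrite ?normr1 ?normr0//.
Qed.

Lemma dist_shift c x v : `|c - x| <= `|c - (x + v)| + `|v|.
Proof.
have e : c - x = (c - (x + v)) + v by apply/matrixP => i k; rewrite !mxE; ring.
by rewrite {1}e ler_normD.
Qed.

Lemma sum_unit_cV (a : 'I_n -> R) (t : R) j : \sum_i a i * (t *: unit_cV j : E) i ord0 = t * a j.
Proof.
rewrite (bigD1 j)//= !mxE !eqxx mulr1 mulrC big1 ?addr0// => i ij.
by rewrite !mxE (negbTE ij) !mulr0.
Qed.

(** By translation invariance all difference quotients integrate to [0], and
    they converge boundedly to the derivative. *)
Lemma int_deriv0 u g c r j : 0 < r -> C1grad u g -> csupp c r u ->
  csupp c r (g j) -> \int[mu]_x g j x = 0.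
Proof.
move=> r0 ug su sg; have [du cu cg] := ug.
have [M M0 hM] := csupp_bounded (cg j) sg.
pose F k (x : E) : R := k.+1%:R * (u (x + mol_radius k *: unit_cV j) - u x).
have FE k x : exists2 t : R, 0 <= t <= 1 & (F k x = g j (x + t *: (mol_radius k *: unit_cV j)))%R.
  have [t t01 ht] := C1grad_mvt x (mol_radius k *: unit_cV j) ug.
  by exists t => //; rewrite /F ht sum_unit_cV mulrA divff// mul1r.
have er1 k : mol_radius k <= 1 :> R by exact: mol_radius_le1.
have mb : measurable (ball c (r + 1) : set E) by exact: measurable_ball_cV.
have r1 : 0 < r + 1 by rewrite addr_gt0.
have iu := csupp_integrable r0 cu su.
have mu_ : measurable_fun setT u by exact: continuous_measurable_cV.
have ne k : `|(mol_radius k : R) *: unit_cV j : E| <= mol_radius k.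
  by rewrite normrZ gtr0_norm ?mol_radius_gt0// ler_piMr ?norm_unit_cV// ltW// mol_radius_gt0.
have it k : mu.-integrable setT (EFin \o (fun x => u (x + mol_radius k *: unit_cV j))).
  apply: (@csupp_integrable c (r + 1)) => //.
    by have := @continuous_subr R E u (- ((mol_radius k : R) *: unit_cV j)) cu; rewrite opprK.
  move=> x cx; apply: su.
  have := dist_shift c x (mol_radius k *: unit_cV j); have := ne k; have := er1 k; lra.
pose D (x : E) := M * \1_(ball c (r + 1) : set E) x.
have ib : mu.-integrable setT (EFin \o D).
  apply: integrable_realZ => //; apply: integrable_indic_lty => //.
  by rewrite [X in (X < _)%E]lebesgue_cV_ball//; exact: ltry.
have mD : measurable_fun setT D by apply/measurable_EFinP; exact: measurable_int ib.
have mF k : measurable_fun setT (F k).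
  apply: measurable_funM => //; apply: measurable_funB => //.
  by apply/measurable_EFinP; exact: measurable_int (it k).
have D0 x : 0 <= D x by rewrite mulr_ge0// indicE.
have FD k x : `|F k x| <= D x.
  rewrite /D indicE; have [xb|/negP xb] := boolP (_ \in _).
    by rewrite mulr1; have [t _ ->] := FE k x.
  have cx : r + 1 <= `|c - x| by rewrite leNgt; apply/negP => h; apply/xb/mem_set/ball_normP.
  rewrite /F !su ?subrr ?mulr0 ?normr0//; first by move: cx; lra.
  have := dist_shift c x (mol_radius k *: unit_cV j); have := ne k; have := er1 k; lra.
have Fcv x : F k x @[k --> \oo] --> g j x.
  apply/cvgrPdist_le => e e0; have [s s0 hs] := continuous_at_ball (cg j x) e0.
  near=> k; have [t /andP[t0 t1] ->] := FE k x; apply: hs.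
  rewrite opprD addrA subrr sub0r normrN normrZ ger0_norm//.
  apply: (@le_lt_trans _ _ (mol_radius k)); last by near: k; exact: mol_radius_near.
  by apply: le_trans (ne k); rewrite ler_piMl.
have mg : measurable_fun setT (g j) by exact: continuous_measurable_cV.
have [] := @pratt _ _ R mu F (g j) (fun=> D) D mF mg (fun=> mD) ib D0 (fun=> erefl) FD.
- exact: aeW.
- by apply: aeW => x; exact: cvg_cst.
move=> _.
have -> : (fun k => \int[mu]_x F k x) = fun=> 0.
  apply/funext => k; rewrite /F RintegralZl//; last exact: integrable_realB.
  rewrite RintegralB//; rewrite [X in X - _](_ : _ = \int[mu]_x u x) ?subrr ?mulr0//.
  rewrite /Rintegral; congr fine; apply: (integral_translate_signed _ (h := EFin \o u)).
  exact/measurable_EFinP.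
by move=> /cvg_lim <-//; rewrite lim_cst.
Unshelve. all: by end_near. Qed.

End compact_support.

Section null_lagrangian.
Context {R : realType} {n : nat}.
Local Notation E := 'cV[R]_n.
Local Notation mu := (@lebesgue_cV R n).
Implicit Types (x c : E) (u w : E -> R) (g : 'I_n -> E -> R).

Lemma C1grad_prodseq (I : eqType) (s : seq I) (u : I -> E -> R) (g : I -> 'I_n -> E -> R) :
  uniq s -> (forall i, C1grad (u i) (g i)) ->
  C1grad (fun x => \prod_(i <- s) u i x)
    (fun j x => \sum_(l <- s) \prod_(i <- s) (if i == l then g i j x else u i x)).
Proof.
move=> + ug; elim: s => [_|a s IH /= /andP[as_ us]].
  have := @C1grad_cst R n 1; congr C1grad.
    by apply/funext => x; rewrite big_nil.
  by apply/funext => j; apply/funext => x; rewrite big_nil.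
have := C1gradM (ug a) (IH us); congr C1grad.
  by apply/funext => x; rewrite big_cons.
apply/funext => j; apply/funext => x; rewrite big_cons addrC; congr (_ + _).
  rewrite big_cons eqxx mulrC; congr (_ * _); apply: eq_big_seq => i is_.
  by case: eqP => // ia; rewrite -ia is_ in as_.
rewrite mulr_sumr; apply: eq_big_seq => l ls; rewrite big_cons; case: eqP => // al.
by rewrite al ls in as_.
Qed.

Definition setrow i (v : 'I_n -> R) (A : 'I_n -> 'I_n -> R) : 'M[R]_n :=
  \matrix_(k, j) if k == i then v j else A k j.

Lemma det_setrow i v A : \det (setrow i v A) =
  \sum_(s : 'S_n) (-1) ^+ s * (v (s i) * \prod_(k | k != i) A k (s k)).
Proof.
apply: eq_bigr => s _; congr (_ * _); rewrite (bigD1 i)//= mxE eqxx; congr (_ * _).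
by apply: eq_bigr => k ki; rewrite mxE (negbTE ki).
Qed.

(** Multiplication by the transposition reverses the sign of every term. *)
Lemma alternating_sum0 (i l : 'I_n) (Q : 'S_n -> R) : i != l ->
  (forall s, Q (tperm i l * s)%g = Q s) -> \sum_(s : 'S_n) (-1) ^+ s * Q s = 0.
Proof.
move=> il hQ; apply/eqP; rewrite -[_ == 0]/((2%N == 0%N) || _) -mulrn_eq0 mulr2n.
rewrite {2}(reindex_inj (mulgI (tperm i l)))/= -big_split/= big1// => s _.
by rewrite hQ odd_mul_tperm il/= signrN mulNr subrr.
Qed.

Variables (F : 'I_n -> E -> R) (DF : 'I_n -> 'I_n -> E -> R)
  (D2F : 'I_n -> 'I_n -> 'I_n -> E -> R) (w : E -> R) (dw : 'I_n -> E -> R)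
  (c : E) (r : R).
Hypothesis r0 : 0 < r.
Hypothesis DF_C1 : forall k j, C1grad (DF k j) (D2F k j).
Hypothesis D2F_sym : forall k j l, D2F k j l = D2F k l j.
Hypothesis w_C1 : C1grad w dw.
Hypothesis w_supp : csupp c r w.
Hypothesis dw_supp : forall j, csupp c r (dw j).

Let s_ i := [seq k <- index_enum 'I_n | k != i].

Let prodE i (a : 'I_n -> R) : \prod_(k | k != i) a k = \prod_(k <- s_ i) a k.
Proof. by rewrite big_filter. Qed.

Let P i (s : 'S_n) x := \prod_(k <- s_ i) DF k (s k) x.
Let Q i (s : 'S_n) l x :=
  \prod_(k <- s_ i) (if k == l then D2F k (s k) (s i) x else DF k (s k) x).

Let by_parts i (s : 'S_n) :
  [/\ mu.-integrable setT (EFin \o (fun x => dw (s i) x * P i s x)),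
      forall l, mu.-integrable setT (EFin \o (fun x => w x * Q i s l x)) &
      \int[mu]_x (dw (s i) x * P i s x) = - \sum_(l <- s_ i) \int[mu]_x (w x * Q i s l x)].
Proof.
have us : uniq (s_ i) by rewrite filter_uniq// index_enum_uniq.
have PC1 := C1grad_prodseq us (fun k => DF_C1 k (s k)).
have wP := C1gradM w_C1 PC1.
have [_ cw cdw] := w_C1.
have cP : continuous (P i s) by have [] := PC1.
have cQ l : continuous (Q i s l).
  rewrite /Q; elim: (s_ i) => [|a t IH].
    by under eq_fun do rewrite big_nil; exact: cst_continuous.
  under eq_fun do rewrite big_cons; apply: continuousMf => //.
  have [_ ca cda] := DF_C1 a (s a).
  by case: (a == l); [exact: cda|exact: ca].
have i1 : mu.-integrable setT (EFin \o (fun x => dw (s i) x * P i s x)).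
  by apply: (csupp_integrable r0); [exact: continuousMf|exact: csuppM].
have i2 l : mu.-integrable setT (EFin \o (fun x => w x * Q i s l x)).
  by apply: (csupp_integrable r0); [exact: (continuousMf cw (cQ l))|exact: csuppM w_supp].
split=> //.
have h : \int[mu]_x (w x * (\sum_(l <- s_ i) Q i s l x) + P i s x * dw (s i) x) = 0.
  apply: (int_deriv0 (j := s i) r0 wP); first exact: csuppM w_supp.
  by move=> x cx; rewrite w_supp// dw_supp// mul0r mulr0 addr0.
apply/eqP; rewrite -addr_eq0; apply/eqP.
rewrite -Rintegral_sum// -RintegralD//; last exact: integrable_real_sum.
rewrite -[RHS]h; apply: eq_Rintegral => x _.
by rewrite addrC mulr_sumr [P _ _ _ * _]mulrC.
Qed.

(** The Jacobian is a null Lagrangian.  Expand the determinant and integrate by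
    parts in each product; the resulting second derivatives of [F] cancel in
    pairs, because they are symmetric and the determinant alternates. *)
Lemma null_lagrangian i :
  \int[mu]_x \det (setrow i (fun j => dw j x) (fun k j => DF k j x)) = 0.
Proof.
under eq_Rintegral do rewrite det_setrow.
rewrite Rintegral_sum//; last first.
  move=> s; apply: integrable_realZ => //.
  by have [h _ _] := by_parts i s; under eq_fun do rewrite prodE.
under eq_bigr => s _.
  have [h1 h2 h3] := by_parts i s.
  under eq_Rintegral do rewrite prodE.
  rewrite RintegralZl// h3 mulrN mulr_sumr.
  over.
rewrite sumrN exchange_big/= big_seq big1 ?oppr0// => l.
rewrite mem_filter => /andP[li _].
apply: (@alternating_sum0 i l); first by rewrite eq_sym.
move=> s; apply: eq_Rintegral => x _; congr (_ * _); rewrite /Q.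
apply: eq_big_seq => k; rewrite mem_filter => /andP[ki _]; rewrite !permM tpermL.
case: eqP => [->|/eqP kl]; first by rewrite tpermR D2F_sym.
by rewrite tpermD// eq_sym.
Qed.

End null_lagrangian.

(** * Integrals along rays *)

Section path_inequality.
Context {R : realType}.
Local Notation leb := (@lebesgue_measure R).

(** The indicator of the unit interval, as a weight on the line: integrals along
    a path then become weighted integrals over the whole space, to which
    Jensen's inequality and Tonelli's theorem apply. *)
Definition unit_weight (s : R) : R := \1_(`]0, 1[%classic : set R) s.
Local Notation a := unit_weight.

Lemma unit_weight_ge0 s : 0 <= a s. Proof. by rewrite /a indicE. Qed.

Lemma measurable_unit_weight : measurable_fun setT a.
Proof. exact: measurable_indic. Qed.

Lemma unit_weight_int : (\int[leb]_s (a s)%:E = 1)%E.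
Proof.
rewrite /unit_weight integral_indic// setIT [LHS]lebesgue_measure_itv/= lte_fin ltr01.
by rewrite -EFinB subr0.
Qed.

Lemma unit_weight_integral (h : R -> \bar R) :
  (\int[leb]_s ((a s)%:E * h s) = \int[leb]_(s in `]0%R, 1%R[) h s)%E.
Proof.
rewrite [RHS]integral_mkcond; apply: eq_integral => s _; rewrite patchE /a indicE.
by case: ifP => _; rewrite ?mul1e ?mul0e.
Qed.

Lemma path_ineq (phi dphi : R -> R) : (forall s, is_derive s (1 : R) phi (dphi s)) ->
  continuous dphi -> (`|phi 1 - phi 0|%:E <= \int[leb]_s ((a s)%:E * `|dphi s|%:E))%E.
Proof.
move=> dp cd.
have cp : continuous phi.
  by move=> s; apply: differentiable_continuous; apply/derivable1_diffP; have [] := dp s.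
have := @continuous_FTC2 R dphi phi 0 1 ltr01 (continuous_subspaceT cd).
have h1 : derivable_oo_LRcontinuous phi 0 1.
  split; first by move=> s _; have [] := dp s.
  - exact: cvg_at_right_filter (cp 0).
  - exact: cvg_at_left_filter (cp 1).
have h2 : {in `]0, 1[, (phi^`())%classic =1 dphi}.
  by move=> s _; rewrite derive1E; have [_ ->] := dp s.
move=> /(_ h1 h2) h; rewrite -EFinB in h.
have md : measurable_fun setT dphi by exact: continuous_measurable_fun.
rewrite -[X in (X <= _)%E]/(`|(phi 1 - phi 0)%:E|%E) -h unit_weight_integral.
apply: le_trans (le_abse_integral _ _ _) _ => //.
  by apply/measurable_EFinP; exact: measurable_funTS.
rewrite integral_itv_bndoo//.
by apply: measurableT_comp => //; apply/measurable_EFinP; exact: measurable_funTS.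
Qed.

End path_inequality.

Section path_integrals.
Context {R : realType} {n : nat} (n0 : (0 < n)%N).
Local Notation E := 'cV[R]_n.
Local Notation mu := (@lebesgue_cV R n).
Local Notation leb := (@lebesgue_measure R).
Local Notation a := unit_weight.

Definition sumnorm (g : 'I_n -> E -> R) x : R := \sum_j `|g j x|.

Lemma sumnorm_ge0 g x : 0 <= sumnorm g x. Proof. exact: sumr_ge0. Qed.

Lemma continuous_sumnorm g : (forall j, continuous (g j)) -> continuous (sumnorm g).
Proof.
move=> cg; rewrite /sumnorm; elim: (index_enum _) => [|j s IH].
  by under eq_fun do rewrite big_nil; exact: cst_continuous.
under eq_fun do rewrite big_cons; apply: continuousDf => //.
exact: continuous_normf.
Qed.

Lemma sum_coord_norm_le (g : 'I_n -> E -> R) y (v : E) :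
  `|\sum_j g j y * v j ord0| <= sumnorm g y * `|v|.
Proof.
rewrite (le_trans (ler_norm_sum _ _ _))// mulr_suml ler_sum// => j _.
by rewrite normrM ler_wpM2l// norm_coord_le.
Qed.

(** The path [s |-> x + s ^+ m.+1 *: z] slows down at [x] for [m > 0]; this
    compensates the singularity at [s = 0] that appears when the inequality is
    averaged over [z] and the variable [s ^+ m.+1 *: z] is substituted. *)
Lemma path_pow_ineq u g (x z : E) m : C1grad u g ->
  (`|u (x + z)%R - u x|%:E <=
   \int[leb]_s ((a s)%:E * (m.+1%:R * `|z| * s ^+ m * sumnorm g (x + s ^+ m.+1 *: z)%R)%:E))%E.
Proof.
move=> ug; have [_ _ cg] := ug.
pose phi s := u (x + s ^+ m.+1 *: z).
pose dphi s := (\sum_j g j (x + s ^+ m.+1 *: z) * z j ord0) * (m.+1%:R * s ^+ m).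
have dp s : is_derive s (1 : R) phi (dphi s).
  have d1 := C1grad_along x z (s ^+ m.+1) ug.
  have d2 : is_derive s (1 : R) (fun s => s ^+ m.+1) (m.+1%:R * s ^+ m).
    have -> : (fun s : R => s ^+ m.+1) = id ^+ m.+1 by apply/funext => t; rewrite exprfctE.
    by apply: is_derive_eqr (is_deriveX m.+1 (is_derive_id s (1 : R))) _; rewrite /GRing.scale/= mulr1.
  exact: (@is_derive1_comp R (fun s => u (x + s *: z)) (fun s => s ^+ m.+1) s _ _ d1 d2).
have cpath : continuous (fun s : R => x + s ^+ m.+1 *: z).
  by move=> s; apply: cvgD; [exact: cvg_cst|apply: cvgZr_tmp; exact: exprn_continuous].
have cd : continuous dphi.
  rewrite /dphi; apply: continuousMf.
    elim: (index_enum _) => [|j t IH].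
      by under eq_fun do rewrite big_nil; exact: cst_continuous.
    under eq_fun do rewrite big_cons; apply: continuousDf => //.
    apply: continuousMf; last exact: cst_continuous.
    by move=> s; apply: continuous_comp; [exact: cpath|exact: cg].
  by apply: continuousMf; [exact: cst_continuous|exact: exprn_continuous].
have := path_ineq dp cd; rewrite /phi expr1n scale1r expr0n/= scale0r addr0.
move=> /le_trans; apply.
rewrite !unit_weight_integral; apply: ge0_le_integral => //.
- apply/measurable_EFinP; apply: measurable_funTS; apply: measurableT_comp => //.
  exact: continuous_measurable_fun.
- apply/measurable_EFinP; apply: measurable_funTS.
  apply: continuous_measurable_fun; apply: continuousMf.
    by apply: continuousMf; [exact: cst_continuous|exact: exprn_continuous].
  move=> s; apply: (@continuous_comp _ _ _ (fun s : R => x + s ^+ m.+1 *: z)); first exact: cpath.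
  exact: continuous_sumnorm.
move=> s; rewrite /= in_itv/= => /andP[s0 s1]; rewrite lee_fin /dphi normrM.
rewrite [`|m.+1%:R * _|]ger0_norm; last by rewrite mulr_ge0// exprn_ge0// ltW.
rewrite [leRHS](_ : _ = sumnorm g (x + s ^+ m.+1 *: z) * `|z| * (m.+1%:R * s ^+ m)); last by ring.
by apply: ler_wpM2r; [rewrite mulr_ge0// exprn_ge0// ltW|exact: sum_coord_norm_le].
Qed.

Lemma measurable_path m d (T : measurableType d) (p q : T -> E) (t : T -> R) :
  measurable_fun setT p -> measurable_fun setT q -> measurable_fun setT t ->
  measurable_fun setT (fun w => p w + t w ^+ m *: q w).
Proof.
move=> /measurable_fun_cVP mp /measurable_fun_cVP mq mt; apply/measurable_fun_cVP => i.
under eq_fun do rewrite !mxE; apply: measurable_funD; first exact: mp.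
by apply: measurable_funM; [exact: measurable_funX|exact: mq].
Qed.

End path_integrals.

Section weighted_tonelli.
Context d1 d2 (T1 : measurableType d1) (T2 : measurableType d2) (R : realType).
Variables (m1 : {sigma_finite_measure set T1 -> \bar R})
  (m2 : {sigma_finite_measure set T2 -> \bar R}).
Variables (a : T1 -> R) (b : T2 -> R) (H : T1 * T2 -> \bar R).
Hypotheses (ma : measurable_fun setT a) (mb : measurable_fun setT b)
  (mH : measurable_fun setT H).
Hypotheses (a0 : forall x, 0 <= a x) (b0 : forall y, 0 <= b y) (H0 : forall z, (0 <= H z)%E).

Lemma measurable_weighted_int :
  measurable_fun setT (fun x => \int[m2]_y ((b y)%:E * H (x, y)))%E.
Proof.
have mf : measurable_fun setT (fun xy : T1 * T2 => ((b xy.2)%:E * H xy)%E).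
  apply: emeasurable_funM => //; apply/measurable_EFinP.
  exact: (measurableT_comp mb measurable_snd).
have f0 (xy : T1 * T2) : (0 <= (b xy.2)%:E * H xy)%E by rewrite mule_ge0// lee_fin.
have := @measurable_fun_fubini_tonelli_F _ _ _ _ R m2 _ mf f0.
by apply: eq_measurable_fun => x _.
Qed.

Lemma measurable_weighted_int2 :
  measurable_fun setT (fun y => \int[m1]_x ((a x)%:E * H (x, y)))%E.
Proof.
have mf : measurable_fun setT (fun xy : T1 * T2 => ((a xy.1)%:E * H xy)%E).
  apply: emeasurable_funM => //; apply/measurable_EFinP.
  exact: (measurableT_comp ma measurable_fst).
have f0 (xy : T1 * T2) : (0 <= (a xy.1)%:E * H xy)%E by rewrite mule_ge0// lee_fin.
have := @measurable_fun_fubini_tonelli_G _ _ _ _ R m1 _ mf f0.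
by apply: eq_measurable_fun => x _.
Qed.

Lemma weighted_tonelli :
  (\int[m1]_x ((a x)%:E * \int[m2]_y ((b y)%:E * H (x, y))) =
   \int[m2]_y ((b y)%:E * \int[m1]_x ((a x)%:E * H (x, y))))%E.
Proof.
pose f (xy : T1 * T2) := ((a xy.1)%:E * ((b xy.2)%:E * H xy))%E.
have mf : measurable_fun setT f.
  apply: emeasurable_funM; last apply: emeasurable_funM => //; apply/measurable_EFinP.
  - exact: (measurableT_comp ma measurable_fst).
  - exact: (measurableT_comp mb measurable_snd).
have f0 xy : (0 <= f xy)%E by rewrite /f !mule_ge0// lee_fin.
have := @fubini_tonelli _ _ _ _ R m1 m2 f mf f0; rewrite /f/= => h.
transitivity (\int[m1]_x \int[m2]_y ((a x)%:E * ((b y)%:E * H (x, y))))%E.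
  apply: eq_integral => x _; rewrite ge0_integralZl//.
  - apply: emeasurable_funM; first exact/measurable_EFinP.
    exact: (measurableT_comp mH (measurable_pair1 x)).
  - by move=> y _; rewrite mule_ge0// lee_fin.
  - by rewrite lee_fin.
rewrite h; apply: eq_integral => y _.
rewrite -ge0_integralZl//.
- by apply: eq_integral => x _; rewrite muleCA.
- apply: emeasurable_funM; first exact/measurable_EFinP.
  exact: (measurableT_comp mH (measurable_pair2 y)).
- by move=> x _; rewrite mule_ge0// lee_fin.
- by rewrite lee_fin.
Qed.

End weighted_tonelli.

Lemma lee_expe {R : realType} (x y : \bar R) N : (0 <= x -> x <= y -> x ^+ N <= y ^+ N)%E.
Proof.
move=> x0 xy; elim: N => [|N IH]; first by rewrite !expe0.
by rewrite !expeS; apply: lee_pmul => //; exact: expe_ge0.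
Qed.

Section ray_inequality.
Context {R : realType} {n : nat}.
Local Notation E := 'cV[R]_n.
Local Notation mu := (@lebesgue_cV R n).
Local Notation leb := (@lebesgue_measure R).
Local Notation a := unit_weight.

Lemma ball_scale (x y : E) (s r : R) : 0 < s -> ball x (s * r) (x + s *: (y - x)) <-> ball x r y.
Proof.
move=> s0; split=> /ball_normP h; apply/ball_normP.
  move: h; have -> : x - (x + s *: (y - x)) = s *: (x - y).
    by apply/matrixP => i j; rewrite !mxE; ring.
  by rewrite normrZ gtr0_norm// ltr_pM2l.
have -> : x - (x + s *: (y - x)) = s *: (x - y).
  by apply/matrixP => i j; rewrite !mxE; ring.
by rewrite normrZ gtr0_norm// ltr_pM2l.
Qed.

(** A Poincare inequality centred at a point: apply the fundamental theorem of
    calculus on each segment from [x], then Jensen's inequality, and substitute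
    [x + s *: (y - x)] for [y].  The hypothesis on small cubes is what makes the
    integral over [s] converge. *)
Lemma ray_ineq u g (x : E) r N C : (0 < N)%N -> 0 < r -> C1grad u g ->
  (forall s, 0 < s <= r ->
    (\int[mu]_(y in ball x s) (sumnorm g y ^+ N)%:E <= (C * s ^+ n)%:E)%E) ->
  (\int[mu]_(y in ball x r) (`|u y - u x| ^+ N)%:E <= (r ^+ N * (C * r ^+ n))%:E)%E.
Proof.
move=> N0 r0 ug hC; have [_ cu cg] := ug.
pose b (y : E) : R := \1_(ball x r : set E) y.
have mB : measurable (ball x r : set E) by exact: measurable_ball_cV.
have mb : measurable_fun setT b by exact: measurable_indic.
have b0 y : 0 <= b y by rewrite /b indicE.
have csn := continuous_sumnorm cg.
have msn : measurable_fun setT (fun y => sumnorm g y) by exact: continuous_measurable_cV.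
pose H (ys : E * R) := ((r * sumnorm g (x + ys.2 ^+ 1 *: (ys.1 - x))) ^+ N)%:E.
have msub : measurable_fun setT (fun ys : E * R => ys.1 - x).
  exact: (measurableT_comp (measurable_translate (- x) (@measurable_id _ _ _)) measurable_fst).
have mH : measurable_fun setT H.
  apply/measurable_EFinP; apply: measurable_funX; apply: measurable_funM => //.
  by apply: (measurableT_comp msn); apply: measurable_path.
have H0 ys : (0 <= H ys)%E by rewrite lee_fin exprn_ge0// mulr_ge0 ?sumnorm_ge0// ltW.
have ma := @measurable_unit_weight R.
have a0 := @unit_weight_ge0 R.
have mu_ : measurable_fun setT (fun y => (`|u y - u x| ^+ N)%:E).
  apply/measurable_EFinP; apply: measurable_funX; apply: measurableT_comp => //.
  by apply: measurable_funB => //; exact: continuous_measurable_cV.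
have mI := measurable_weighted_int leb ma mH a0 H0.
have I0 y : (0 <= \int[leb]_s ((a s)%:E * H (y, s)))%E.
  by apply: integral_ge0 => s _; rewrite mule_ge0// lee_fin.
apply: (@le_trans _ _ (\int[mu]_y ((b y)%:E * \int[leb]_s ((a s)%:E * H (y, s))))%E).
  rewrite integral_mkcond; apply: ge0_le_integral => //.
  - by move=> y _; rewrite patchE; case: ifP => // _; rewrite lee_fin exprn_ge0.
  - by apply/(measurable_restrictT _ mB); exact: measurable_funTS.
  - by apply: emeasurable_funM => //; exact/measurable_EFinP.
  move=> y _; rewrite patchE /b indicE; case: ifPn => [/set_mem/ball_normP yB|_]; last first.
    by rewrite mul0e.
  rewrite mul1e.
  have := path_pow_ineq x (y - x) 0 ug; rewrite [x + (y - x)]addrC subrK => h.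
  have mp : measurable_fun setT (fun s : R => sumnorm g (x + s ^+ 1 *: (y - x))).
    by apply: (measurableT_comp msn); exact: measurable_path.
  have h0 s : (0 <= (r * sumnorm g (x + s ^+ 1 *: (y - x)))%:E)%E.
    by rewrite lee_fin mulr_ge0 ?sumnorm_ge0// ltW.
  have mh : measurable_fun setT (fun s : R => (r * sumnorm g (x + s ^+ 1 *: (y - x)))%:E).
    by apply/measurable_EFinP; exact: measurable_funM.
  have := @jensen_pow _ _ R leb setT a _ N N0 measurableT ma (fun s _ => a0 s) mh
    (fun s _ => h0 s) unit_weight_int.
  under [X in (_ <= X)%E -> _]eq_integral do rewrite -EFin_expe.
  apply: le_trans; rewrite EFin_expe; apply: lee_expe; first by rewrite lee_fin.
  apply: le_trans h _; apply: ge0_le_integral => //.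
  - move=> s _; rewrite mule_ge0 ?lee_fin// mulr_ge0 ?sumnorm_ge0//.
    by rewrite mulr_ge0// expr0.
  - apply: emeasurable_funM; first exact/measurable_EFinP.
    by apply/measurable_EFinP; apply: measurable_funM => //; apply: measurable_funM.
  - by apply: emeasurable_funM => //; exact/measurable_EFinP.
  move=> s _; apply: lee_wpmul2l; rewrite lee_fin//.
  rewrite ler_wpM2r ?sumnorm_ge0// mul1r expr0 mulr1 distrC ltW//.
rewrite (@weighted_tonelli _ _ _ _ R mu leb b a H)//.
have K0 : 0 <= r ^+ N * (C * r ^+ n).
  rewrite mulr_ge0 ?exprn_ge0 ?(ltW r0)// -lee_fin.
  have rr : 0 < r <= r by rewrite r0 lexx.
  apply: le_trans (hC r rr); apply: integral_ge0 => y _.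
  by rewrite lee_fin exprn_ge0// sumnorm_ge0.
have -> : ((r ^+ N * (C * r ^+ n))%:E = \int[leb]_s ((a s)%:E * (r ^+ N * (C * r ^+ n))%:E))%E.
  by rewrite ge0_integralZr ?unit_weight_int ?mul1e// => [|s _]; [exact/measurable_EFinP|rewrite lee_fin].
have mJ : measurable_fun setT (fun s => \int[mu]_y ((b y)%:E * H (y, s)))%E.
  exact: (measurable_weighted_int2 mu mb mH b0 H0).
rewrite !unit_weight_integral; apply: ge0_le_integral => //.
- by move=> s _; apply: integral_ge0 => y _; rewrite mule_ge0// lee_fin.
- exact: measurable_funTS.
move=> s; rewrite /= in_itv/= => /andP[s0 s1].
have sr : 0 < s * r <= r by rewrite mulr_gt0//= ler_piMl// ltW.
have := hC (s * r) sr.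
rewrite -(integral_affine (x - s *: x) s0 (measurable_ball_cV x (s * r))); last 2 first.
- by apply/measurable_EFinP; apply: measurable_funTS; exact: measurable_funX.
- by move=> y _; rewrite lee_fin exprn_ge0// sumnorm_ge0.
have eqp y : x - s *: x + s *: y = x + s *: (y - x).
  by apply/matrixP => i k; rewrite !mxE; ring.
rewrite [X in integral _ X _](_ : _ = ball x r); last first.
  by apply/seteqP; split => y; rewrite /preimage/= eqp; move/(ball_scale x y r s0).
rewrite exprMn mulrCA EFinM lee_pmul2l//; last by rewrite lte_fin exprn_gt0.
move=> hI.
rewrite (_ : integral _ _ _ = (r ^+ N)%:E * \int[mu]_(y in ball x r) ((sumnorm g (x - s *: x + s *: y)) ^+ N)%:E)%E.
  by rewrite EFinM lee_wpmul2l// lee_fin exprn_ge0// ltW.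
rewrite -ge0_integralZl//; last 3 first.
- apply/measurable_EFinP; apply: measurable_funTS; apply: measurable_funX.
  exact: (measurableT_comp msn (measurable_affine _ _)).
- by move=> y _; rewrite lee_fin exprn_ge0// sumnorm_ge0.
- by rewrite lee_fin exprn_ge0// ltW.
rewrite [RHS]integral_mkcond; apply: eq_integral => y _; rewrite patchE /b indicE /H.
case: ifP => _; rewrite ?mul0e// mul1e -EFinM -exprMn eqp.
by rewrite expr1.
Qed.

End ray_inequality.

(** * A Sobolev inequality on cubes *)

Lemma expeMn {R : realType} (x y : \bar R) N : ((x * y) ^+ N = x ^+ N * y ^+ N)%E.
Proof. by elim: N => [|N IH]; rewrite ?expe0 ?mule1// !expeS IH muleACA. Qed.

Lemma expeD' {R : realType} (x : \bar R) N M : (x ^+ (N + M) = x ^+ N * x ^+ M)%E.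
Proof. by elim: N => [|N IH]; rewrite ?expe0 ?mul1e// addSn !expeS IH muleA. Qed.

Section sobolev_inequality.
Context {R : realType} {n : nat} (n0 : (0 < n)%N).
Local Notation E := 'cV[R]_n.
Local Notation mu := (@lebesgue_cV R n).
Local Notation leb := (@lebesgue_measure R).
Local Notation a := unit_weight.
Variables (V : E -> R) (g : 'I_n -> E -> R) (x0 : E) (r : R).
Hypothesis r0 : 0 < r.
Hypothesis Vg : C1grad V g.
Hypothesis suppV : csupp x0 r V.

Let z0 : E := const_mx (5 / 2 * r).
Let B : set E := ball z0 (r / 2).
Let q (z : E) : R := r ^- n * \1_B z.

Let mB : measurable B. Proof. exact: measurable_ball_cV. Qed.

Let q0 z : 0 <= q z.
Proof. by rewrite mulr_ge0// ?indicE// invr_ge0 exprn_ge0// ltW. Qed.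

Let mq : measurable_fun setT q.
Proof. by apply: measurable_funM => //; exact: measurable_indic. Qed.

Let rn0 : 0 <= r ^- n. Proof. by rewrite invr_ge0 exprn_ge0// ltW. Qed.

Let q_int : (\int[mu]_z (q z)%:E = 1)%E.
Proof.
under eq_integral do rewrite EFinM.
rewrite ge0_integralZl//; last by apply/measurable_EFinP; exact: measurable_indic.
rewrite integral_indic// setIT [X in (_ * X)%E]lebesgue_cV_ball ?divr_gt0//.
by rewrite mulrC divfK// -EFinM mulVf// expf_neq0// gt_eqF.
Qed.

Let q_avg (c : \bar R) : (0 <= c -> \int[mu]_z ((q z)%:E * c) = c)%E.
Proof.
move=> c0; rewrite ge0_integralZr//; first by rewrite q_int mul1e.
  exact/measurable_EFinP.
by move=> z _; rewrite lee_fin.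
Qed.

Let B_coord z i : B z -> 2 * r < z i ord0 < 3 * r.
Proof.
move=> /(ballcVP _ _ _)h; have r2 : 0 < r / 2 by rewrite divr_gt0.
by have := h r2 i; rewrite mxE ltr_norml => /andP[h1 h2]; apply/andP; split; lra.
Qed.

Let B_norm z : B z -> `|z| <= 3 * r.
Proof.
move=> Bz; apply: norm_cV_le => [|i]; first by rewrite mulr_ge0// ltW.
by have /andP[h1 h2] := B_coord i Bz; rewrite ger0_norm; lra.
Qed.

(* Displacements in [B] carry the cube out of the support of [V], so that
   [- V x] is an increment of [V] along the path. *)
Let V_shift x z : `|x0 - x| < r -> B z -> V (x + z) = 0.
Proof.
move=> xr Bz; apply: suppV; pose i := Ordinal n0.
apply: le_trans (norm_coord_le _ i).
have := le_lt_trans (norm_coord_le _ i) xr; rewrite !mxE.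
have /andP[h1 h2] := B_coord i Bz.
rewrite ltr_norml => /andP[h3 h4]; rewrite distrC; apply: le_trans (ler_norm _); lra.
Qed.

Let sn := sumnorm g.
Let msn : measurable_fun setT sn.
Proof. by apply: continuous_measurable_cV; apply: continuous_sumnorm; case: Vg. Qed.
Let sn0 y : 0 <= sn y. Proof. exact: sumnorm_ge0. Qed.

Let J (x : E) (s : R) : \bar R := (\int[mu]_z ((q z)%:E * (sn (x + s ^+ 3 *: z))%:E))%E.
Let K (x : E) (s : R) : \bar R := (\int[mu]_z ((q z)%:E * (sn (x + s ^+ 3 *: z) ^+ n)%:E))%E.
Let I : \bar R := (\int[mu]_y (sn y ^+ n)%:E)%E.

Let J0 x s : (0 <= J x s)%E.
Proof. by apply: integral_ge0 => z _; rewrite -EFinM lee_fin mulr_ge0. Qed.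
Let K0 x s : (0 <= K x s)%E.
Proof. by apply: integral_ge0 => z _; rewrite -EFinM lee_fin mulr_ge0// exprn_ge0. Qed.
Let I0 : (0 <= I)%E.
Proof. by apply: integral_ge0 => z _; rewrite lee_fin exprn_ge0. Qed.

Let msnz x s : measurable_fun setT (fun z : E => sn (x + s ^+ 3 *: z)).
Proof. exact: (measurableT_comp msn (measurable_affine _ _)). Qed.

Let JK x s : (J x s ^+ n <= K x s)%E.
Proof.
have mh : measurable_fun setT (fun z : E => (sn (x + s ^+ 3 *: z))%:E) by exact/measurable_EFinP.
have h0 z : (0 <= (sn (x + s ^+ 3 *: z))%:E)%E by rewrite lee_fin.
have := @jensen_pow _ _ R mu setT q _ n n0 measurableT mq (fun z _ => q0 z) mh
  (fun z _ => h0 z) q_int.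
by under [X in (_ <= X)%E -> _]eq_integral do rewrite -EFin_expe.
Qed.

(* Substitution of [x + s ^+ 3 *: z] for [z]. *)
Let KI x s : 0 < s -> ((s ^+ (3 * n))%:E * K x s <= (r ^- n)%:E * I)%E.
Proof.
move=> s0; have s3 : 0 < s ^+ 3 by rewrite exprn_gt0.
have mh : measurable_fun setT (fun y => (sn y ^+ n)%:E).
  by apply/measurable_EFinP; exact: measurable_funX.
have h := @integral_affine R n x _ setT _ s3 measurableT mh (fun y _ => _).
rewrite preimage_setT in h.
rewrite /I -h; last by move=> y; rewrite lee_fin exprn_ge0.
rewrite exprM muleCA; apply: lee_wpmul2l; first by rewrite lee_fin exprn_ge0// ltW.
rewrite -ge0_integralZl//; last 2 first.
- by apply/measurable_EFinP; exact: measurable_funX.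
- by move=> z _; rewrite lee_fin exprn_ge0.
apply: ge0_le_integral => //.
- by move=> z _; rewrite -EFinM lee_fin mulr_ge0// exprn_ge0.
- by apply/measurable_EFinP; apply: measurable_funM => //; exact: measurable_funX.
- by apply/measurable_EFinP; apply: measurable_funM => //; exact: measurable_funX.
move=> z _; rewrite -!EFinM lee_fin ler_wpM2r ?exprn_ge0// /q indicE.
by case: (_ \in _); rewrite ?mulr1 ?mulr0.
Qed.

Let P (x : E) s : \bar R := ((9 * r * s ^+ 2)%:E * J x s)%E.

Let c2_ge0 (s : R) : 0 <= 9 * r * s ^+ 2.
Proof. by rewrite mulr_ge0 ?sqr_ge0// mulr_ge0// ltW. Qed.

(* Two of the three factors [J x s ^+ n] are estimated by [JK] and [KI], at the cost of
   [s ^- (6 * n)]; the weight [s ^+ 2] of the path pays for it exactly. *)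
Let P_pow x s : 0 < s ->
  (P x s ^+ (3 * n) <= (((9 * r) ^+ (3 * n))%:E * ((r ^- n)%:E * I) ^+ 2) * K x s)%E.
Proof.
move=> s0; have c0 : 0 <= (9 * r) ^+ (3 * n) by rewrite exprn_ge0// mulr_ge0// ltW.
rewrite /P expeMn -EFin_expe exprMn EFinM; set A := ((r ^- n)%:E * I)%E.
have A0 : (0 <= A)%E by rewrite mule_ge0// lee_fin.
rewrite -[leLHS]muleA -[leRHS]muleA; apply: lee_wpmul2l; first by rewrite lee_fin.
have -> : (s ^+ 2) ^+ (3 * n) = s ^+ (3 * n) * s ^+ (3 * n) by rewrite -exprM mulnC exprM expr2.
have -> : (J x s ^+ (3 * n) = (J x s ^+ n) * ((J x s ^+ n) * (J x s ^+ n)))%E.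
  by rewrite -!expeD'; congr (_ ^+ _)%E; rewrite !mulSn mul0n addn0.
have Jn0 : (0 <= J x s ^+ n)%E by exact: expe_ge0.
have S0 : (0%:E <= (s ^+ (3 * n))%:E)%E by rewrite lee_fin exprn_ge0// ltW.
rewrite EFinM.
have h : ((s ^+ (3 * n))%:E * J x s ^+ n <= A)%E.
  by apply: le_trans (KI x s0); apply: lee_wpmul2l.
have -> : (A ^+ 2 = A * A)%E by [].
rewrite [leLHS](_ : _ = (((s ^+ (3 * n))%:E * J x s ^+ n) * ((s ^+ (3 * n))%:E * J x s ^+ n)) * J x s ^+ n)%E.
  apply: lee_pmul => //; first by rewrite mule_ge0// mule_ge0.
  by apply: lee_pmul => //; rewrite mule_ge0.
by rewrite [X in _ = (X * _)%E]muleACA -[RHS]muleA -[X in _ = (_ * X)%E]muleA.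
Qed.

Let mpath3 : measurable_fun setT (fun w : (E * R) * E => (sn (w.1.1 + w.1.2 ^+ 3 *: w.2))).
Proof.
apply: (measurableT_comp msn); apply: measurable_path.
- exact: (measurableT_comp measurable_fst measurable_fst).
- exact: measurable_snd.
- exact: (measurableT_comp measurable_snd measurable_fst).
Qed.

Let mK : measurable_fun setT (fun w : E * R => K w.1 w.2).
Proof.
have mH : measurable_fun setT (fun w : (E * R) * E => (sn (w.1.1 + w.1.2 ^+ 3 *: w.2) ^+ n)%:E).
  by apply/measurable_EFinP; apply: measurable_funX; exact: mpath3.
have H0 (w : (E * R) * E) : (0 <= (sn (w.1.1 + w.1.2 ^+ 3 *: w.2) ^+ n)%:E)%E.
  by rewrite lee_fin exprn_ge0.
exact: (measurable_weighted_int mu mq mH q0 H0).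
Qed.

Let mJ x : measurable_fun setT (J x).
Proof.
have mH : measurable_fun setT (fun w : R * E => (sn (x + w.1 ^+ 3 *: w.2))%:E).
  by apply/measurable_EFinP; apply: (measurableT_comp msn); apply: measurable_path.
have H0 (w : R * E) : (0 <= (sn (x + w.1 ^+ 3 *: w.2))%:E)%E by rewrite lee_fin.
exact: (measurable_weighted_int mu mq mH q0 H0).
Qed.

Let ma := @measurable_unit_weight R.
Let a0 := @unit_weight_ge0 R.

Let mP x : measurable_fun setT (P x).
Proof.
apply: emeasurable_funM; last exact: mJ.
by apply/measurable_EFinP; apply: measurable_funM => //; exact: measurable_funX.
Qed.

Let P0 x s : 0 <= s -> (0 <= P x s)%E.
Proof. by move=> s0; rewrite mule_ge0// lee_fin; exact: c2_ge0. Qed.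

Let V_le x : (`|V x|%:E <= \int[leb]_s ((a s)%:E * P x s))%E.
Proof.
have [xr|xr] := ltP `|x0 - x| r; last first.
  rewrite suppV// normr0; rewrite unit_weight_integral; apply: integral_ge0 => s.
  by rewrite /= in_itv/= => /andP[s0 _]; apply: P0; exact: ltW.
pose F (w : E * R) := (9 * r * w.2 ^+ 2 * sn (x + w.2 ^+ 3 *: w.1))%:E.
have mF : measurable_fun setT F.
  apply/measurable_EFinP; apply: measurable_funM.
    by apply: measurable_funM => //; exact: measurable_funX.
  by apply: (measurableT_comp msn); exact: measurable_path.
have F0 w : (0 <= F w)%E.
  by rewrite /F lee_fin mulr_ge0 ?sn0//; exact: c2_ge0.
have h z : ((q z)%:E * `|V x|%:E <= (q z)%:E * \int[leb]_s ((a s)%:E * F (z, s)))%E.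
  rewrite /q indicE; have [/set_mem Bz|_] := boolP (_ \in _); last by rewrite mulr0 !mul0e.
  apply: lee_wpmul2l; first by rewrite lee_fin mulr1.
  have := path_pow_ineq x z 2 Vg; rewrite (V_shift xr Bz) sub0r normrN => /le_trans; apply.
  rewrite !unit_weight_integral; apply: ge0_le_integral => //.
  - by move=> s _; rewrite lee_fin mulr_ge0 ?sn0// mulr_ge0 ?sqr_ge0// mulr_ge0.
  - apply/measurable_EFinP; apply: measurable_funTS; apply: measurable_funM.
      by apply: measurable_funM => //; exact: measurable_funX.
    by apply: (measurableT_comp msn); exact: measurable_path.
  - by apply: measurable_funTS; exact: (measurableT_comp mF (measurable_pair1 z)).
  move=> s _; rewrite lee_fin ler_wpM2r ?sn0//= ler_wpM2r ?sqr_ge0//.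
  by have := B_norm Bz; lra.
rewrite [leRHS](_ : _ = \int[leb]_s ((a s)%:E * \int[mu]_z ((q z)%:E * F (z, s))))%E; last first.
  apply: eq_integral => s _; congr (_ * _)%E; rewrite /P /J -ge0_integralZl//.
  - by apply: eq_integral => z _; rewrite /F/= EFinM muleCA.
  - by apply/measurable_EFinP; exact: measurable_funM.
  - by move=> z _; rewrite -EFinM lee_fin mulr_ge0.
  - by rewrite lee_fin; exact: c2_ge0.
rewrite -(weighted_tonelli mu leb mq ma mF q0 a0 F0).
rewrite -[leLHS]q_avg ?lee_fin//; apply: ge0_le_integral => //.
- by move=> z _; rewrite -EFinM lee_fin mulr_ge0.
- by apply/measurable_EFinP; exact: measurable_funM.
- apply: emeasurable_funM; first exact/measurable_EFinP.
  exact: (measurable_weighted_int leb ma mF a0 F0).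
Qed.

Let C : \bar R := (((9 * r) ^+ (3 * n))%:E * ((r ^- n)%:E * I) ^+ 2)%E.

Let C0 : (0 <= C)%E.
Proof.
rewrite mule_ge0 ?lee_fin ?exprn_ge0// ?mulr_ge0// ?(ltW r0)//.
by rewrite expe_ge0// mule_ge0// lee_fin.
Qed.

Let V_pow_le x : ((`|V x| ^+ (3 * n))%:E <= \int[leb]_s ((a s)%:E * (C * K x s)))%E.
Proof.
have n3 : (0 < 3 * n)%N by rewrite muln_gt0.
rewrite EFin_expe; apply: le_trans (lee_expe (3 * n) _ (V_le x)) _; first by rewrite lee_fin.
pose P' s := (((a s))%:E * P x s)%E.
have mP' : measurable_fun setT P'.
  by apply: emeasurable_funM; [apply/measurable_EFinP; exact: ma|exact: mP].
have P'0 s : (0 <= P' s)%E.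
  rewrite /P' /a/= indicE; case: (boolP (_ \in _)) => [|_]; last by rewrite mul0e.
  by rewrite inE/= in_itv/= mul1e => /andP[s0 _]; apply: P0; exact: ltW.
have aP s : ((a s)%:E * P' s = (a s)%:E * P x s)%E.
  by rewrite /P' muleA -EFinM /a indicE; case: (_ \in _); rewrite ?mulr1 ?mulr0.
have := @jensen_pow _ _ R leb setT a P' _ n3 measurableT ma (fun s _ => a0 s) mP'
    (fun s _ => P'0 s) unit_weight_int.
under [X in (X ^+ _ <= _)%E -> _]eq_integral do rewrite aP.
move=> /le_trans; apply; rewrite !unit_weight_integral; apply: ge0_le_integral => //.
- by move=> s _; exact: expe_ge0.
- by apply: measurable_funTS; exact: measurable_fun_expe.
- apply: measurable_funTS; apply: emeasurable_funM => //.
  exact: (measurableT_comp mK (measurable_pair1 x)).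
- move=> s; rewrite /= in_itv/= => /andP[s0 s1]; apply: le_trans (P_pow x s0).
  by rewrite /P' /a indicE mem_set ?mul1e//= in_itv/= s0.
Qed.

Let m1 : measurable_fun setT ((fun=> 1) : E -> R).
Proof. exact: measurable_cst. Qed.

(* Integrating over [x] first removes the displacement. *)
Let K_int s : (\int[mu]_x K x s = I)%E.
Proof.
have mH : measurable_fun setT (fun w : E * E => (sn (w.1 + s ^+ 3 *: w.2) ^+ n)%:E).
  apply/measurable_EFinP; apply: measurable_funX; apply: (measurableT_comp msn).
  apply: (measurable_path 3 (t := fun=> s)) => //.
have H0 (w : E * E) : (0 <= (sn (w.1 + s ^+ 3 *: w.2) ^+ n)%:E)%E by rewrite lee_fin exprn_ge0.
have := @weighted_tonelli _ _ _ _ R mu mu (fun=> 1) q _ m1 mq mH (fun=> ler01) q0 H0.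
rewrite /=; under eq_integral do rewrite mul1e; move=> ->.
rewrite -[RHS]q_avg//; apply: eq_integral => z _; congr (_ * _)%E; under eq_integral do rewrite mul1e.
apply: (integral_translate (s ^+ 3 *: z) (h := fun y => (sn y ^+ n)%:E)).
  by apply/measurable_EFinP; exact: measurable_funX.
by move=> y; rewrite lee_fin exprn_ge0.
Qed.

(** A Sobolev inequality with gain of integrability: the [3 * n]-th power of [V]
    is controlled by the [n]-th power of its gradient.  Write [- V x] as the
    integral of the derivative along the paths [s |-> x + s ^+ 3 *: z], average
    over displacements [z] in [B], and apply Jensen's inequality.  Any exponent
    above [n] would do for the iteration; an odd integer multiple keeps all
    powers natural and preserves the parity needed below. *)
Lemma sobolev_ineq :
  (\int[mu]_x (`|V x| ^+ (3 * n))%:E <=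
    ((9 * r) ^+ (3 * n))%:E * ((r ^- n)%:E * \int[mu]_y (sumnorm g y ^+ n)%:E) ^+ 2 *
    \int[mu]_y (sumnorm g y ^+ n)%:E)%E.
Proof.
rewrite -/sn -/I -/C.
have mCK : measurable_fun setT (fun w : E * R => C * K w.1 w.2)%E.
  by apply: emeasurable_funM => //; exact: mK.
have CK0 (w : E * R) : (0 <= C * K w.1 w.2)%E by rewrite mule_ge0.
apply: (@le_trans _ _ (\int[mu]_x (1%:E * \int[leb]_s ((a s)%:E * (C * K x s))))%E).
  apply: ge0_le_integral => //.
  - apply/measurable_EFinP; apply: measurable_funX; apply: measurableT_comp => //.
    by apply: continuous_measurable_cV; case: Vg.
  - apply: emeasurable_funM => //; exact: (measurable_weighted_int leb ma mCK a0 CK0).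
  - by move=> x _; rewrite mul1e.
rewrite (@weighted_tonelli _ _ _ _ R mu leb (fun=> 1) a _ m1 ma mCK (fun=> ler01) a0 CK0)/=.
rewrite le_eqVlt; apply/orP; left; apply/eqP.
have -> : (C * I = \int[leb]_s ((a s)%:E * (C * I)))%E.
  rewrite ge0_integralZr//; first by rewrite unit_weight_int mul1e.
  - exact/measurable_EFinP.
  - by move=> s _; rewrite lee_fin.
  - by rewrite mule_ge0.
apply: eq_integral => s _; congr (_ * _)%E; under eq_integral do rewrite mul1e.
rewrite ge0_integralZl//; last exact: (measurableT_comp mK (measurable_pair2 s)).
by rewrite K_int.
Qed.

End sobolev_inequality.

(** * Determinants, matrix norms and numerical inequalities *)

Section algebra.
Context {R : realType} {n : nat}.
Local Notation E := 'cV[R]_n.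

Definition mxsum (A : 'I_n -> 'I_n -> R) : R := \sum_i \sum_j `|A i j|.

Lemma mxsum_ge0 A : 0 <= mxsum A.
Proof. by apply: sumr_ge0 => i _; exact: sumr_ge0. Qed.

Lemma mxsum_entry A i j : `|A i j| <= mxsum A.
Proof.
rewrite /mxsum (bigD1 i)//= (bigD1 j)//= -addrA lerDl addr_ge0// ?sumr_ge0//.
by move=> k _; exact: sumr_ge0.
Qed.

Lemma mxsum_row A i : \sum_j `|A i j| <= mxsum A.
Proof. by rewrite /mxsum [leRHS](bigD1 i)//= lerDl; apply: sumr_ge0 => l _; exact: sumr_ge0. Qed.

(** Each product in the expansion takes one factor from row [i] and [n.-1] others. *)
Lemma det_setrow_le i v A : (0 < n)%N ->
  `|\det (setrow i v A)| <= n`!%:R * ((\sum_j `|v j|) * mxsum A ^+ n.-1).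
Proof.
move=> n0; rewrite det_setrow (le_trans (ler_norm_sum _ _ _))//.
rewrite mulr_natl -[X in _ *+ X]card_Sn -sumr_const ler_sum// => s _.
rewrite normrM normrX normrN1 expr1n mul1r normrM; apply: ler_pM => //.
  by rewrite (bigD1 (s i))//= lerDl sumr_ge0.
rewrite normr_prod.
have -> : n.-1 = #|[pred k | k != i]|.
  by rewrite -[in LHS](card_ord n) (cardD1 i)/=; apply: eq_card => k; rewrite !inE andbT.
rewrite -prodr_const; apply: ler_prod => k _; rewrite normr_ge0/=; exact: mxsum_entry.
Qed.

Lemma setrow_id i (A : 'I_n -> 'I_n -> R) : setrow i (A i) A = \matrix_(k, j) A k j.
Proof. by apply/matrixP => k j; rewrite !mxE; case: eqP => [->|]. Qed.

Lemma det_setrow_lin (i : 'I_n) (a b : R) v w A :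
  \det (setrow i (fun j => a * v j + b * w j) A) =
  a * \det (setrow i v A) + b * \det (setrow i w A).
Proof.
rewrite !det_setrow !mulr_sumr -big_split/=; apply: eq_bigr => s _.
set p := \prod_(k | _) _; move: ((-1) ^+ s) p (v _) (w _) => c p x y; ring.
Qed.

Lemma measurable_det_setrow (i : 'I_n) (v : 'I_n -> E -> R) (A : 'I_n -> 'I_n -> E -> R) :
  (forall j, measurable_fun setT (v j)) -> (forall l j, measurable_fun setT (A l j)) ->
  measurable_fun setT (fun x => \det (setrow i (fun j => v j x) (fun l j => A l j x))).
Proof.
move=> mv mA; under eq_fun do rewrite det_setrow.
apply: measurable_sum => s; apply: measurable_funM => //; apply: measurable_funM => //.
by under eq_fun do rewrite -big_filter; apply: measurable_prod.
Qed.

Lemma cvg_bigsum (I : Type) (s : seq I) (f : I -> nat -> R) (l : I -> R) :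
  (forall i, f i k @[k --> \oo] --> l i) -> (\sum_(i <- s) f i k) @[k --> \oo] --> \sum_(i <- s) l i.
Proof.
move=> fl; elim: s => [|i s IH].
  by rewrite big_nil; under eq_fun do rewrite big_nil; exact: cvg_cst.
by rewrite big_cons; under eq_fun do rewrite big_cons; exact: cvgD.
Qed.

Lemma cvg_bigprod (I : Type) (s : seq I) (P : pred I) (f : I -> nat -> R) (l : I -> R) :
  (forall i, f i k @[k --> \oo] --> l i) ->
  (\prod_(i <- s | P i) f i k) @[k --> \oo] --> \prod_(i <- s | P i) l i.
Proof.
move=> fl; elim: s => [|i s IH].
  by rewrite big_nil; under eq_fun do rewrite big_nil; exact: cvg_cst.
rewrite big_cons; under eq_fun do rewrite big_cons.
by case: (P i) => //; exact: cvgM.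
Qed.

Lemma cvg_det_setrow (i : 'I_n) (v : nat -> 'I_n -> R) (A : nat -> 'I_n -> 'I_n -> R) v0 A0 :
  (forall j, v k j @[k --> \oo] --> v0 j) -> (forall l j, A k l j @[k --> \oo] --> A0 l j) ->
  \det (setrow i (v k) (A k)) @[k --> \oo] --> \det (setrow i v0 A0).
Proof.
move=> cv cA; rewrite det_setrow; under eq_fun do rewrite det_setrow.
apply: cvg_bigsum => s; apply: cvgM; first exact: cvg_cst.
by apply: cvgM; [exact: cv|apply: cvg_bigprod => l; exact: cA].
Qed.

(** Young's inequality by cases: either the left-hand side is at most
    [a ^+ n / 2], or [a < 2 * T * e]. *)
Lemma young_pow (a e T : R) : (0 < n)%N -> 0 <= a -> 0 <= e -> 0 <= T ->
  T * (a ^+ n.-1 * e) <= a ^+ n / 2 + (2 * T * e) ^+ n.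
Proof.
move=> n0 a0 e0 T0; have -> : a ^+ n = a ^+ n.-1 * a by rewrite -exprSr prednK.
have an0 : 0 <= a ^+ n.-1 by rewrite exprn_ge0.
have Te0 : 0 <= 2 * T * e by rewrite !mulr_ge0.
have [h|h] := leP (2 * T * e) a.
  have : a ^+ n.-1 * (2 * T * e) <= a ^+ n.-1 * a by rewrite ler_wpM2l.
  by have := exprn_ge0 n Te0; lra.
have : a ^+ n.-1 * (2 * T * e) <= (2 * T * e) ^+ n.-1 * (2 * T * e).
  by rewrite ler_wpM2r// lerXn2r ?nnegrE// ltW.
rewrite -exprSr prednK// => h2; have : 0 <= a ^+ n.-1 * a by rewrite mulr_ge0.
have := exprn_ge0 n Te0; lra.
Qed.

Lemma coord_enorm (x : E) i : `|x i ord0| <= enorm x.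
Proof.
rewrite /enorm -sqrtr_sqr ler_sqrt ?sqr_ge0//; last by apply: sumr_ge0 => k _; exact: sqr_ge0.
by rewrite (bigD1 i)//= lerDl sumr_ge0// => k _; exact: sqr_ge0.
Qed.

Lemma enorm_le (x : E) : enorm x <= \sum_i `|x i ord0|.
Proof.
rewrite /enorm -[leRHS]ger0_norm ?sumr_ge0// -sqrtr_sqr ler_sqrt ?sqr_ge0//.
elim: (index_enum _) => [|i s IH]; first by rewrite !big_nil expr0n.
rewrite !big_cons; have : 0 <= \sum_(j <- s) `|x j ord0| by apply: sumr_ge0.
by have := normr_ge0 (x i ord0); rewrite -(sqnormr (x i ord0)); nra.
Qed.

Lemma opnorm_entry (A : 'M[R]_n) i j : `|A i j| <= opnorm A.
Proof.
have enu : enorm (unit_cV j : E) = 1.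
  rewrite /enorm (bigD1 j)//= !mxE !eqxx big1 ?addr0 ?expr1n ?sqrtr1// => k kj.
  by rewrite !mxE (negbTE kj) expr0n.
have hs : has_ubound [set enorm (A *m xi) | xi in [set xi : E | enorm xi = 1]].
  exists (mxsum (fun i j => A i j)) => _ [xi /= xi1 <-].
  apply: le_trans (enorm_le _) _; apply: ler_sum => k _; rewrite mxE.
  apply: le_trans (ler_norm_sum _ _ _) _; apply: ler_sum => l _.
  by rewrite normrM ler_piMr// -xi1 coord_enorm.
apply: (@le_trans _ _ (enorm (A *m unit_cV j))); last first.
  by apply: (ub_le_sup hs); exists (unit_cV j).
apply: le_trans (coord_enorm _ i); rewrite mxE (bigD1 j)//= !mxE !eqxx mulr1 big1 ?addr0// => k kj.
by rewrite !mxE (negbTE kj) mulr0.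
Qed.

Lemma mxsum_opnorm (A : 'M[R]_n) : mxsum (fun i j => A i j) <= (n * n)%:R * opnorm A.
Proof.
rewrite natrM -mulrA mulr_natl -[X in _ *+ X]card_ord -sumr_const; apply: ler_sum => i _.
rewrite mulr_natl -[X in _ *+ X]card_ord -sumr_const; apply: ler_sum => j _; exact: opnorm_entry.
Qed.

(** The quantities [A ^+ 2 * D ^+ (2 * k + 3) * J k] satisfy the recursion
    without constants; hence the exponents in the proof. *)
Lemma moser_iteration (A D : R) (J : nat -> R) : 1 <= A -> 1 <= D -> (forall k, 0 <= J k) ->
  (forall k, J k.+1 <= (A * D ^+ k * J k) ^+ 3) ->
  forall k, J k <= (A ^+ 2 * D ^+ 3 * J 0) ^+ (3 ^ k)%N.
Proof.
move=> A1 D1 J0 hJ k.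
have A0 : 0 <= A by lra. have D0 : 0 <= D by lra.
have c0 l : 0 <= A ^+ 2 * D ^+ (2 * l + 3) by rewrite mulr_ge0 ?exprn_ge0.
have : A ^+ 2 * D ^+ (2 * k + 3) * J k <= (A ^+ 2 * D ^+ 3 * J 0) ^+ (3 ^ k)%N.
  elim: k => [|k IH]; first by rewrite expn0 expr1 muln0 add0n.
  rewrite expnSr exprM; apply: (@le_trans _ _ ((A ^+ 2 * D ^+ (2 * k + 3) * J k) ^+ 3)); last first.
    by rewrite lerXn2r ?nnegrE ?mulr_ge0// exprn_ge0// !mulr_ge0 ?exprn_ge0.
  apply: (@le_trans _ _ (A ^+ 2 * D ^+ (2 * k.+1 + 3) * (A * D ^+ k * J k) ^+ 3)).
    by rewrite ler_wpM2l.
  have -> : (A * D ^+ k * J k) ^+ 3 = A ^+ 3 * D ^+ (k * 3) * J k ^+ 3 by rewrite !exprMn !exprM.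
  have -> : (A ^+ 2 * D ^+ (2 * k + 3) * J k) ^+ 3 = A ^+ 6 * D ^+ ((2 * k + 3) * 3) * J k ^+ 3.
    by rewrite (exprM D) (exprM A 2 3) -!exprMn.
  rewrite mulrA; apply: ler_wpM2r; first by rewrite exprn_ge0.
  have -> : A ^+ 2 * D ^+ (2 * k.+1 + 3) * (A ^+ 3 * D ^+ (k * 3)) = A ^+ 5 * D ^+ (5 * k + 5).
    rewrite mulrACA -!exprD; congr (_ * _ ^+ _); ring.
  apply: ler_pM; rewrite ?exprn_ge0//.
    by rewrite ler_weXn2l.
  by rewrite ler_weXn2l// mulnDl leq_add// mulnAC leq_mul2r orbT.
apply: le_trans; rewrite ler_peMl// -[leLHS]mulr1 ler_pM// ?exprn_ege1//.
Qed.

End algebra.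

(** * Limits of mollified integrals *)

Section mollified_limits.
Context {R : realType} {n : nat}.
Local Notation E := 'cV[R]_n.
Local Notation mu := (@lebesgue_cV R n).

(** The constant does not depend on the scale, which makes the estimates scale invariant. *)
Lemma kern0_grad_le : exists2 L : R, 0 <= L &
  forall eps j (z : E), 0 < eps -> `|kern (dkern eps j bump_profile) eps z| <= L / eps.
Proof.
have [L L0 hL] := bump1_bounded (dbump1 (1 : {poly R}, 0%N)).
exists L => // eps j z e0; rewrite /kern normr_prod (bigD1 j)//= -[leRHS]mulr1.
apply: ler_pM => //; first exact: prodr_ge0.
  rewrite /dkern eqxx bump1Z normrM [`|_^-1|]gtr0_norm ?invr_gt0// mulrC.
  by rewrite ler_wpM2r ?hL// invr_ge0 ltW.
apply: prodr_ile1 => i ij; rewrite normr_ge0/= /dkern (negbTE ij) /bump_profile.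
rewrite ger0_norm ?bump1_ge0// bump1E; case: ifP => // t1.
by rewrite expR_le1 oppr_le0 invr_ge0 subr_ge0 -sqnormr exprn_ile1// ltW.
Qed.

Lemma ae_le_Rintegral (g h : E -> R) : mu.-integrable setT (EFin \o g) ->
  mu.-integrable setT (EFin \o h) -> {ae mu, forall x, g x <= h x} ->
  \int[mu]_x g x <= \int[mu]_x h x.
Proof.
move=> ig ih gh.
have mg : measurable_fun setT g by apply/measurable_EFinP; exact: measurable_int ig.
have mh : measurable_fun setT h by apply/measurable_EFinP; exact: measurable_int ih.
have mm : measurable_fun setT (fun x => Num.min (g x) (h x)) by exact: measurable_minr.
have im : mu.-integrable setT (EFin \o (fun x => Num.min (g x) (h x))).
  have iS : mu.-integrable setT (EFin \o (fun x => `|g x| + `|h x|)).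
    by apply: integrable_realD => //; exact: integrable_norm.
  apply: (integrable_real_le measurableT mm iS) => x _.
  by case: (leP (g x) (h x)) => _; rewrite ?lerDl ?lerDr.
have -> : \int[mu]_x g x = \int[mu]_x Num.min (g x) (h x).
  congr fine; apply: ae_eq_integral => //; [exact/measurable_EFinP|exact/measurable_EFinP|].
  by apply: filterS gh => x gx _ /=; rewrite min_l.
by apply: le_Rintegral => // x _; rewrite ge_min lexx orbT.
Qed.

Lemma mol_bound eps (g : E -> R) x M : 0 < eps -> eps <= 1 -> locint g -> 0 <= M ->
  (forall y, `|y - x| < eps -> `|g y| <= M) -> `|mol eps g x| <= M.
Proof.
move=> e0 e1 gl M0 gM; have [_ [mg _]] := gl.
rewrite -lee_fin -[`|_|]expr1; apply: le_trans (mol_pow_le x (ltn0Sn 0) e0 e1 gl) _.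
apply: (@le_trans _ _ (\int[mu]_y ((mker eps (y - x))%:E * M%:E))%E); last first.
  rewrite ge0_integralZr//; first by rewrite mker_int// mul1e.
    by apply/measurable_EFinP; exact: measurable_mkersub.
  by move=> y _; rewrite lee_fin mker_ge0.
apply: ge0_le_integral => //.
- by move=> y _; rewrite mule_ge0// lee_fin ?mker_ge0.
- apply: emeasurable_funM; apply/measurable_EFinP; first exact: measurable_mkersub.
  by apply: measurable_funX; exact: measurableT_comp.
- apply: emeasurable_funM => //; apply/measurable_EFinP; exact: measurable_mkersub.
move=> y _; have [yx|yx] := ltP `|y - x| eps.
  by apply: lee_wpmul2l; rewrite lee_fin ?mker_ge0// expr1 gM.
by rewrite mker_supp// !mul0e.
Qed.

Lemma mol_ge0 eps (h : E -> R) x : 0 < eps -> (forall y, 0 <= h y) -> 0 <= mol eps h x.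
Proof.
by move=> e0 h0; apply: fine_ge0; apply: integral_ge0 => y _; rewrite lee_fin mulr_ge0// mker_ge0.
Qed.

Lemma measurable_mol eps (g : E -> R) : 0 < eps -> eps <= 1 -> locint g ->
  measurable_fun setT (mol eps g).
Proof. by move=> e0 e1 gl; have [_ cg _] := C1grad_mol e0 e1 gl; exact: continuous_measurable_cV. Qed.

(** The majorants are not dominated by a single integrable function, but they
    converge almost everywhere and mollification preserves their integral, so
    that [pratt] applies. *)
Lemma mol_dominated (h : E -> R) (B : set E) (C : R) k0 (F : nat -> E -> R) (F0 : E -> R) :
  (forall x, 0 <= h x) -> mu.-integrable setT (EFin \o h) -> measurable B -> (mu B < +oo)%E ->
  0 <= C -> (forall k, measurable_fun setT (F k)) -> measurable_fun setT F0 ->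
  (forall k x, `|F k x| <= C * (\1_B x + mol (mol_radius (k + k0)) h x)) ->
  {ae mu, forall x, F k x @[k --> \oo] --> F0 x} ->
  mu.-integrable setT (EFin \o F0) /\ \int[mu]_x F k x @[k --> \oo] --> \int[mu]_x F0 x.
Proof.
move=> h0 ih mB Boo C0 mF mF0 FD Fcv.
have hl := locint_int ih.
have mh : measurable_fun setT h by case: hl => ? [].
have iB := integrable_indic_lty mB Boo.
have e0 k : 0 < mol_radius (k + k0) :> R by exact: mol_radius_gt0.
have e1 k : mol_radius (k + k0) <= 1 :> R by exact: mol_radius_le1.
have mm k := measurable_mol (e0 k) (e1 k) hl.
have molE k : (\int[mu]_x (mol (mol_radius (k + k0)) h x)%:E = \int[mu]_x (h x)%:E)%E.
  rewrite -(mker_tonelli (e0 k) (h := EFin \o h)) //; [|exact/measurable_EFinP].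
  by apply: eq_integral => x _; rewrite mol_EFin.
have iD : mu.-integrable setT (EFin \o (fun x => C * (\1_B x + h x))).
  by apply: integrable_realZ => //; exact: integrable_realD.
apply: (@pratt _ _ R mu F F0 (fun k x => C * (\1_B x + mol (mol_radius (k + k0)) h x))
  (fun x => C * (\1_B x + h x))) => //.
- move=> k; apply: measurable_funM => //; apply: measurable_funD => //; exact: measurable_indic.
- by move=> x; rewrite mulr_ge0// addr_ge0// indicE.
- move=> k.
  have eqI (u : E -> R) : measurable_fun setT u -> (forall x, 0 <= u x) ->
      (\int[mu]_x (C * (\1_B x + u x))%:E = C%:E * (\int[mu]_x (\1_B x)%:E + \int[mu]_x (u x)%:E))%E.
    move=> mu_ u0; rewrite -ge0_integralD//; last 3 first.
    - by apply/measurable_EFinP; exact: measurable_indic.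
    - by move=> x _; rewrite lee_fin.
    - exact/measurable_EFinP.
    rewrite -ge0_integralZl//.
    - by apply/measurable_EFinP; apply: measurable_funD => //; exact: measurable_indic.
    - by move=> x _; rewrite -EFinD lee_fin addr_ge0// indicE.
  have m0 x : 0 <= mol (mol_radius (k + k0)) h x by exact: mol_ge0.
  by rewrite (eqI _ mh h0) (eqI _ (mm k) m0) molE.
have := @lebesgue_points R n 1 h (ltn0Sn 0) mh.
have -> : (fun x => `|h x| ^+ 1) = h by apply/funext => x; rewrite expr1 ger0_norm.
move=> /(_ ih); apply: filterS => x hx; apply: cvgM; first exact: cvg_cst.
apply: cvgD; first exact: cvg_cst.
apply: (cvg_comp (fun k => (k + k0)%N) (fun k => mol (mol_radius k) h x)); first exact: cvg_addnr.
exact: (mol_cvg (ltn0Sn 0) hl hx).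
Qed.

End mollified_limits.

Section powers.
Context {R : realType}.

Lemma pow_add_le (a b : R) N : 0 <= a -> 0 <= b -> (a + b) ^+ N <= 2 ^+ N * (a ^+ N + b ^+ N).
Proof.
move=> a0 b0; have m0 : 0 <= Num.max a b by rewrite le_max a0.
apply: (@le_trans _ _ ((2 * Num.max a b) ^+ N)).
  rewrite lerXn2r ?nnegrE ?addr_ge0 ?mulr_ge0//.
  by rewrite mulr_natl mulr2n lerD// le_max lexx ?orbT.
rewrite exprMn ler_wpM2l ?exprn_ge0//.
by case: (leP a b) => _; rewrite ?lerDl ?lerDr exprn_ge0.
Qed.

Lemma pow_pred_le (a : R) N : 0 <= a -> a ^+ N.-1 <= 1 + a ^+ N.
Proof.
move=> a0; case: N => [|N]; first by rewrite expr0 lerDl.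
have [a1|a1] := leP a 1.
  by rewrite (@le_trans _ _ 1)// ?exprn_ile1// lerDl exprn_ge0.
by rewrite (@le_trans _ _ (a ^+ N.+1))// ?lerDr// ler_weXn2l// ltW.
Qed.

Lemma cvg_pow (u : nat -> R) (l : R) N : u k @[k --> \oo] --> l -> u k ^+ N @[k --> \oo] --> l ^+ N.
Proof. by move=> ul; apply: (cvg_comp u (fun y : R => y ^+ N) ul); exact: exprn_continuous. Qed.

Lemma mol_radius_anti k l : (k <= l)%N -> mol_radius l <= mol_radius k :> R.
Proof. by move=> kl; rewrite /mol_radius lef_pV2 ?posrE// ler_nat. Qed.

Lemma mol_radius_exists (r : R) : 0 < r -> exists k, mol_radius k < r.
Proof. by move=> /mol_radius_near[k _ /(_ k (leqnn k))]; exists k. Qed.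

End powers.

Section integrable_powers.
Context {R : realType} {n : nat}.
Local Notation E := 'cV[R]_n.
Local Notation mu := (@lebesgue_cV R n).

Lemma integrable_powD (g h : E -> R) N : measurable_fun setT g -> measurable_fun setT h ->
  mu.-integrable setT (EFin \o (fun x => `|g x| ^+ N)) ->
  mu.-integrable setT (EFin \o (fun x => `|h x| ^+ N)) ->
  mu.-integrable setT (EFin \o (fun x => `|g x + h x| ^+ N)).
Proof.
move=> mg mh ig ih.
have iS : mu.-integrable setT (EFin \o (fun x => 2 ^+ N * (`|g x| ^+ N + `|h x| ^+ N))).
  by apply: integrable_realZ => //; exact: integrable_realD.
apply: (integrable_real_le measurableT _ iS).
  by apply: measurable_funX; apply: measurableT_comp => //; exact: measurable_funD.
move=> x _; rewrite ger0_norm ?exprn_ge0//; apply: le_trans (pow_add_le N _ _) => //.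
by rewrite lerXn2r ?nnegrE ?addr_ge0 ?ler_normD.
Qed.

Lemma integrable_pow_sum (I : Type) (s : seq I) (g : I -> E -> R) N : (0 < N)%N ->
  (forall i, measurable_fun setT (g i)) ->
  (forall i, mu.-integrable setT (EFin \o (fun x => `|g i x| ^+ N))) ->
  mu.-integrable setT (EFin \o (fun x => `|\sum_(i <- s) g i x| ^+ N)).
Proof.
move=> N0 mg ig; elim: s => [|i s IH].
  have := integrable0 mu setT; apply: eq_integrable => // x _ /=.
  by rewrite big_nil normr0 expr0n gtn_eqF.
under eq_fun do rewrite big_cons; apply: integrable_powD => //.
exact: measurable_sum.
Qed.

End integrable_powers.

Section mollified_gradient.
Context {R : realType} {n : nat} (n0 : (0 < n)%N).
Local Notation E := 'cV[R]_n.
Local Notation mu := (@lebesgue_cV R n).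
Variables (Omega : set E) (f : 'I_n -> E -> R) (G : 'I_n -> 'I_n -> E -> R).
Hypothesis f_locint : forall i, locint (f i).
Hypothesis f_cont : forall i x, Omega x -> {for x, continuous (f i)}.
Hypothesis mG : forall i j, measurable_fun setT (G i j).
Hypothesis iG : forall i j, mu.-integrable setT (EFin \o (fun x => `|G i j x| ^+ n)).
Hypothesis f_grad : forall i j eps x, 0 < eps -> eps <= 1 ->
  [set y : E | `|x - y| <= eps] `<=` Omega -> dmol eps j (f i) x = mol eps (G i j) x.

Definition gsum x : R := mxsum (fun i j => G i j x).

Lemma gsum_ge0 x : 0 <= gsum x. Proof. exact: mxsum_ge0. Qed.

Lemma measurable_gsum : measurable_fun setT gsum.
Proof.
by apply: measurable_sum => i; apply: measurable_sum => j; exact: measurableT_comp.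
Qed.

Lemma gsum_integrable : mu.-integrable setT (EFin \o (fun x => gsum x ^+ n)).
Proof.
have mrow i : measurable_fun setT (fun x => \sum_j `|G i j x|).
  by apply: measurable_sum => j; exact: measurableT_comp.
have irow i : mu.-integrable setT (EFin \o (fun x => `|\sum_j `|G i j x| | ^+ n)).
  apply: integrable_pow_sum => // j; first exact: measurableT_comp.
  by under eq_fun do rewrite normr_id.
have := integrable_pow_sum (index_enum _) n0 mrow irow.
by under eq_fun do rewrite ger0_norm ?gsum_ge0//.
Qed.

Lemma G_locint i j : locint (G i j).
Proof. exact: locint_pow (iG i j). Qed.

(** Jensen's inequality for the mollification, which is an average. *)
Lemma gsum_mol_le eps x : 0 < eps -> eps <= 1 ->
  mxsum (fun i j => mol eps (G i j) x) ^+ n <= mol eps (fun y => gsum y ^+ n) x.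
Proof.
move=> e0 e1.
have dl : locint gsum.
  by apply: locint_sum => i; apply: locint_sum => j; apply/locint_norm/G_locint.
have ddl := locint_int gsum_integrable.
have h : mxsum (fun i j => mol eps (G i j) x) <= mol eps gsum x.
  rewrite mol_sum//; last by move=> i; apply: locint_sum => j; apply/locint_norm/G_locint.
  apply: ler_sum => i _; rewrite mol_sum//; last by move=> j; apply/locint_norm/G_locint.
  by apply: ler_sum => j _; apply: mol_norm_le => //; exact: G_locint.
apply: (@le_trans _ _ (`|mol eps gsum x| ^+ n)).
  rewrite lerXn2r ?nnegrE ?mxsum_ge0//; exact: le_trans (ler_norm _).
rewrite -lee_fin mol_EFin//; apply: le_trans (mol_pow_le x n0 e0 e1 dl) _.
rewrite le_eqVlt; apply/orP; left; apply/eqP/eq_integral => y _.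
by rewrite ger0_norm ?gsum_ge0.
Qed.

Variables (i : 'I_n) (c : R) (x0 : E) (r : R) (k0 : nat).
Hypothesis r0 : 0 < r.
Hypothesis k0r : mol_radius k0 < r.
Hypothesis ball2 : [set y : E | `|x0 - y| <= 2 * r] `<=` Omega.

Definition uval x := (f i x - c) / r.
Definition umol k x := (mol (mol_radius (k + k0)) (f i) x - c) / r.
Definition gmol k l j x := dmol (mol_radius (k + k0)) j (f l) x.

Let e0 k : 0 < mol_radius (k + k0) :> R. Proof. exact: mol_radius_gt0. Qed.
Let e1 k : mol_radius (k + k0) <= 1 :> R. Proof. exact: mol_radius_le1. Qed.
Let er_r k : mol_radius (k + k0) < r. Proof. by apply: le_lt_trans k0r; apply: mol_radius_anti; rewrite leq_addl. Qed.

Let sub2 x y : `|x0 - x| < r -> `|y - x| < r -> `|x0 - y| <= 2 * r.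
Proof.
move=> h1 h2; have := ler_distD x x0 y; rewrite (distrC y) in h2; lra.
Qed.

Lemma gmolE k l j x : `|x0 - x| < r -> gmol k l j x = mol (mol_radius (k + k0)) (G l j) x.
Proof.
move=> xr; apply: f_grad => // y /= yx; apply/ball2/(sub2 xr); rewrite distrC.
exact: le_lt_trans (er_r k).
Qed.

Lemma uval_bounded : exists2 M, 0 <= M & forall x, `|x0 - x| <= 2 * r -> `|uval x| <= M.
Proof.
have cK := @cV_compact_cball R n x0 (2 * r).
have cu : {within [set y : E | `|x0 - y| <= 2 * r], continuous (f i)}.
  by apply: continuous_in_subspaceT => x /set_mem xK; apply: f_cont; exact: ball2.
have := continuous_compact cu cK; move=> /compact_bounded[M [_ hM]].
exists ((`|M| + 1 + `|c|) / r); first by rewrite divr_ge0 ?addr_ge0// ltW.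
move=> x xK; rewrite /uval normrM normfV [`|r|]gtr0_norm// ler_pM2r ?invr_gt0//.
rewrite (le_trans (ler_normB _ _))// lerD2r.
apply: (hM (`|M| + 1)); last by exists x.
by rewrite (le_lt_trans (ler_norm M))// ltrDl.
Qed.

Lemma umol_bounded M k x : 0 <= M -> (forall y, `|x0 - y| <= 2 * r -> `|uval y| <= M) ->
  `|x0 - x| < r -> `|umol k x| <= M.
Proof.
move=> M0 hM xr; rewrite /umol normrM normfV [`|r|]gtr0_norm// ler_pdivrMr//.
rewrite -mol_subc//; apply: mol_bound => //.
- by apply: locintD => //; exact: locint_cst.
- by rewrite mulr_ge0// ltW.
move=> y yx; have /hM : `|x0 - y| <= 2 * r by apply: (sub2 xr); exact: lt_trans (er_r k).
by rewrite /uval normrM normfV [`|r|]gtr0_norm// ler_pdivrMr.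
Qed.

Lemma mol_cvg_shift (g : E -> R) N (x : E) : (0 < N)%N -> locint g -> leb_pt N g x ->
  mol (mol_radius (k + k0)) g x @[k --> \oo] --> g x.
Proof.
move=> N0 gl gx; apply: (cvg_comp (fun k => (k + k0)%N) (fun k => mol (mol_radius k) g x)).
  exact: cvg_addnr.
exact: mol_cvg gx.
Qed.

Lemma umol_cvg x : `|x0 - x| < r -> umol k x @[k --> \oo] --> uval x.
Proof.
move=> xr; apply: cvgM; last exact: cvg_cst.
apply: cvgB; last exact: cvg_cst.
apply: (@mol_cvg_shift _ 1) => //; apply: leb_pt_continuous; first by case: (f_locint i) => ? [].
by apply/f_cont/ball2/(sub2 xr); rewrite subrr normr0.
Qed.

Lemma measurable_uval : measurable_fun setT uval.
Proof.
by apply: measurable_funM => //; apply: measurable_funB => //; case: (f_locint i) => ? [].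
Qed.

Lemma C1grad_umol k : C1grad (umol k) (fun j x => gmol k i j x / r).
Proof.
have := C1gradZ r^-1 (C1gradD (C1grad_mol (e0 k) (e1 k) (f_locint i)) (C1grad_cst (- c))).
congr C1grad; first by apply/funext => x; rewrite mulrC.
by apply/funext => j; apply/funext => x; rewrite addr0 mulrC.
Qed.

Lemma C1grad_gmol k l j : C1grad (gmol k l j) (fun j' => d2mol (mol_radius (k + k0)) j' j (f l)).
Proof. exact: C1grad_dmol. Qed.

Definition good_pt x := forall l j, leb_pt n (G l j) x.

Lemma ae_good_pt : {ae mu, forall x, good_pt x}.
Proof.
apply: filter_forall => l; apply: filter_forall => j.
exact: lebesgue_points.
Qed.

(** The passage from mollifications to [f] and [G], for every integrand [Phi] with
    the growth of the Jacobian that vanishes off the cube.  The gradients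
    converge at the Lebesgue points of [G], and the mollifications of
    [gsum ^+ n] serve as majorants. *)
Lemma mollified_limit (Phi : E -> R -> ('I_n -> 'I_n -> R) -> R) M C :
  0 <= C -> 0 <= M -> (forall y, `|x0 - y| <= 2 * r -> `|uval y| <= M) ->
  (forall (t : E -> R) (A : 'I_n -> 'I_n -> E -> R), measurable_fun setT t ->
    (forall l j, measurable_fun setT (A l j)) ->
    measurable_fun setT (fun x => Phi x (t x) (fun l j => A l j x))) ->
  (forall x t A, r <= `|x0 - x| -> Phi x t A = 0) ->
  (forall x t A, `|t| <= M -> `|Phi x t A| <= C * (1 + mxsum A ^+ n)) ->
  (forall x (t : nat -> R) t0 (A : nat -> 'I_n -> 'I_n -> R) A0, t k @[k --> \oo] --> t0 ->
    (forall l j, A k l j @[k --> \oo] --> A0 l j) ->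
    Phi x (t k) (A k) @[k --> \oo] --> Phi x t0 A0) ->
  [/\ mu.-integrable setT (EFin \o (fun x => Phi x (uval x) (fun l j => G l j x))),
      forall k, mu.-integrable setT (EFin \o (fun x => Phi x (umol k x) (fun l j => gmol k l j x))) &
      \int[mu]_x Phi x (umol k x) (fun l j => gmol k l j x) @[k --> \oo] -->
      \int[mu]_x Phi x (uval x) (fun l j => G l j x)].
Proof.
move=> C0 M0 hM mPhi Phi0 PhiC Phicv.
have mB : measurable (ball x0 r : set E) by exact: measurable_ball_cV.
have Boo : (mu (ball x0 r) < +oo)%E.
  by rewrite [X in (X < _)%E]lebesgue_cV_ball//; exact: ltry.
have mF k : measurable_fun setT (fun x => Phi x (umol k x) (fun l j => gmol k l j x)).
  apply: mPhi; first by have [_ cu _] := C1grad_umol k; exact: continuous_measurable_cV.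
  by move=> l j; have [_ cg _] := C1grad_gmol k l j; exact: continuous_measurable_cV.
have mF0 : measurable_fun setT (fun x => Phi x (uval x) (fun l j => G l j x)).
  by apply: mPhi => //; exact: measurable_uval.
have h0 x : 0 <= gsum x ^+ n by rewrite exprn_ge0// gsum_ge0.
have FD k x : `|Phi x (umol k x) (fun l j => gmol k l j x)| <=
    C * (\1_(ball x0 r : set E) x + mol (mol_radius (k + k0)) (fun y => gsum y ^+ n) x).
  have m0 : 0 <= mol (mol_radius (k + k0)) (fun y => gsum y ^+ n) x by exact: mol_ge0.
  have [xr|xr] := ltP `|x0 - x| r; last by rewrite Phi0// normr0 mulr_ge0// addr_ge0// indicE.
  have xB : x \in (ball x0 r : set E) by apply/mem_set/ball_normP.
  apply: le_trans (PhiC _ _ _ (umol_bounded k M0 hM xr)) _.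
  rewrite indicE xB ler_wpM2l// lerD2l; apply: le_trans (gsum_mol_le x (e0 k) (e1 k)).
  rewrite le_eqVlt; apply/orP; left; apply/eqP; congr (_ ^+ _).
  by apply: eq_bigr => l _; apply: eq_bigr => j _; rewrite gmolE.
have Fcv : {ae mu, forall x, Phi x (umol k x) (fun l j => gmol k l j x) @[k --> \oo] -->
    Phi x (uval x) (fun l j => G l j x)}.
  apply: filterS ae_good_pt => x gx.
  have [xr|xr] := ltP `|x0 - x| r; last first.
    by under eq_fun do rewrite Phi0//; rewrite Phi0//; exact: cvg_cst.
  apply: Phicv; first exact: umol_cvg.
  move=> l j; under eq_fun do rewrite gmolE//.
  apply: (@mol_cvg_shift _ n) => //; exact: G_locint.
have [h1 h2] := mol_dominated h0 gsum_integrable mB Boo C0 mF mF0 FD Fcv.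
split => // k.
have ddl := locint_int gsum_integrable.
have iD : mu.-integrable setT (EFin \o (fun x => C * (\1_(ball x0 r : set E) x + mol (mol_radius (k + k0)) (fun y => gsum y ^+ n) x))).
  apply: integrable_realZ => //; apply: integrable_realD => //; first exact: integrable_indic_lty.
  apply/integrableP; split; first by apply/measurable_EFinP; exact: measurable_mol.
  have /integrableP[_] := gsum_integrable.
  have ddm : measurable_fun setT (fun y => (gsum y ^+ n)%:E).
    by apply/measurable_EFinP; apply: measurable_funX; exact: measurable_gsum.
  rewrite [X in (X < _)%E -> _](_ : _ = \int[mu]_y (gsum y ^+ n)%:E)%E; last first.
    by apply: eq_integral => y _; rewrite /= ger0_norm.
  rewrite -(mker_tonelli (e0 k) ddm) => [|y]; last by rewrite lee_fin.
  apply: le_lt_trans; rewrite le_eqVlt; apply/orP; left; apply/eqP/eq_integral => y _ /=.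
  by rewrite ger0_norm ?mol_ge0// mol_EFin.
by apply: (integrable_real_le measurableT (mF k) iD) => x _; exact: FD.
Qed.

(** * The Caccioppoli inequality *)

Variables (a1 a2 L : R).
Hypothesis a1_ge0 : 0 <= a1.
Hypothesis a2_ge0 : 0 <= a2.
Hypothesis L0 : 0 <= L.
Hypothesis hL : forall eps j (z : E), 0 < eps -> `|kern (dkern eps j bump_profile) eps z| <= L / eps.

Let jac x := \det (setrow i (fun j => G i j x) (fun l j => G l j x)).

Hypothesis jac_sign : {ae mu, forall x, 0 <= jac x} \/ {ae mu, forall x, jac x <= 0}.
Hypothesis jac_bound : {ae mu, forall x, gsum x ^+ n <= a1 * `|jac x| + a2}.

Definition cut (x : E) : R := kern bump_profile r (x - x0).
Definition dcut j (x : E) : R := kern (dkern r j bump_profile) r (x - x0).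

Lemma cut_ge0 x : 0 <= cut x. Proof. exact: kern0_ge0. Qed.
Lemma cut_le1 x : cut x <= 1. Proof. exact: kern0_le1. Qed.

Lemma cut_supp : csupp x0 r cut.
Proof. by move=> x xr; rewrite /cut kern_supp// distrC. Qed.

Lemma dcut_supp j : csupp x0 r (dcut j).
Proof. by move=> x xr; rewrite /dcut kern_supp// distrC. Qed.

Lemma C1grad_cut : C1grad cut dcut. Proof. exact: C1grad_kern. Qed.

Lemma sum_dcut_le x : \sum_j `|dcut j x| <= n%:R * (L / r).
Proof.
rewrite mulr_natl -[X in _ *+ X]card_ord -sumr_const; apply: ler_sum => j _; exact: hL.
Qed.

Lemma measurable_cut : measurable_fun setT cut.
Proof. by have [_ h _] := C1grad_cut; exact: continuous_measurable_cV. Qed.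

Variables (b p : nat).
(* The test function is [cut ^+ q * u ^+ m.+1], whose gradient produces the even
   power [u ^+ m]; evenness keeps the sign of the Jacobian. *)
Let m := (n * p)%N.
Let q := (n * b.+1)%N.
Hypothesis m_even : ~~ odd m.

Let Phia x (t : R) (A : 'I_n -> 'I_n -> R) :=
  cut x ^+ q * t ^+ m * \det (setrow i (A i) A).
Let Phib x (t : R) (A : 'I_n -> 'I_n -> R) :=
  t ^+ m.+1 * cut x ^+ q.-1 * \det (setrow i (fun j => dcut j x) A).

Let q0 : (0 < q)%N. Proof. by rewrite muln_gt0 n0. Qed.

Let cutX_le1 k x : 0 <= cut x ^+ k <= 1.
Proof. by rewrite exprn_ge0 ?cut_ge0//= exprn_ile1 ?cut_ge0 ?cut_le1. Qed.

Let det_ge0 (A : 'I_n -> 'I_n -> R) : 0 <= mxsum A ^+ n.-1. Proof. by rewrite exprn_ge0// mxsum_ge0. Qed.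

Let mxsumS (A : 'I_n -> 'I_n -> R) : mxsum A * mxsum A ^+ n.-1 = mxsum A ^+ n.
Proof. by rewrite -exprS prednK. Qed.

(** The null Lagrangian identity for the test function [cut ^+ q * u ^+ m.+1].  It
    needs second derivatives, hence is proved for mollifications and passes to
    the limit. *)
Lemma caccioppoli_limit M : 0 <= M -> (forall y, `|x0 - y| <= 2 * r -> `|uval y| <= M) ->
  [/\ mu.-integrable setT (EFin \o (fun x => Phia x (uval x) (fun l j => G l j x))),
      mu.-integrable setT (EFin \o (fun x => Phib x (uval x) (fun l j => G l j x))) &
      m.+1%:R / r * \int[mu]_x Phia x (uval x) (fun l j => G l j x) +
      q%:R * \int[mu]_x Phib x (uval x) (fun l j => G l j x) = 0].
Proof.
move=> M0 hM.
have [] := @mollified_limit Phia M (M ^+ m * n`!%:R) _ M0 hM.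
- by rewrite mulr_ge0// exprn_ge0.
- move=> t A mt mA; apply: measurable_funM; last exact: measurable_det_setrow.
  by apply: measurable_funM; apply: measurable_funX => //; exact: measurable_cut.
- by move=> x t A xr; rewrite /Phia cut_supp// expr0n gtn_eqF//= !mul0r.
- move=> x t A tM; rewrite /Phia 2!normrM -mulrA; have /andP[c1 c2] := cutX_le1 q x.
  rewrite ger0_norm// normrX.
  apply: (@le_trans _ _ (`|t| ^+ m * `|\det (setrow i (A i) A)|)).
    by rewrite ler_piMl// mulr_ge0// exprn_ge0.
  rewrite -mulrA; apply: ler_pM => //.
    by rewrite lerXn2r ?nnegrE.
  apply: le_trans (det_setrow_le _ _ _ n0) _; rewrite ler_wpM2l//.
  apply: (@le_trans _ _ (mxsum A ^+ n)); last by rewrite lerDr.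
  by rewrite -mxsumS ler_wpM2r// mxsum_row.
- move=> x t t0 A A0 ct cA; apply: cvgM; last by apply: cvg_det_setrow => // j; exact: cA.
  by apply: cvgM; [exact: cvg_cst|apply: (cvg_comp _ (fun y : R => y ^+ m) ct); exact: exprn_continuous].
move=> ia iak ca.
have [] := @mollified_limit Phib M (M ^+ m.+1 * (n`!%:R * (n%:R * (L / r)))) _ M0 hM.
- by rewrite !mulr_ge0// ?exprn_ge0// invr_ge0 ltW.
- move=> t A mt mA; apply: measurable_funM; last first.
    apply: measurable_det_setrow => // j; apply: continuous_measurable_cV.
    by have [_ _] := C1grad_cut.
  by apply: measurable_funM; apply: measurable_funX => //; exact: measurable_cut.
- move=> x t A xr; rewrite /Phib det_setrow big1 ?mulr0// => s _.
  by rewrite dcut_supp// mul0r mulr0.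
- move=> x t A tM; rewrite /Phib 2!normrM; have /andP[c1 c2] := cutX_le1 q.-1 x.
  rewrite (ger0_norm c1) normrX -!mulrA; apply: ler_pM.
  + exact: exprn_ge0.
  + by rewrite mulr_ge0.
  + by rewrite lerXn2r ?nnegrE.
  apply: (@le_trans _ _ (`|\det (setrow i (dcut^~ x) A)|)); first by rewrite ler_piMl.
  apply: le_trans (det_setrow_le _ _ _ n0) _; rewrite ler_wpM2l//.
  rewrite mulrA mulrA -[n%:R * L / r]mulrA; apply: ler_pM; [exact: sumr_ge0|exact: det_ge0|exact: sum_dcut_le|].
  by apply: pow_pred_le; exact: mxsum_ge0.
- move=> x t t0 A A0 ct cA; apply: cvgM.
    by apply: cvgM; [apply: (cvg_comp _ (fun y : R => y ^+ m.+1) ct); exact: exprn_continuous|exact: cvg_cst].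
  by apply: cvg_det_setrow => // j; exact: cvg_cst.
move=> ib ibk cb; split => //.
have h k : m.+1%:R / r * \int[mu]_x Phia x (umol k x) (fun l j => gmol k l j x) +
    q%:R * \int[mu]_x Phib x (umol k x) (fun l j => gmol k l j x) = 0.
  have wC1 := C1gradM (C1gradX q C1grad_cut) (C1gradX m.+1 (C1grad_umol k)).
  have := @null_lagrangian _ _ (gmol k) (fun l j j' => d2mol (mol_radius (k + k0)) j' j (f l)) _ _ x0 r r0
    (C1grad_gmol k) _ wC1 _ _ i.
  rewrite -!RintegralZl// -RintegralD//; last 2 first.
  + exact: integrable_realZ.
  + exact: integrable_realZ.
  move=> <-.
  + apply: eq_Rintegral => x _.
    rewrite [X in _ = \det (setrow i X _)](_ : _ = (fun j =>
      (cut x ^+ q * (m.+1%:R * umol k x ^+ m) / r) * gmol k i j x +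
      (umol k x ^+ m.+1 * (q%:R * cut x ^+ q.-1)) * dcut j x)); last first.
      by apply/funext => j /=; ring.
    rewrite det_setrow_lin /Phia /Phib; ring.
  + by move=> l j j'; apply/funext => x; exact: d2molC.
  + by apply: csuppM => x xr; rewrite cut_supp// expr0n gtn_eqF.
  + by move=> j x xr; rewrite cut_supp// dcut_supp// expr0n gtn_eqF// !mulr0 !mul0r addr0.
have /cvg_lim <- // : (fun k => m.+1%:R / r * \int[mu]_x Phia x (umol k x) (fun l j => gmol k l j x) +
    q%:R * \int[mu]_x Phib x (umol k x) (fun l j => gmol k l j x)) k @[k --> \oo] -->
    m.+1%:R / r * \int[mu]_x Phia x (uval x) (fun l j => G l j x) +
      q%:R * \int[mu]_x Phib x (uval x) (fun l j => G l j x).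
  by apply: cvgD; apply: cvgM => //; exact: cvg_cst.
by under eq_fun do rewrite h; rewrite lim_cst.
Qed.

Let B : set E := ball x0 r.
Let chi (x : E) : R := \1_B x.

Let chi_in x : `|x0 - x| < r -> chi x = 1.
Proof. by move=> xr; rewrite /chi indicE mem_set//; exact/ball_normP. Qed.

Let chi_out x : r <= `|x0 - x| -> chi x = 0.
Proof.
move=> xr; rewrite /chi indicE memNset// => /ball_normP; by rewrite ltNge xr.
Qed.

Let chi_ge0 x : 0 <= chi x. Proof. by rewrite /chi indicE. Qed.
Let chi_le1 x : chi x <= 1. Proof. by rewrite /chi indicE; case: (_ \in _). Qed.

Let mB : measurable B. Proof. exact: measurable_ball_cV. Qed.

(** The quantity that the iteration improves is the integral over the cube of
    [1 + (cut ^+ b * |u| ^+ p) ^+ n].  The summand [1] lets it dominate the lower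
    power [|u| ^+ (n * p.-1)] of the Caccioppoli inequality as well as the
    inhomogeneous term [a2]. *)
Definition moser_integrand b' p' (x : E) (t : R) (A : 'I_n -> 'I_n -> R) :=
  chi x + (chi x * (cut x ^+ b' * `|t| ^+ p')) ^+ n.

Let Phin := moser_integrand b p.+1.
Let Phix x (t : R) (A : 'I_n -> 'I_n -> R) := cut x ^+ q * `|t| ^+ m * mxsum A ^+ n.

Let cutX_ge0 k x : 0 <= cut x ^+ k. Proof. by have /andP[] := cutX_le1 k x. Qed.

Let Phin_ge0 x t A : 0 <= Phin x t A.
Proof. by rewrite /Phin /moser_integrand addr_ge0// exprn_ge0// !mulr_ge0// exprn_ge0. Qed.

Let mchi : measurable_fun setT chi. Proof. exact: measurable_indic. Qed.

Lemma moser_limit b' p' M : 0 <= M -> (forall y, `|x0 - y| <= 2 * r -> `|uval y| <= M) ->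
  [/\ mu.-integrable setT (EFin \o (fun x => moser_integrand b' p' x (uval x) (fun l j => G l j x))),
      forall k, mu.-integrable setT (EFin \o (fun x => moser_integrand b' p' x (umol k x) (fun l j => gmol k l j x))) &
      \int[mu]_x moser_integrand b' p' x (umol k x) (fun l j => gmol k l j x) @[k --> \oo] -->
      \int[mu]_x moser_integrand b' p' x (uval x) (fun l j => G l j x)].
Proof.
move=> M0 hM.
have Mp0 : 0 <= 1 + (M ^+ p') ^+ n by rewrite addr_ge0// !exprn_ge0.
apply: (@mollified_limit _ M (1 + (M ^+ p') ^+ n) Mp0 M0 hM).
- move=> t A mt mA; apply: measurable_funD => //; apply: measurable_funX; apply: measurable_funM => //.
  apply: measurable_funM; apply: measurable_funX; first exact: measurable_cut.
  exact: measurableT_comp.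
- by move=> x t A xr; rewrite /moser_integrand chi_out// mul0r add0r expr0n gtn_eqF.
- move=> x t A tM.
  have h0 : 0 <= chi x * (cut x ^+ b' * `|t| ^+ p') by rewrite !mulr_ge0// exprn_ge0.
  rewrite /moser_integrand ger0_norm; last by rewrite addr_ge0// exprn_ge0.
  apply: (@le_trans _ _ (1 + (M ^+ p') ^+ n)); last first.
    by rewrite ler_peMr// lerDl exprn_ge0// mxsum_ge0.
  rewrite lerD// lerXn2r ?nnegrE ?exprn_ge0//.
  rewrite (@le_trans _ _ (`|t| ^+ p'))//; last by rewrite lerXn2r ?nnegrE.
  rewrite mulrA ler_piMl ?exprn_ge0// mulr_ile1//.
  by have /andP[] := cutX_le1 b' x.
- move=> x t t0 A A0 ct cA; apply: cvgD; first exact: cvg_cst.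
  have cn : `|t k| @[k --> \oo] --> `|t0| by exact: cvg_norm.
  have c1 : `|t k| ^+ p' @[k --> \oo] --> `|t0| ^+ p'.
    by apply: (cvg_comp _ (fun y : R => y ^+ p') cn); exact: exprn_continuous.
  have c2 : chi x * (cut x ^+ b' * `|t k| ^+ p') @[k --> \oo] --> chi x * (cut x ^+ b' * `|t0| ^+ p').
    by apply: cvgM; [exact: cvg_cst|apply: cvgM => //; exact: cvg_cst].
  by apply: (cvg_comp _ (fun y : R => y ^+ n) c2); exact: exprn_continuous.
Qed.

Lemma gradient_limit M : 0 <= M -> (forall y, `|x0 - y| <= 2 * r -> `|uval y| <= M) ->
  [/\ mu.-integrable setT (EFin \o (fun x => Phix x (uval x) (fun l j => G l j x))),
      forall k, mu.-integrable setT (EFin \o (fun x => Phix x (umol k x) (fun l j => gmol k l j x))) &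
      \int[mu]_x Phix x (umol k x) (fun l j => gmol k l j x) @[k --> \oo] -->
      \int[mu]_x Phix x (uval x) (fun l j => G l j x)].
Proof.
move=> M0 hM.
have Mm0 : 0 <= M ^+ m by rewrite exprn_ge0.
apply: (@mollified_limit _ M (M ^+ m) Mm0 M0 hM).
- move=> t A mt mA; apply: measurable_funM.
    apply: measurable_funM; apply: measurable_funX; first exact: measurable_cut.
    exact: measurableT_comp.
  apply: measurable_funX; apply: measurable_sum => l; apply: measurable_sum => j.
  exact: measurableT_comp.
- by move=> x t A xr; rewrite /Phix cut_supp// expr0n gtn_eqF//= !mul0r.
- move=> x t A tM; have An0 : 0 <= mxsum A ^+ n by rewrite exprn_ge0// mxsum_ge0.
  have tm0 : 0 <= `|t| ^+ m by rewrite exprn_ge0.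
  rewrite /Phix ger0_norm; last by rewrite !mulr_ge0.
  apply: ler_pM => //; first by rewrite mulr_ge0.
  - rewrite (@le_trans _ _ (`|t| ^+ m))//; last by rewrite lerXn2r ?nnegrE.
    by rewrite ler_piMl//; have /andP[] := cutX_le1 q x.
  - by rewrite lerDr.
- move=> x t t0 A A0 ct cA; apply: cvgM.
    apply: cvgM; first exact: cvg_cst.
    have cn : `|t k| @[k --> \oo] --> `|t0| by exact: cvg_norm.
    by apply: (cvg_comp _ (fun y : R => y ^+ m) cn); exact: exprn_continuous.
  have cm : mxsum (A k) @[k --> \oo] --> mxsum A0.
    by apply: cvg_bigsum => l; apply: cvg_bigsum => j; apply: cvg_norm; exact: cA.
  by apply: (cvg_comp _ (fun y : R => y ^+ n) cm); exact: exprn_continuous.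
Qed.

Let qE : q.-1 = (b.+1 * n.-1 + b)%N.
Proof.
by rewrite /q -{1}(prednK n0) mulSn addSn /= addnC mulnC.
Qed.

Let mE : m.+1 = (p * n.-1 + p.+1)%N.
Proof.
by rewrite /m -{1}(prednK n0) mulSn addnS addnC mulnC.
Qed.

Let Phin_le x t A : cut x ^+ q * `|t| ^+ m <= Phin x t A.
Proof.
have [xr|xr] := ltP `|x0 - x| r; last first.
  by rewrite cut_supp// expr0n gtn_eqF//= mul0r.
rewrite /Phin /moser_integrand chi_in// mul1r exprMn -!exprM.
have cb0 : 0 <= cut x ^+ (b * n) by [].
have c1 : cut x ^+ q <= cut x ^+ (b * n).
  have bq : (b * n <= q)%N by rewrite /q mulnC leq_mul2l leqnSn orbT.
  by rewrite ler_wiXn2l ?cut_ge0 ?cut_le1.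
have c2 : cut x ^+ (b * n) <= 1 by have /andP[] := cutX_le1 (b * n) x.
have t0 : 0 <= `|t| ^+ m by rewrite exprn_ge0.
have h : `|t| ^+ m <= 1 + `|t| ^+ (p.+1 * n).
  have [t1|t1] := leP `|t| 1.
    by rewrite (@le_trans _ _ 1)// ?exprn_ile1// lerDl exprn_ge0.
  rewrite (@le_trans _ _ (`|t| ^+ (p.+1 * n)))// ?lerDr//.
  have pm : (m <= p.+1 * n)%N by rewrite /m [(p.+1 * n)%N]mulnC leq_mul2l leqnSn orbT.
  by rewrite ler_weXn2l// ltW.
apply: (@le_trans _ _ (cut x ^+ (b * n) * (1 + `|t| ^+ (p.+1 * n)))); first exact: ler_pM.
by rewrite mulrDr mulr1 lerD2r.
Qed.

Let T : R := a1 * (q%:R * (n`!%:R * (n%:R * L))).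

Let T0 : 0 <= T. Proof. by rewrite !mulr_ge0. Qed.

(* Young's inequality with [a ^+ n = Phix] and [e ^+ n <= Phin]. *)
Let Phib_le x t A : a1 * (q%:R * r * `|Phib x t A|) <= Phix x t A / 2 + (2 * T) ^+ n * Phin x t A.
Proof.
have N0 := Phin_ge0 x t A.
have X0 : 0 <= Phix x t A.
  by rewrite /Phix mulr_ge0 ?exprn_ge0 ?mxsum_ge0// mulr_ge0 // exprn_ge0.
have [xr|xr] := ltP `|x0 - x| r; last first.
  rewrite /Phib det_setrow big1; last by move=> s _; rewrite dcut_supp// mul0r mulr0.
  have D0 : 0 <= (2 * T) ^+ n by rewrite exprn_ge0// mulr_ge0.
  by rewrite mulr0 normr0 !mulr0; apply: addr_ge0; [exact: divr_ge0|exact: mulr_ge0].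
pose a := cut x ^+ b.+1 * `|t| ^+ p * mxsum A.
pose e := cut x ^+ b * `|t| ^+ p.+1.
have a0 : 0 <= a by rewrite /a mulr_ge0 ?mxsum_ge0// mulr_ge0// exprn_ge0.
have e0' : 0 <= e by rewrite /e mulr_ge0// exprn_ge0.
have <- : a ^+ n = Phix x t A.
  by rewrite /a /Phix !exprMn -!exprM [(b.+1 * n)%N]mulnC [(p * n)%N]mulnC.
have eN : e ^+ n <= Phin x t A by rewrite /Phin /moser_integrand chi_in// mul1r lerDr.
apply: (@le_trans _ _ (T * (a ^+ n.-1 * e))); last first.
  apply: le_trans (young_pow n0 a0 e0' T0) _; rewrite lerD2l exprMn.
  by rewrite ler_wpM2l// exprn_ge0// mulr_ge0.
rewrite /T -!mulrA; apply: ler_wpM2l => //; apply: ler_wpM2l => //.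
have -> : a ^+ n.-1 * e = `|t| ^+ m.+1 * cut x ^+ q.-1 * mxsum A ^+ n.-1.
  rewrite /a /e qE mE !exprMn (exprD _ (b.+1 * n.-1)) (exprD _ (p * n.-1)).
  rewrite (exprM _ b.+1) (exprM _ p).
  move: ((cut x ^+ b.+1) ^+ n.-1) ((`|t| ^+ p) ^+ n.-1) (mxsum A ^+ n.-1) (cut x ^+ b)
    (`|t| ^+ p.+1) => A1 A2 A3 A4 A5; ring.
rewrite /Phib 2!normrM normrX [`|cut x ^+ _|]ger0_norm//.
set W := `|t| ^+ m.+1 * cut x ^+ q.-1.
have W0 : 0 <= W by rewrite mulr_ge0// exprn_ge0.
have := det_setrow_le i (dcut^~ x) A n0.
have := ler_wpM2r (det_ge0 A) (sum_dcut_le x).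
move=> h1 h2.
have h3 : `|\det (setrow i (dcut^~ x) A)| <= n`!%:R * (n%:R * (L / r) * mxsum A ^+ n.-1).
  by apply: le_trans h2 _; rewrite ler_wpM2l.
apply: (@le_trans _ _ (r * (W * (n`!%:R * (n%:R * (L / r) * mxsum A ^+ n.-1))))).
  by apply: ler_wpM2l; [exact: ltW|exact: ler_wpM2l].
rewrite le_eqVlt; apply/orP; left; apply/eqP; field; exact: lt0r_neq0.
Qed.

(** The Caccioppoli inequality.  Because the Jacobian has a constant sign,
    [caccioppoli_limit] controls the weighted integral of its absolute value; the
    term with the gradient of the cut-off is then
    absorbed by Young's inequality. *)
Lemma caccioppoli M : 0 <= M -> (forall y, `|x0 - y| <= 2 * r -> `|uval y| <= M) ->
  \int[mu]_x Phix x (uval x) (fun l j => G l j x) <=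
  2 * ((2 * T) ^+ n + a2) * \int[mu]_x Phin x (uval x) (fun l j => G l j x).
Proof.
move=> M0 hM.
have [ia ib hab] := caccioppoli_limit M0 hM.
have [iN _ _] := moser_limit b p.+1 M0 hM.
have [iX _ _] := gradient_limit M0 hM.
pose Pa x := Phia x (uval x) (fun l j => G l j x).
pose Pb x := Phib x (uval x) (fun l j => G l j x).
pose PN x := Phin x (uval x) (fun l j => G l j x).
pose PX x := Phix x (uval x) (fun l j => G l j x).
rewrite -/PX -/PN in ia ib hab iN iX *.
have ina := integrable_norm ia; have inb := integrable_norm ib.
have um x : uval x ^+ m = `|uval x| ^+ m by rewrite -normrX ger0_norm// exprn_even_ge0.
have PaE x : `|Pa x| = cut x ^+ q * `|uval x| ^+ m * `|jac x|.
  by rewrite /Pa /Phia um normrM ger0_norm// mulr_ge0// exprn_ge0.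
have sgn : \int[mu]_x `|Pa x| <= `|\int[mu]_x Pa x|.
  case: jac_sign => sg.
    apply: le_trans (ler_norm _); apply: ae_le_Rintegral => //.
    by apply: filterS sg => x jx; rewrite PaE (ger0_norm jx) /Pa /Phia um.
  rewrite -normrN; apply: le_trans (ler_norm _); rewrite -mulN1r -RintegralZl//.
  apply: ae_le_Rintegral => //; first exact: integrable_realZ.
  by apply: filterS sg => x jx; rewrite PaE (ler0_norm jx) /Pa /Phia um mulrN mulN1r.
have hX : \int[mu]_x PX x <= a1 * \int[mu]_x `|Pa x| + a2 * \int[mu]_x PN x.
  rewrite -!RintegralZl// -RintegralD//; last 2 first.
  - exact: integrable_realZ.
  - exact: integrable_realZ.
  apply: ae_le_Rintegral => //; first by apply: integrable_realD => //; exact: integrable_realZ.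
  apply: filterS jac_bound => x hx; rewrite PaE /PX /Phix.
  have c0 : 0 <= cut x ^+ q * `|uval x| ^+ m by rewrite mulr_ge0// exprn_ge0.
  apply: (@le_trans _ _ (cut x ^+ q * `|uval x| ^+ m * (a1 * `|jac x| + a2))).
    by rewrite ler_wpM2l.
  rewrite mulrDr mulrCA lerD2l mulrC ler_wpM2l//; exact: Phin_le.
have hab2 : \int[mu]_x `|Pa x| <= q%:R * r * \int[mu]_x `|Pb x|.
  apply: le_trans sgn _.
  have IbE : `|\int[mu]_x Pb x| <= \int[mu]_x `|Pb x| by exact: le_normr_Rintegral.
  have -> : \int[mu]_x Pa x = - (q%:R * r / m.+1%:R) * \int[mu]_x Pb x.
    have r00 : r != 0 by exact: lt0r_neq0.
    have m00 : m.+1%:R != 0 :> R by rewrite pnatr_eq0.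
    move: hab m00; move: (\int[mu]_x Pa x) (\int[mu]_x Pb x) (m.+1%:R : R) => Ia Ib y hab y0.
    have -> : Ia = (y / r * Ia) * (r / y) by field; rewrite r00 y0.
    have -> : y / r * Ia = - (q%:R * Ib) by apply/eqP; rewrite -addr_eq0 hab.
    by field.
  rewrite normrM normrN; apply: ler_pM => //.
  have qr0 : 0 <= q%:R * r by rewrite mulr_ge0// ltW.
  rewrite ger0_norm; last by rewrite divr_ge0.
  by rewrite ler_pdivrMr// ler_peMr// ler1n.
have hB : a1 * (q%:R * r * \int[mu]_x `|Pb x|) <= (\int[mu]_x PX x) / 2 + (2 * T) ^+ n * \int[mu]_x PN x.
  rewrite [_ / 2]mulrC -!RintegralZl//; last exact: integrable_realZ.
  rewrite -RintegralD//; last 2 first.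
  - exact: integrable_realZ.
  - exact: integrable_realZ.
  apply: le_Rintegral => //.
  - by do 2 apply: integrable_realZ => //.
  - by apply: integrable_realD => //; exact: integrable_realZ.
  - by move=> x _; rewrite [_ * PX x]mulrC; exact: Phib_le.
have N0 : 0 <= \int[mu]_x PN x by apply: Rintegral_ge0 => x _; exact: Phin_ge0.
have := ler_wpM2l a1_ge0 hab2; move: hB hX.
move: (\int[mu]_x PX x) (\int[mu]_x PN x) (\int[mu]_x `|Pa x|) (\int[mu]_x `|Pb x|) ((2 * T) ^+ n) => X N Ia Ib D; lra.
Qed.

(** * Moser iteration *)

Let V k x := cut x ^+ b.+1 * umol k x ^+ p.+1.
Let dV k j x := cut x ^+ b.+1 * (p.+1%:R * umol k x ^+ p * (gmol k i j x / r)) +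
  umol k x ^+ p.+1 * (b.+1%:R * cut x ^+ b * dcut j x).

Let V_C1 k : C1grad (V k) (dV k).
Proof. exact: C1gradM (C1gradX b.+1 C1grad_cut) (C1gradX p.+1 (C1grad_umol k)). Qed.

Let V_supp k : csupp x0 r (V k).
Proof. by move=> x xr; rewrite /V cut_supp// exprS mul0r mul0r. Qed.

Let dV_supp k j : csupp x0 r (dV k j).
Proof. by move=> x xr; rewrite /dV cut_supp// dcut_supp// exprS !mul0r !mulr0 addr0. Qed.

Let S : R := (b.+1 * p.+1)%:R.

Let S1 : 1 <= S. Proof. by rewrite ler1n. Qed.

Let nL0 : 0 <= n%:R * L. Proof. by rewrite mulr_ge0. Qed.

Let term_le (cx t g d : R) : 0 <= cx ->
  `|cx ^+ b.+1 * (p.+1%:R * t ^+ p * (g / r)) + t ^+ p.+1 * (b.+1%:R * cx ^+ b * d)| <=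
  S / r * (cx ^+ b.+1 * `|t| ^+ p * `|g|) + S * (cx ^+ b * `|t| ^+ p.+1) * `|d|.
Proof.
move=> cx0; have pS : p.+1%:R <= S by rewrite ler_nat leq_pmull.
have bS : b.+1%:R <= S by rewrite ler_nat leq_pmulr.
rewrite (le_trans (ler_normD _ _))//; apply: lerD.
  rewrite !normrM !normrX normfV [`|r|]gtr0_norm// (ger0_norm cx0) [`|p.+1%:R|]ger0_norm//.
  move: pS; move: (p.+1%:R : R) => P pS.
  rewrite [leLHS](_ : _ = P * (cx ^+ b.+1 * `|t| ^+ p * `|g| / r)); last by ring.
  rewrite [leRHS](_ : _ = S * (cx ^+ b.+1 * `|t| ^+ p * `|g| / r)); last by ring.
  by rewrite ler_wpM2r// divr_ge0 ?(ltW r0)// mulr_ge0// mulr_ge0// exprn_ge0.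
rewrite !normrM !normrX (ger0_norm cx0) [`|b.+1%:R|]ger0_norm//.
move: bS; move: (b.+1%:R : R) => P bS.
rewrite [leLHS](_ : _ = P * (cx ^+ b * `|t| ^+ p.+1 * `|d|)); last by ring.
by rewrite -[leRHS]mulrA ler_wpM2r// mulr_ge0// mulr_ge0// exprn_ge0.
Qed.

Let dV_le k x : sumnorm (dV k) x ^+ n <= (2 * S / r) ^+ n *
  (Phix x (umol k x) (fun l j => gmol k l j x) +
   (n%:R * L) ^+ n * Phin x (umol k x) (fun l j => gmol k l j x)).
Proof.
set A := fun l j => gmol k l j x; set t := umol k x.
have N0 := Phin_ge0 x t A.
have X0 : 0 <= Phix x t A.
  by rewrite /Phix mulr_ge0 ?exprn_ge0 ?mxsum_ge0// mulr_ge0 // exprn_ge0.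
have nLn : 0 <= (n%:R * L) ^+ n by rewrite exprn_ge0.
have Sr0 : 0 <= S / r by rewrite divr_ge0// ltW.
have [xr|xr] := ltP `|x0 - x| r; last first.
  rewrite /sumnorm big1; last by move=> j _; rewrite dV_supp// normr0.
  have C0 : 0 <= (2 * S / r) ^+ n by rewrite exprn_ge0// -mulrA mulr_ge0.
  by rewrite expr0n gtn_eqF//= mulr_ge0// addr_ge0// mulr_ge0.
pose a := cut x ^+ b.+1 * `|t| ^+ p * mxsum A.
pose e := cut x ^+ b * `|t| ^+ p.+1.
have ta : 0 <= `|t| ^+ p by rewrite exprn_ge0.
have te : 0 <= `|t| ^+ p.+1 by rewrite exprn_ge0.
have a0 : 0 <= a by rewrite /a mulr_ge0 ?mxsum_ge0// mulr_ge0.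
have e0' : 0 <= e by rewrite /e mulr_ge0.
have aE : a ^+ n = Phix x t A.
  by rewrite /a /Phix !exprMn -!exprM [(b.+1 * n)%N]mulnC [(p * n)%N]mulnC.
have eN : e ^+ n <= Phin x t A by rewrite /Phin /moser_integrand chi_in// mul1r lerDr.
have main : sumnorm (dV k) x <= S / r * (a + n%:R * L * e).
  have h j : `|dV k j x| <= S / r * (cut x ^+ b.+1 * `|t| ^+ p * `|A i j|) + S * e * `|dcut j x|.
    exact: term_le (cut_ge0 x).
  apply: (@le_trans _ _ (\sum_j (S / r * (cut x ^+ b.+1 * `|t| ^+ p * `|A i j|) + S * e * `|dcut j x|))).
    by apply: ler_sum => j _; exact: h.
  rewrite big_split/= -!mulr_sumr mulrDr; apply: lerD.
    by rewrite ler_wpM2l// /a ler_wpM2l ?mulr_ge0// mxsum_row.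
  have S0 : 0 <= S * e by rewrite mulr_ge0// (le_trans ler01).
  apply: le_trans (ler_wpM2l S0 (sum_dcut_le x)) _.
  by rewrite le_eqVlt; apply/orP; left; apply/eqP; ring.
apply: (@le_trans _ _ ((S / r * (a + n%:R * L * e)) ^+ n)).
  by rewrite lerXn2r ?nnegrE ?sumnorm_ge0// mulr_ge0// addr_ge0// mulr_ge0.
rewrite exprMn; have := pow_add_le n a0 (mulr_ge0 nL0 e0').
rewrite aE [(n%:R * L * e) ^+ n]exprMn => h.
have -> : (2 * S / r) ^+ n = (S / r) ^+ n * 2 ^+ n by rewrite -exprMn; congr (_ ^+ _); ring.
rewrite -[leRHS]mulrA.
apply: ler_wpM2l; first exact: exprn_ge0.
apply: le_trans h _; rewrite ler_wpM2l ?exprn_ge0// lerD2l ler_wpM2l//.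
Qed.

Let W k := \int[mu]_x `|V k x| ^+ (3 * n).

Let sobolev_V k : W k <= (9 * r) ^+ (3 * n) * (r ^- n) ^+ 2 * (\int[mu]_x (sumnorm (dV k) x ^+ n)) ^+ 3.
Proof.
have [_ cV cdV] := V_C1 k.
have iV : mu.-integrable setT (EFin \o (fun x => `|V k x| ^+ (3 * n))).
  apply: (@csupp_integrable _ _ x0 r) => //.
    by apply: continuousXf; exact: continuous_normf.
  by move=> x xr; rewrite V_supp// normr0 expr0n gtn_eqF// muln_gt0.
have iS : mu.-integrable setT (EFin \o (fun x => sumnorm (dV k) x ^+ n)).
  apply: (@csupp_integrable _ _ x0 r) => //.
    by apply: continuousXf; exact: continuous_sumnorm.
  move=> x xr; rewrite /sumnorm big1 ?expr0n ?gtn_eqF// => j _.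
  by rewrite dV_supp// normr0.
rewrite -lee_fin /W Rintegral_EFin//; apply: le_trans (sobolev_ineq n0 r0 (V_C1 k) (@V_supp k)) _.
have -> : (\int[mu]_y (sumnorm (dV k) y ^+ n)%:E = (\int[mu]_y (sumnorm (dV k) y ^+ n)%R)%:E)%E.
  by rewrite Rintegral_EFin.
set I := \int[mu]_x _; rewrite [X in (X <= _)%E](_ : _ = ((9 * r) ^+ (3 * n) * (r ^- n * I) ^+ 2 * I)%:E).
  rewrite lee_fin.
  by rewrite le_eqVlt; apply/orP; left; apply/eqP; ring.
by rewrite !EFinM EFin_expe EFinM.
Qed.

Let T1 : R := a1 * (n%:R * (n`!%:R * (n%:R * L))).
Let a4 : R := 2 * ((2 * T1) ^+ n + a2) + (n%:R * L) ^+ n.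

Let a4_ge0 : 0 <= a4.
Proof. by rewrite addr_ge0 ?exprn_ge0// mulr_ge0// addr_ge0// exprn_ge0// !mulr_ge0. Qed.

Let chi_int : \int[mu]_x chi x = (2 * r) ^+ n.
Proof.
rewrite /Rintegral integral_indic// setIT.
by rewrite [X in fine X]lebesgue_cV_ball.
Qed.

(** One step of the iteration.  The Sobolev inequality for
    [cut ^+ b.+1 * u ^+ p.+1], whose gradient is controlled by the Caccioppoli
    inequality, multiplies the power of [u] by three.  It needs a
    differentiable [u], so it is used for the mollifications. *)
Lemma moser_step : r ^- n * \int[mu]_x moser_integrand (3 * b.+1) (3 * p.+1) x (uval x) (fun l j => G l j x) <=
  ((18 ^+ n * a4 + 1) * S ^+ (2 * n) *
    (r ^- n * \int[mu]_x moser_integrand b p.+1 x (uval x) (fun l j => G l j x))) ^+ 3.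
Proof.
have [M M0 hM] := uval_bounded.
have [iN iNk cN] := moser_limit b p.+1 M0 hM.
have [iN' iNk' cN'] := moser_limit (3 * b.+1) (3 * p.+1) M0 hM.
have [iX iXk cX] := gradient_limit M0 hM.
have cac := caccioppoli M0 hM.
pose X := \int[mu]_x Phix x (uval x) (fun l j => G l j x).
pose N := \int[mu]_x Phin x (uval x) (fun l j => G l j x).
pose N' := \int[mu]_x moser_integrand (3 * b.+1) (3 * p.+1) x (uval x) (fun l j => G l j x).
rewrite -/X -/N -/N' in cac cN cN' cX *.
(* The constant of the Sobolev inequality times that of [dV_le]. *)
pose K := (9 * r) ^+ (3 * n) * (r ^- n) ^+ 2 * ((2 * S / r) ^+ n) ^+ 3.
have hk k : \int[mu]_x moser_integrand (3 * b.+1) (3 * p.+1) x (umol k x) (fun l j => gmol k l j x) <=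
    (2 * r) ^+ n + K * (\int[mu]_x Phix x (umol k x) (fun l j => gmol k l j x) +
      (n%:R * L) ^+ n * \int[mu]_x Phin x (umol k x) (fun l j => gmol k l j x)) ^+ 3.
  have Xk0 : 0 <= \int[mu]_x sumnorm (dV k) x ^+ n.
    by apply: Rintegral_ge0 => x _; rewrite exprn_ge0// sumnorm_ge0.
  have [_ cV cdV] := V_C1 k.
  have iV : mu.-integrable setT (EFin \o (fun x => `|V k x| ^+ (3 * n))).
    apply: (@csupp_integrable _ _ x0 r) => //.
      by apply: continuousXf; exact: continuous_normf.
    by move=> x xr; rewrite V_supp// normr0 expr0n gtn_eqF// muln_gt0.
  have iS : mu.-integrable setT (EFin \o (fun x => sumnorm (dV k) x ^+ n)).
    apply: (@csupp_integrable _ _ x0 r) => //.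
      by apply: continuousXf; exact: continuous_sumnorm.
    move=> x xr; rewrite /sumnorm big1 ?expr0n ?gtn_eqF// => j _.
    by rewrite dV_supp// normr0.
  have ichi : mu.-integrable setT (EFin \o chi).
    by apply: integrable_indic_lty => //; rewrite [X in (X < _)%E]lebesgue_cV_ball//; exact: ltry.
  have iXk' := iXk k; have iNk'' := iNk k.
  apply: (@le_trans _ _ ((2 * r) ^+ n + W k)).
    rewrite -chi_int -RintegralD//; apply: le_Rintegral => //; first exact: integrable_realD.
    move=> x _; rewrite /moser_integrand lerD2l /V.
    have -> : `|cut x ^+ b.+1 * umol k x ^+ p.+1| ^+ (3 * n) =
        (cut x ^+ (3 * b.+1) * `|umol k x| ^+ (3 * p.+1)) ^+ n.
      rewrite normrM !normrX (ger0_norm (cut_ge0 x)) exprM; congr (_ ^+ n).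
      by rewrite [(3 * b.+1)%N]mulnC [(3 * p.+1)%N]mulnC !exprM exprMn.
    have h0 : 0 <= cut x ^+ (3 * b.+1) * `|umol k x| ^+ (3 * p.+1) by rewrite mulr_ge0// exprn_ge0.
    by rewrite lerXn2r ?nnegrE ?mulr_ge0// ler_piMl.
  rewrite lerD2l; apply: le_trans (sobolev_V k) _; rewrite /K -[leRHS]mulrA -exprMn.
  have r3 : 0 <= (9 * r) ^+ (3 * n) * (r ^- n) ^+ 2.
    by rewrite mulr_ge0// exprn_ge0// ?mulr_ge0// ?invr_ge0 ?exprn_ge0// ltW.
  apply: ler_wpM2l => //.
  have h2 : \int[mu]_x sumnorm (dV k) x ^+ n <= (2 * S / r) ^+ n *
      (\int[mu]_x Phix x (umol k x) (fun l j => gmol k l j x) +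
       (n%:R * L) ^+ n * \int[mu]_x Phin x (umol k x) (fun l j => gmol k l j x)).
    rewrite -RintegralZl// -RintegralD//; last exact: integrable_realZ.
    rewrite -RintegralZl//; last by apply: integrable_realD => //; exact: integrable_realZ.
    apply: le_Rintegral => //.
      by apply: integrable_realZ => //; apply: integrable_realD => //; exact: integrable_realZ.
  by rewrite lerXn2r ?nnegrE// (le_trans Xk0).
have hlim : N' <= (2 * r) ^+ n + K * (X + (n%:R * L) ^+ n * N) ^+ 3.
  pose xs k := \int[mu]_x Phix x (umol k x) (fun l j => gmol k l j x).
  pose ns k := \int[mu]_x Phin x (umol k x) (fun l j => gmol k l j x).
  have c2 : (2 * r) ^+ n + K * (xs k + (n%:R * L) ^+ n * ns k) ^+ 3 @[k --> \oo] -->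
      (2 * r) ^+ n + K * (X + (n%:R * L) ^+ n * N) ^+ 3.
    apply: cvgD; first exact: cvg_cst.
    apply: cvgM; first exact: cvg_cst.
    by apply: cvg_pow; apply: cvgD => //; apply: cvgM => //; exact: cvg_cst.
  exact: (ler_cvg_to cN' c2 (nearW _ hk)).
have N_ge : (2 * r) ^+ n <= N.
  rewrite -chi_int; apply: le_Rintegral => //.
    apply: integrable_indic_lty => //; rewrite [X in (X < _)%E]lebesgue_cV_ball//; exact: ltry.
  move=> x _; rewrite /Phin /moser_integrand lerDl exprn_ge0// !mulr_ge0// exprn_ge0//.
have N0 : 0 <= N by apply: le_trans N_ge; rewrite exprn_ge0// mulr_ge0// ltW.
have nLn : 0 <= (n%:R * L) ^+ n by rewrite exprn_ge0.
have X0 : 0 <= X.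
  by apply: Rintegral_ge0 => x _; rewrite /Phix mulr_ge0 ?exprn_ge0 ?mxsum_ge0// mulr_ge0// exprn_ge0.
have S0 : 0 <= S by rewrite ler0n.
have Sn1 : 1 <= S ^+ n by rewrite exprn_ege1.
have T10 : 0 <= T1 by rewrite !mulr_ge0.
have hT : (2 * T) ^+ n <= S ^+ n * (2 * T1) ^+ n.
  rewrite -exprMn lerXn2r ?nnegrE ?mulr_ge0//.
  have -> : T = b.+1%:R * T1 by rewrite /T /T1 /q natrM; ring.
  rewrite mulrCA ler_wpM2r ?mulr_ge0// ler_nat leq_pmulr//.
have hX : X + (n%:R * L) ^+ n * N <= S ^+ n * a4 * N.
  have T1n : 0 <= (2 * T1) ^+ n by rewrite exprn_ge0// mulr_ge0.
  apply: (@le_trans _ _ ((2 * ((2 * T) ^+ n + a2) + (n%:R * L) ^+ n) * N)).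
    by rewrite [leRHS]mulrDl lerD2r.
  apply: ler_wpM2r => //; rewrite /a4; move: hT T1n Sn1 nLn a2_ge0.
  move: ((2 * T) ^+ n) ((2 * T1) ^+ n) (S ^+ n) ((n%:R * L) ^+ n) => t t1 s l; nra.
have r00 : r != 0 by exact: lt0r_neq0.
set Y := 18 ^+ n * a4 * S ^+ (2 * n) * (r ^- n * N).
set Z := S ^+ (2 * n) * (r ^- n * N).
have -> : (18 ^+ n * a4 + 1) * S ^+ (2 * n) * (r ^- n * N) = Y + Z by rewrite /Y /Z; ring.
have rho0 : 0 < r ^+ n by rewrite exprn_gt0.
have I1 : 2 ^+ n <= r ^- n * N.
  by rewrite mulrC ler_pdivlMr// -exprMn.
have S2n : 1 <= S ^+ (2 * n) by rewrite exprn_ege1.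
have Z2 : 2 ^+ n <= Z.
  by rewrite (le_trans I1)// /Z ler_peMl// (le_trans _ I1)// exprn_ge0.
have Z1 : 1 <= Z by apply: le_trans Z2; rewrite exprn_ege1// ler1n.
have Y0 : 0 <= Y.
  have In0 : 0 <= r ^- n * N by rewrite (le_trans _ I1)// exprn_ge0.
  have S2n0 : 0 <= S ^+ (2 * n) by rewrite (le_trans ler01).
  have e18 : 0 <= (18 : R) ^+ n by rewrite exprn_ge0.
  by rewrite /Y mulr_ge0// mulr_ge0// mulr_ge0.
have step : r ^- n * (K * (X + (n%:R * L) ^+ n * N) ^+ 3) <= Y ^+ 3.
  have K0 : 0 <= r ^- n * K.
    have r1 : 0 <= r ^- n by rewrite invr_ge0 ltW.
    have r9 : 0 <= 9 * r by rewrite mulr_ge0// ltW.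
    have S2r : 0 <= 2 * S / r by rewrite divr_ge0 ?mulr_ge0// ltW.
    apply: mulr_ge0 => //; apply: mulr_ge0; last by apply/exprn_ge0/exprn_ge0.
    by apply: mulr_ge0; exact: exprn_ge0.
  have hX3 : (X + (n%:R * L) ^+ n * N) ^+ 3 <= (S ^+ n * a4 * N) ^+ 3.
    rewrite lerXn2r ?nnegrE// ?addr_ge0 ?mulr_ge0// exprn_ge0//.
  rewrite mulrA; apply: le_trans (ler_wpM2l K0 hX3) _.
  rewrite le_eqVlt; apply/orP; left; apply/eqP.
  rewrite /K /Y exprMn [(2 * S / r) ^+ n]exprMn [(2 * S) ^+ n]exprMn [r^-1 ^+ n]exprVn.
  have -> : (9 : R) ^+ (3 * n) = (9 ^+ n) ^+ 3 by rewrite mulnC exprM.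
  have -> : r ^+ (3 * n) = (r ^+ n) ^+ 3 by rewrite mulnC exprM.
  have -> : S ^+ (2 * n) = (S ^+ n) ^+ 2 by rewrite mulnC exprM.
  have -> : (18 : R) ^+ n = 9 ^+ n * 2 ^+ n by rewrite -exprMn -natrM.
  move: (9 ^+ n : R) (2 ^+ n : R) (S ^+ n) (lt0r_neq0 rho0); move: (r ^+ n) => rho A9 A2 s rho1.
  by field.
apply: (@le_trans _ _ (r ^- n * ((2 * r) ^+ n + K * (X + (n%:R * L) ^+ n * N) ^+ 3))).
  by rewrite ler_wpM2l// invr_ge0 ltW.
have -> : r ^- n * ((2 * r) ^+ n + K * (X + (n%:R * L) ^+ n * N) ^+ 3) =
  2 ^+ n + r ^- n * (K * (X + (n%:R * L) ^+ n * N) ^+ 3).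
  by rewrite mulrDr exprMn; congr (_ + _); rewrite mulrC mulfK// lt0r_neq0.
apply: (@le_trans _ _ (Z ^+ 3 + Y ^+ 3)).
  by apply: lerD => //; apply: (le_trans Z2); rewrite ler_eXnr.
have Z0 : 0 <= Z by exact: le_trans Z1.
have YZ : 0 <= Y * Z * (Y + Z) by rewrite mulr_ge0 ?addr_ge0// mulr_ge0.
have -> : (Y + Z) ^+ 3 = Z ^+ 3 + Y ^+ 3 + 3 * (Y * Z * (Y + Z)) by ring.
by rewrite lerDl mulr_ge0.
Qed.

End mollified_gradient.

Section sup_estimate.
Context {R : realType} {n : nat} (n0 : (0 < n)%N).
Local Notation E := 'cV[R]_n.
Local Notation mu := (@lebesgue_cV R n).

(** The recursion for the cut-off exponent that [moser_step] imposes; the powers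
    of [u] are [3 ^ k], and the two grow at the same rate. *)
Fixpoint moser_exp (k : nat) : nat := if k is k'.+1 then (3 * (moser_exp k').+1)%N else 0%N.

Lemma moser_expE k : (2 * (moser_exp k).+1).+1 = (3 ^ k.+1)%N.
Proof.
elim: k => [//|k IH]; rewrite expnS -IH /=.
ring.
Qed.

Lemma moser_exp_le k : (moser_exp k <= 2 * 3 ^ k)%N.
Proof.
have h := moser_expE k; rewrite expnS in h.
have : (2 * moser_exp k <= 2 * (2 * 3 ^ k))%N.
  apply: (@leq_trans (3 * 3 ^ k)%N); last by rewrite mulnA leq_mul2r orbT.
  by rewrite -h mulnS; do 3 apply: leqW.
by rewrite leq_mul2l.
Qed.

Lemma moser_expS_le k : ((moser_exp k).+1 * 3 ^ k <= 3 * 9 ^ k)%N.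
Proof.
have -> : (3 * 9 ^ k = 3 ^ k.+1 * 3 ^ k)%N.
  by rewrite expnS -mulnA -expnMn.
rewrite leq_mul2r -moser_expE; apply/orP; right; apply: leqW.
by rewrite mul2n -addnn leq_addr.
Qed.

Lemma odd_pow3 k : odd (3 ^ k). Proof. by rewrite oddX orbT. Qed.

(** Only the rates of growth matter in the limit of the iteration. *)
Lemma geometric_absurd (C q e : R) : 0 < C -> 0 < e -> e < q ->
  (forall k, C * q ^+ (3 ^ k)%N <= e ^+ (3 ^ k)%N) -> False.
Proof.
move=> C0 e0 eq h; have q0 := lt_trans e0 eq.
have z1 : `|e / q| < 1 by rewrite ger0_norm ?divr_ge0 ?ltW// ltr_pdivrMr ?mul1r.
have /cvgr0Pnorm_lt/(_ _ C0)[N _ hN] := cvg_expr z1.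
have := hN (3 ^ N)%N (ltnW (ltn_expl N (isT : 1 < 3)%N)).
rewrite /= ger0_norm ?exprn_ge0 ?divr_ge0 ?ltW// expr_div_n ltr_pdivrMr ?exprn_gt0//.
by rewrite ltNge h.
Qed.

Lemma continuous_at_cutoff {V : normedModType R} (h w : V -> R) (c r : R) N x :
  {for x, continuous h} -> {for x, continuous w} ->
  {for x, continuous (fun y => (h y ^+ 2 * `|(w y - c) / r|) ^+ N)}.
Proof.
move=> ch cw; apply: (cvg_comp _ (fun z : R => z ^+ N)); last exact: exprn_continuous.
apply: cvgM; first by apply: (cvg_comp _ (fun z : R => z ^+ 2) ch); exact: exprn_continuous.
apply: cvg_norm; apply: cvgM; last exact: cvg_cst.
by apply: cvgB => //; exact: cvg_cst.
Qed.

Variables (Omega : set E) (f : 'I_n -> E -> R) (G : 'I_n -> 'I_n -> E -> R) (a1 a2 : R).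
Hypothesis f_locint : forall i, locint (f i).
Hypothesis f_cont : forall i x, Omega x -> {for x, continuous (f i)}.
Hypothesis mG : forall i j, measurable_fun setT (G i j).
Hypothesis iG : forall i j, mu.-integrable setT (EFin \o (fun x => `|G i j x| ^+ n)).
Hypothesis f_grad : forall i j eps x, 0 < eps -> eps <= 1 ->
  [set y : E | `|x - y| <= eps] `<=` Omega -> dmol eps j (f i) x = mol eps (G i j) x.
Hypothesis a1_ge0 : 0 <= a1.
Hypothesis a2_ge0 : 0 <= a2.
Hypothesis jac_sign : {ae mu, forall x, 0 <= \det (\matrix_(l, j) G l j x)} \/
  {ae mu, forall x, \det (\matrix_(l, j) G l j x) <= 0}.
Hypothesis jac_bound : {ae mu, forall x,
  gsum G x ^+ n <= a1 * `|\det (\matrix_(l, j) G l j x)| + a2}.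

(** Moser's argument.  The integrals of the powers [n * 3 ^ k] are at most
    [e ^+ (3 ^ k)] for a fixed [e], so a continuous integrand cannot exceed [e] on
    a neighbourhood of the centre.  The constant does not depend on the cube or
    on [c]. *)
Lemma sup_estimate : exists2 C : R, 0 <= C & forall i c (x0 : E) r, 0 < r ->
  [set y : E | `|x0 - y| <= 2 * r] `<=` Omega ->
  `|f i x0 - c| ^+ n <= C * (r ^+ n + r ^- n * \int[mu]_(x in ball x0 r) (`|f i x - c| ^+ n)).
Proof.
have [L L0 hL] := @kern0_grad_le R n.
pose a4 : R := 2 * ((2 * (a1 * (n%:R * (n`!%:R * (n%:R * L))))) ^+ n + a2) + (n%:R * L) ^+ n.
have a40 : 0 <= a4.
  by rewrite addr_ge0 ?exprn_ge0 ?mulr_ge0// addr_ge0// exprn_ge0// !mulr_ge0.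
pose A : R := (18 ^+ n * a4 + 1) * 9 ^+ n.
pose D : R := 81 ^+ n.
have A1 : 1 <= A.
  rewrite -[leLHS]mulr1; apply: ler_pM => //; last by rewrite exprn_ege1// ler1n.
  by rewrite lerDr mulr_ge0// exprn_ge0.
have D1 : 1 <= D by rewrite exprn_ege1// ler1n.
(* The value of the cut-off at the centre of its cube, the same for all cubes. *)
pose kap : R := kern bump_profile 1 (0 : E).
have kap0 : 0 < kap.
  apply: lt_le_trans (kern0_lb (eps := 1) (z := 0 : E) _); first by rewrite exprn_gt0// expR_gt0.
  by rewrite normr0 divr_gt0.
have AD0 : 0 <= A ^+ 2 * D ^+ 3 by rewrite mulr_ge0// exprn_ge0// (le_trans ler01).
exists (A ^+ 2 * D ^+ 3 / kap ^+ (2 * n) * 2 ^+ n).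
  by rewrite mulr_ge0 ?exprn_ge0// mulr_ge0// invr_ge0 exprn_ge0// ltW.
move=> i c x0 r r0 b2.
have [k0 k0r] := mol_radius_exists r0.
have [M M0 hM] := uval_bounded f_cont i c r0 b2.
pose u := uval f i c r.
pose N b p := \int[mu]_x moser_integrand x0 r b p x (u x) (fun l j => G l j x).
have iN b p : mu.-integrable setT (EFin \o (fun x => moser_integrand x0 r b p x (u x) (fun l j => G l j x))).
  by have [] := moser_limit n0 f_locint f_cont mG iG f_grad r0 k0r b2 b p M0 hM.
pose J k := r ^- n * N (moser_exp k) (3 ^ k)%N.
have rn0 : 0 <= r ^- n by rewrite invr_ge0 exprn_ge0// ltW.
have mi_ge0 b p x t B : 0 <= moser_integrand x0 r b p x t B.
  rewrite /moser_integrand addr_ge0 ?indicE// exprn_ge0// mulr_ge0// mulr_ge0 ?exprn_ge0//.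
  exact: cut_ge0.
have J0 k : 0 <= J k by rewrite mulr_ge0//; apply: Rintegral_ge0 => x _.
have stepJ k : J k.+1 <= (A * D ^+ k * J k) ^+ 3.
  have p3 : (0 < 3 ^ k)%N by rewrite expn_gt0.
  have sgn : {ae mu, forall x, 0 <= \det (setrow i ((G i)^~ x) (fun l => (G l)^~ x))} \/
      {ae mu, forall x, \det (setrow i ((G i)^~ x) (fun l => (G l)^~ x)) <= 0}.
    by case: jac_sign => h; [left|right]; apply: filterS h => x; rewrite (setrow_id i (fun l j => G l j x)).
  have bd : {ae mu, forall x, gsum G x ^+ n <=
      a1 * `|\det (setrow i ((G i)^~ x) (fun l => (G l)^~ x))| + a2}.
    by apply: filterS jac_bound => x; rewrite (setrow_id i (fun l j => G l j x)).
  have ev : ~~ odd (n * (3 ^ k).-1).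
    have : odd (3 ^ k).-1.+1 by rewrite prednK// odd_pow3.
    by rewrite oddM negb_and oddS => ->; rewrite orbT.
  have := @moser_step R n n0 Omega f G f_locint f_cont mG iG f_grad i c x0 r k0 r0 k0r b2 a1 a2 L
    a1_ge0 a2_ge0 L0 hL sgn bd (moser_exp k) (3 ^ k).-1 ev.
  rewrite prednK// -expnS -/a4 => h.
  apply: le_trans h _.
  have S0 : 0 <= 18 ^+ n * a4 + 1 by rewrite addr_ge0// mulr_ge0// exprn_ge0.
  rewrite lerXn2r ?nnegrE//.
  - by rewrite mulr_ge0 ?J0// mulr_ge0// exprn_ge0.
  - by rewrite mulr_ge0 ?J0// mulr_ge0// ?exprn_ge0// (le_trans ler01).
  rewrite ler_wpM2r ?J0// /A -[leRHS]mulrA ler_wpM2l//.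
  apply: (@le_trans _ _ ((3 * 9 ^ k)%:R ^+ (2 * n))).
    by rewrite lerXn2r ?nnegrE// ler_nat moser_expS_le.
  rewrite exprM (_ : (3 * 9 ^ k)%:R ^+ 2 = 9 * 81 ^+ k :> R).
    by rewrite exprMn /D -!exprM mulnC.
  have e2 : ((3 * 9 ^ k) ^ 2 = 9 * 81 ^ k)%N by rewrite expnMn -expnM [(k * 2)%N]mulnC expnM.
  by rewrite -natrX e2 natrM natrX.
have iter := moser_iteration A1 D1 J0 stepJ.
have mb : measurable (ball x0 r : set E) by exact: measurable_ball_cV.
have ichi : mu.-integrable setT (EFin \o (\1_(ball x0 r : set E) : E -> R)).
  by apply: integrable_indic_lty => //; rewrite [X in (X < _)%E]lebesgue_cV_ball//; exact: ltry.
have uE x : `|u x| ^+ n = r ^- n * `|f i x - c| ^+ n.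
  by rewrite /u /uval normrM normfV [`|r|]gtr0_norm// exprMn exprVn mulrC.
(* The iteration starts from the mean of [|u| ^+ n]. *)
have N00 : J 0 = 2 ^+ n + r ^- n * (r ^- n * \int[mu]_(x in ball x0 r) (`|f i x - c| ^+ n)).
  pose h x := (\1_(ball x0 r : set E) x * `|u x|) ^+ n.
  have e0 x : moser_integrand x0 r 0 1 x (u x) (fun l j => G l j x) = \1_(ball x0 r : set E) x + h x.
    by rewrite /moser_integrand expr0 mul1r expr1.
  have ih : mu.-integrable setT (EFin \o h).
    have := integrable_realB measurableT (iN 0%N 1%N) ichi; apply: eq_integrable => // x _ /=.
    by rewrite e0 addrC addKr.
  have hE x : h x = ((fun x => `|u x| ^+ n) \_ (ball x0 r : set E)) x.
    rewrite /h patchE indicE; case: (_ \in _); first by rewrite mul1r.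
    by rewrite mul0r expr0n gtn_eqF.
  have iu : mu.-integrable (ball x0 r : set E) (EFin \o (fun x => `|u x| ^+ n)).
    apply/(integrable_mkcond _ mb); apply: eq_integrable ih => // x _ /=.
    by rewrite hE !patchE; case: ifP.
  have ifc : mu.-integrable (ball x0 r : set E) (EFin \o (fun x => `|f i x - c| ^+ n)).
    have := integrable_realZ mb (r ^+ n) iu; apply: eq_integrable => // x _ /=.
    by rewrite uE mulrA mulfV ?mul1r// expf_neq0// gt_eqF.
  have eI : N 0%N 1%N = \int[mu]_x (\1_(ball x0 r : set E) x + h x).
    by apply: eq_Rintegral => x _; exact: e0.
  rewrite /J expn0 /= eI.
  rewrite RintegralD// mulrDr; congr (_ + _).
    rewrite /Rintegral integral_indic// setIT [X in fine X]lebesgue_cV_ball//=.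
    by rewrite exprMn mulrCA mulVf ?mulr1// expf_neq0// gt_eqF.
  congr (_ * _); rewrite -RintegralZl// [RHS]Rintegral_mkcond; apply: eq_Rintegral => x _.
  by rewrite hE !patchE; case: ifP => // _; rewrite uE.
pose g x : R := cut x0 r x ^+ 2 * `|u x|.
have J00 : 1 <= J 0.
  rewrite N00 -[leLHS]addr0 lerD ?exprn_ege1 ?ler1n// mulr_ge0// mulr_ge0//.
  by apply: Rintegral_ge0 => x _; rewrite exprn_ge0.
have g0 x : 0 <= g x by rewrite /g mulr_ge0// exprn_ge0// cut_ge0.
have main : g x0 ^+ n <= A ^+ 2 * D ^+ 3 * J 0.
  rewrite leNgt; apply/negP; set e := A ^+ 2 * D ^+ 3 * J 0 => lt.
  have e0 : 0 < e.
    by rewrite /e mulr_gt0 ?(lt_le_trans ltr01 J00)// mulr_gt0// exprn_gt0// (lt_le_trans ltr01).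
  (* [g ^+ n] exceeds [q > e] near [x0], so that [J k] is at least a fixed multiple
     of [q ^+ (3 ^ k)]. *)
  pose q := (e + g x0 ^+ n) / 2.
  have eq : e < q by rewrite /q; lra.
  have cg : {for x0, continuous (fun x => g x ^+ n)}.
    apply: continuous_at_cutoff.
      by have [_ cc _] := C1grad_cut x0 r; exact: cc.
    by apply: f_cont; apply: b2; rewrite /= subrr normr0 mulr_ge0// ltW.
  have d0 : 0 < g x0 ^+ n - q by rewrite /q; lra.
  have [s0 s00 hs] := continuous_at_ball cg d0.
  pose s := Num.min s0 r.
  have s_gt0 : 0 < s by rewrite lt_min s00.
  have mbs : measurable (ball x0 s : set E) by exact: measurable_ball_cV.
  have q0 : 0 <= q by rewrite ltW// (lt_trans e0).
  apply: (@geometric_absurd (r ^- n * (2 * s) ^+ n) q e) => //.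
    by rewrite mulr_gt0// ?invr_gt0 exprn_gt0// mulr_gt0.
  move=> k; apply: le_trans (iter k); rewrite /J -mulrA ler_wpM2l//.
  have is_ : mu.-integrable setT (EFin \o (\1_(ball x0 s : set E) : E -> R)).
    by apply: integrable_indic_lty => //; rewrite [X in (X < _)%E]lebesgue_cV_ball//; exact: ltry.
  have <- : \int[mu]_x (q ^+ (3 ^ k)%N * \1_(ball x0 s : set E) x) = (2 * s) ^+ n * q ^+ (3 ^ k)%N.
    rewrite RintegralZl// mulrC; congr (_ * _).
    by rewrite /Rintegral integral_indic// setIT [X in fine X]lebesgue_cV_ball.
  apply: le_Rintegral => //; first exact: integrable_realZ.
  move=> x _; rewrite [\1_(ball x0 s) x]indicE; have [/set_mem/ball_normP xs|_] := boolP (_ \in _); last first.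
    by rewrite mulr0.
  have xr : `|x0 - x| < r by rewrite (lt_le_trans xs)// ge_min lexx orbT.
  have xs0 : `|x0 - x| < s0 by rewrite (lt_le_trans xs)// ge_min lexx.
  have gq : q <= g x ^+ n.
    by have := hs x xs0; rewrite ler_norml => /andP[_]; rewrite lerBlDr; lra.
  rewrite mulr1; apply: (@le_trans _ _ ((g x ^+ n) ^+ (3 ^ k)%N)).
    by rewrite lerXn2r ?nnegrE// exprn_ge0.
  have xB : x \in (ball x0 r : set E) by apply/mem_set/ball_normP.
  rewrite /moser_integrand indicE xB mul1r -exprM mulnC exprM.
  apply: (@le_trans _ _ ((cut x0 r x ^+ moser_exp k * `|u x| ^+ (3 ^ k)) ^+ n)); last by rewrite lerDr.
  have p30 : 0 <= `|u x| ^+ (3 ^ k) by rewrite exprn_ge0.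
  have ce k' : 0 <= cut x0 r x ^+ k' by rewrite exprn_ge0// cut_ge0.
  have l0 : 0 <= g x ^+ (3 ^ k) by rewrite exprn_ge0.
  have l1 : 0 <= cut x0 r x ^+ moser_exp k * `|u x| ^+ (3 ^ k) by rewrite mulr_ge0.
  rewrite lerXn2r ?nnegrE//.
  rewrite /g exprMn -exprM ler_wpM2r// ler_wiXn2l ?cut_ge0 ?cut_le1//.
  exact: moser_exp_le.
have gx0 : g x0 = kap ^+ 2 * `|u x0|.
  rewrite /g /cut subrr; congr (_ ^+ 2 * _); apply: eq_bigr => l _.
  by rewrite !mxE !mul0r.
have kapn : 0 < kap ^+ (2 * n) by rewrite exprn_gt0.
have I0 : 0 <= r ^- n * (r ^- n * \int[mu]_(x in ball x0 r) (`|f i x - c| ^+ n)).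
  by rewrite mulr_ge0// mulr_ge0//; apply: Rintegral_ge0 => x _; rewrite exprn_ge0.
move: main; rewrite gx0 exprMn -exprM uE N00 => main.
have h : kap ^+ (2 * n) * (r ^- n * `|f i x0 - c| ^+ n) <= A ^+ 2 * D ^+ 3 * (2 ^+ n *
    (1 + r ^- n * (r ^- n * \int[mu]_(x in ball x0 r) (`|f i x - c| ^+ n)))).
  apply: le_trans main _; rewrite ler_wpM2l// mulrDr mulr1 lerD2l ler_peMl//.
  by rewrite exprn_ege1// ler1n.
have rn : 0 < r ^+ n by rewrite exprn_gt0.
move: h; move: (\int[mu]_(x in ball x0 r) _) (`|f i x0 - c| ^+ n) (lt0r_neq0 rn) kapn.
move: (r ^+ n) rn (A ^+ 2 * D ^+ 3) (2 ^+ n : R) (kap ^+ (2 * n)) => rho rho0 AD t K I F rho1 K0 h.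
have K1 := lt0r_neq0 K0.
have -> : F = K * (rho^-1 * F) * (rho / K) by field; rewrite K1.
apply: le_trans (ler_wpM2r _ h) _; first by rewrite divr_ge0// ltW.
by rewrite le_eqVlt; apply/orP; left; apply/eqP; field; rewrite rho1 K1.
Qed.

End sup_estimate.

(** * Differentiability in the mean *)

Section mean_differentiability.
Context {R : realType} {n : nat} (n0 : (0 < n)%N).
Local Notation E := 'cV[R]_n.
Local Notation mu := (@lebesgue_cV R n).

Definition lin (a : 'I_n -> R) (y : E) : R := \sum_j a j * y j ord0.

Lemma linD a x y : lin a (x + y) = lin a x + lin a y.
Proof. by rewrite /lin -big_split/=; apply: eq_bigr => j _; rewrite mxE mulrDr. Qed.

Lemma linZ a t x : lin a (t *: x) = t * lin a x.
Proof. by rewrite /lin mulr_sumr; apply: eq_bigr => j _; rewrite mxE mulrCA. Qed.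

Lemma linN a x : lin (fun j => - a j) x = - lin a x.
Proof. by rewrite /lin -sumrN; apply: eq_bigr => j _; rewrite mulNr. Qed.

Lemma linB a x y : lin a (x - y) = lin a x - lin a y.
Proof. by rewrite linD -scaleN1r linZ mulN1r. Qed.

Lemma lin_le a M v : (forall j, `|a j| <= M) -> `|lin a v| <= n%:R * M * `|v|.
Proof. exact: sum_coord_le. Qed.

Lemma C1grad_lin a : C1grad (lin a) (fun j _ => a j).
Proof.
split => [x v||j]; last exact: cst_continuous.
  apply: (@is_derive_of_taylor _ _ _ _ _ _ 0) => h.
  rewrite linD linZ -/(lin a v) [X in `|X|](_ : _ = 0) ?normr0 ?mul0r//; ring.
apply: (@lipschitz_cts _ _ _ (n%:R * \sum_j `|a j|)) => x v.
rewrite linD addrAC subrr add0r; apply: lin_le => j.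
by rewrite (bigD1 j)//= lerDl sumr_ge0.
Qed.

Lemma leb_pt_sum (I : Type) (s : seq I) (g : I -> E -> R) N x : (0 < N)%N ->
  (forall i, measurable_fun setT (g i)) -> (forall i, leb_pt N (g i) x) ->
  forall e, 0 < e -> \forall r \near 0^'+,
    (\int[mu]_(y in ball x r) ((\sum_(i <- s) `|g i y - g i x|) ^+ N)%:E <= (e * r ^+ n)%:E)%E.
Proof.
move=> N0 mg gx; elim: s => [|i s IH] e e0.
  near=> r; have r0 : 0 < r by near: r; exact: nbhs_right_gt.
  under eq_integral do rewrite big_nil expr0n gtn_eqF//.
  by rewrite integral0 lee_fin mulr_ge0 ?exprn_ge0// ltW.
have e' : 0 < e / 2 / 2 ^+ N by rewrite !divr_gt0// exprn_gt0.
near=> r; have r0 : 0 < r by near: r; exact: nbhs_right_gt.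
have h1 : (\int[mu]_(y in ball x r) (`|g i y - g i x| ^+ N)%:E <= (e / 2 / 2 ^+ N * r ^+ n)%:E)%E.
  by near: r; exact: gx.
have h2 : (\int[mu]_(y in ball x r) ((\sum_(i <- s) `|g i y - g i x|) ^+ N)%:E <= (e / 2 / 2 ^+ N * r ^+ n)%:E)%E.
  by near: r; exact: IH.
have mb : measurable (ball x r : set E) by exact: measurable_ball_cV.
have m1 j : measurable_fun setT (fun y => `|g j y - g j x|).
  by apply: measurableT_comp => //; exact: measurable_funB.
have m2 : measurable_fun setT (fun y => \sum_(i <- s) `|g i y - g i x|) by exact: measurable_sum.
have mm1 : measurable_fun (ball x r : set E) (fun y => (`|g i y - g i x| ^+ N)%:E).
  by apply/measurable_EFinP; apply: measurable_funTS; exact: measurable_funX.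
have mm2 : measurable_fun (ball x r : set E) (fun y => ((\sum_(i <- s) `|g i y - g i x|) ^+ N)%:E).
  by apply/measurable_EFinP; apply: measurable_funTS; exact: measurable_funX.
have s0 y : 0 <= \sum_(i <- s) `|g i y - g i x| by exact: sumr_ge0.
apply: (@le_trans _ _ (\int[mu]_(y in ball x r) ((2 ^+ N)%:E *
   ((`|g i y - g i x| ^+ N)%:E + ((\sum_(i <- s) `|g i y - g i x|) ^+ N)%:E)))%E).
  apply: ge0_le_integral => //.
  - by move=> y _; rewrite lee_fin exprn_ge0// big_cons addr_ge0.
  - apply/measurable_EFinP; apply: measurable_funTS; apply: measurable_funX.
    by under eq_fun do rewrite big_cons; exact: measurable_funD.
  - by apply: emeasurable_funM => //; exact: emeasurable_funD.
  - by move=> y _; rewrite -EFinD -EFinM lee_fin big_cons; exact: pow_add_le.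
rewrite ge0_integralZl//; last 2 first.
- exact: emeasurable_funD.
- by move=> y _; rewrite -EFinD lee_fin addr_ge0// exprn_ge0.
rewrite ge0_integralD//; last by move=> y _; rewrite lee_fin exprn_ge0.
apply: (@le_trans _ _ ((2 ^+ N)%:E * ((e / 2 / 2 ^+ N * r ^+ n)%:E + (e / 2 / 2 ^+ N * r ^+ n)%:E))%E).
  by rewrite lee_wpmul2l ?lee_fin ?exprn_ge0// leeD.
rewrite -EFinD -EFinM lee_fin le_eqVlt; apply/orP; left; apply/eqP.
by field; rewrite expf_neq0.
Unshelve. all: by end_near. Qed.

(** Mean values over cubes centred at [x] are controlled at all scales below
    [r].  If [eps <= s] the mollification is bounded on average by the values in a
    cube of twice the size, and otherwise pointwise by a mean over a cube of
    radius comparable to [eps]. *)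
Lemma mol_leb_bound (H : E -> \bar R) (x : E) r e s eps : measurable_fun setT H ->
  (forall y, (0 <= H y)%E) -> 0 <= e ->
  (forall t, 0 < t <= 2 * r -> (\int[mu]_(y in ball x t) H y <= (e * t ^+ n)%:E)%E) ->
  0 < s <= r -> 0 < eps <= r ->
  (\int[mu]_(z in ball x s) \int[mu]_y ((mker eps (y - z))%:E * H y) <=
    (expR 2 ^+ n * 4 ^+ n * e * s ^+ n)%:E)%E.
Proof.
move=> mH H0 e0 hH /andP[s0 sr] /andP[ep0 epr].
have mb z t : measurable (ball z t : set E) by exact: measurable_ball_cV.
have ex1 : 1 <= expR 2 ^+ n :> R by rewrite exprn_ege1// -expR0 ler_expR.
have [es|es] := leP eps s.
  apply: le_trans (mker_tonelli_on (D' := ball x (2 * s) : set E) ep0 (mb x s) _ _ mH H0) _.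
  - exact: mb.
  - move=> z y /ball_normP zx yz; apply/ball_normP.
    by have := ler_distD z x y; rewrite (distrC z y); lra.
  have s2 : 0 < 2 * s <= 2 * r by rewrite mulr_gt0//= ler_wpM2l.
  apply: le_trans (hH _ s2) _; rewrite lee_fin exprMn.
  have c : 2 ^+ n <= expR 2 ^+ n * 4 ^+ n :> R.
    by rewrite -[leLHS]mul1r ler_pM ?exprn_ge0// lerXn2r ?nnegrE// ler_nat.
  rewrite mulrCA mulrA; apply: ler_wpM2r; first by rewrite exprn_ge0// ltW.
  by rewrite ler_wpM2r.
apply: (@le_trans _ _ (\int[mu]_(z in ball x s) (expR 2 ^+ n * 2 ^+ n * e)%:E)%E).
  apply: ge0_le_integral => //.
  - by move=> z _; apply: integral_ge0 => y _; rewrite mule_ge0// lee_fin mker_ge0.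
  - by apply: measurable_funTS; exact: measurable_mker_int.
  move=> z /ball_normP zx; apply: le_trans (mker_int_le z ep0 mH H0) _.
  have e2 : 0 < 2 * eps <= 2 * r by rewrite mulr_gt0//= ler_wpM2l.
  have B0 : 0 <= expR 2 ^+ n * eps ^- n.
    by rewrite mulr_ge0 ?invr_ge0 ?exprn_ge0 ?expR_ge0// ltW.
  apply: (@le_trans _ _ ((expR 2 ^+ n * eps ^- n)%:E * (e * (2 * eps) ^+ n)%:E)%E).
    apply: lee_wpmul2l; first by rewrite lee_fin.
    apply: le_trans (hH _ e2); apply: ge0_subset_integral => //.
    - exact: measurable_funTS.
    - move=> y /ball_normP yz; apply/ball_normP.
      by have := ler_distD z x y; lra.
  rewrite -EFinM lee_fin le_eqVlt; apply/orP; left; apply/eqP; rewrite exprMn.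
  field; by rewrite expf_neq0// gt_eqF.
rewrite integral_cst// [X in (_ * X)%E]lebesgue_cV_ball// -EFinM lee_fin exprMn.
have -> : (4 : R) ^+ n = 2 ^+ n * 2 ^+ n by rewrite -exprMn -natrM.
by rewrite le_eqVlt; apply/orP; left; apply/eqP; ring.
Qed.

Variables (Omega : set E) (f : 'I_n -> E -> R) (G : 'I_n -> 'I_n -> E -> R).
Hypothesis f_locint : forall i, locint (f i).
Hypothesis f_cont : forall i x, Omega x -> {for x, continuous (f i)}.
Hypothesis mG : forall i j, measurable_fun setT (G i j).
Hypothesis iG : forall i j, mu.-integrable setT (EFin \o (fun x => `|G i j x| ^+ n)).
Hypothesis f_grad : forall i j eps x, 0 < eps -> eps <= 1 ->
  [set y : E | `|x - y| <= eps] `<=` Omega -> dmol eps j (f i) x = mol eps (G i j) x.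

(** Apply [ray_ineq] to the mollification of [f i] minus the linear part: its
    gradient is the mollification of [G i] minus the value at [x], which is small
    in the mean at every scale because [x] is a Lebesgue point. *)
Lemma mean_differentiable x d i : 0 < d -> [set y : E | `|x - y| <= d] `<=` Omega ->
  (forall j, leb_pt n (G i j) x) -> forall e, 0 < e -> \forall r \near 0^'+,
  (\int[mu]_(y in ball x r)
    (`|f i y - f i x - lin (fun j => G i j x) (y - x)| ^+ n)%:E <= (e * r ^+ (2 * n))%:E)%E.
Proof.
move=> d0 dO Gx e e0.
pose a j := G i j x.
pose h y := \sum_j `|G i j y - G i j x|.
have mh : measurable_fun setT h.
  by apply: measurable_sum => j; apply: measurableT_comp => //; exact: measurable_funB.
have h0 y : 0 <= h y by exact: sumr_ge0.
pose C0 : R := expR 2 ^+ n * 4 ^+ n.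
have C00 : 0 < C0 by rewrite mulr_gt0 ?exprn_gt0// expR_gt0.
have e' : 0 < e / C0 by rewrite divr_gt0.
have [t0 /= t00 ht] := @leb_pt_sum _ (index_enum _) (G i) n x n0 (mG i) Gx _ e'.
near=> r; have r0 : 0 < r by near: r; exact: nbhs_right_gt.
have rt : 2 * r < t0.
  by rewrite mulrC -ltr_pdivlMr//; near: r; apply: nbhs_right_lt; rewrite divr_gt0.
have rd : 2 * r < d.
  by rewrite mulrC -ltr_pdivlMr//; near: r; apply: nbhs_right_lt; rewrite divr_gt0.
have hH t : 0 < t <= 2 * r -> (\int[mu]_(y in ball x t) (h y ^+ n)%:E <= (e / C0 * t ^+ n)%:E)%E.
  move=> /andP[tt t2]; apply: ht => //; rewrite /ball/= sub0r normrN gtr0_norm//.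
  exact: le_lt_trans rt.
have mb : measurable (ball x r : set E) by exact: measurable_ball_cV.
have [k0 k0r] := mol_radius_exists r0.
(* The radii start below [r], so that the supports of the kernels stay in [Omega]. *)
pose u k y := mol (mol_radius (k + k0)) (f i) y + lin (fun j => - a j) y.
have er0 k : 0 < mol_radius (k + k0) :> R by exact: mol_radius_gt0.
have er1 k : mol_radius (k + k0) <= 1 :> R by exact: mol_radius_le1.
have err k : mol_radius (k + k0) <= r.
  by apply: ltW; apply: le_lt_trans k0r; apply: mol_radius_anti; rewrite leq_addl.
pose g k j y := dmol (mol_radius (k + k0)) j (f i) y + - a j.
have uC1 k : C1grad (u k) (g k).
  exact: C1gradD (C1grad_mol (er0 k) (er1 k) (f_locint i)) (C1grad_lin (fun j => - a j)).
have mH : measurable_fun setT (fun y => (h y ^+ n)%:E).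
  by apply/measurable_EFinP; exact: measurable_funX.
have hl : locint h.
  apply: locint_sum => j; apply: locint_norm; apply: locintD; last exact: locint_cst.
  exact: locint_pow (iG i j).
have bound k s : 0 < s <= r -> (\int[mu]_(y in ball x s) (sumnorm (g k) y ^+ n)%:E <= (e * s ^+ n)%:E)%E.
  move=> s01; have /andP[s0 sr] := s01.
  have -> : e = expR 2 ^+ n * 4 ^+ n * (e / C0) by rewrite mulrC divfK// gt_eqF.
  have ek : 0 < (mol_radius (k + k0) : R) <= r by apply/andP; split; [exact: er0|exact: err].
  apply: le_trans (mol_leb_bound mH _ (ltW e') hH s01 ek); last by move=> y; rewrite lee_fin exprn_ge0.
  apply: ge0_le_integral => //.
  - exact: measurable_ball_cV.
  - by move=> y _; rewrite lee_fin exprn_ge0// sumnorm_ge0.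
  - apply/measurable_EFinP; apply: measurable_funTS; apply: measurable_funX.
    by apply: continuous_measurable_cV; apply: continuous_sumnorm; have [_ _] := uC1 k.
  - apply: measurable_funTS; apply: measurable_mker_int => // y.
    by rewrite lee_fin exprn_ge0.
  move=> y /ball_normP yx.
  have gE j : g k j y = mol (mol_radius (k + k0)) (fun z => G i j z - a j) y.
    rewrite mol_subc//; last exact: locint_pow (iG i j).
    congr (_ - _); apply: f_grad => // z /= zy; apply: dO => /=.
    have := ler_distD y x z; have := err k; move: zy yx sr rd; lra.
  have le1 : sumnorm (g k) y <= mol (mol_radius (k + k0)) h y.
    rewrite mol_sum//; last first.
      move=> j; apply: locint_norm; apply: locintD; last exact: locint_cst.
      exact: locint_pow (iG i j).
    apply: ler_sum => j _; rewrite gE; apply: mol_norm_le => //.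
    apply: locintD; last exact: locint_cst.
    exact: locint_pow (iG i j).
  apply: (@le_trans _ _ (`|mol (mol_radius (k + k0)) h y| ^+ n)%:E).
    by rewrite lee_fin lerXn2r ?nnegrE ?sumnorm_ge0//; apply: le_trans le1 _; exact: ler_norm.
  apply: le_trans (mol_pow_le y n0 (er0 k) (er1 k) hl) _.
  rewrite le_eqVlt; apply/orP; left; apply/eqP/eq_integral => z _.
  by rewrite ger0_norm.
have ray k : (\int[mu]_(y in ball x r) (`|u k y - u k x| ^+ n)%:E <= (e * r ^+ (2 * n))%:E)%E.
  apply: le_trans (ray_ineq n0 r0 (uC1 k) (bound k)) _.
  by rewrite lee_fin mulrCA -exprD addnn -mul2n.
have mf : measurable_fun setT (f i) by case: (f_locint i) => ? [].
have mlin b : measurable_fun setT (lin b).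
  by have [_ cl _] := C1grad_lin b; exact: continuous_measurable_cV.
apply: (@fatou_le _ _ _ mu (ball x r : set E) (fun k y => (`|u k y - u k x| ^+ n)%:E)) => //.
- move=> k; apply/measurable_EFinP; apply: measurable_funTS; apply: measurable_funX.
  apply: measurableT_comp => //; apply: measurable_funB => //.
  by have [_ cu _] := uC1 k; exact: continuous_measurable_cV.
- apply: aeW => y /ball_normP yx; apply: cvg_EFinr.
  apply: cvg_pow; apply: cvg_norm.
  have cf z : Omega z -> mol (mol_radius (k + k0)) (f i) z @[k --> \oo] --> f i z.
    move=> zO; apply: (cvg_comp (fun k => (k + k0)%N) (fun k => mol (mol_radius k) (f i) z)).
      exact: cvg_addnr.
    apply: (@mol_cvg _ _ _ 1) => //; apply: leb_pt_continuous => //; exact: f_cont.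
  have -> : f i y - f i x - lin a (y - x) = (f i y + lin (fun j => - a j) y) - (f i x + lin (fun j => - a j) x).
    by rewrite linB !linN; ring.
  have xO : Omega x by apply: dO; rewrite /= subrr normr0 ltW.
  have yO : Omega y.
    by apply: dO => /=; apply: ltW; apply: lt_trans rd; apply: (lt_trans yx); rewrite ltr_pMl// ltr1n.
  by apply: cvgB; (apply: cvgD; first exact: cf); exact: cvg_cst.
- apply/measurable_EFinP; apply: measurable_funTS; apply: measurable_funX; apply: measurableT_comp => //.
  apply: measurable_funB; first exact: measurable_funB.
  by apply: (measurable_translate (- x) (h := lin a)).
- by near=> k; exact: ray.
Unshelve. all: by end_near. Qed.

End mean_differentiability.

(** * From differentiability in the mean to differentiability at a point *)

Section pointwise_differentiability.
Context {R : realType} {n : nat} (n0 : (0 < n)%N).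
Local Notation E := 'cV[R]_n.
Local Notation mu := (@lebesgue_cV R n).

Lemma Rintegral_le_bound (D : set E) (h : E -> R) (C : R) : (forall x, 0 <= h x) ->
  (\int[mu]_(x in D) (h x)%:E <= C%:E)%E -> \int[mu]_(x in D) h x <= C.
Proof.
move=> h0 hC; rewrite -lee_fin /Rintegral fineK//.
rewrite ge0_fin_numE; first exact: le_lt_trans hC (ltry C).
by apply: integral_ge0 => x _; rewrite lee_fin.
Qed.

(** The free parameter [t] is the ratio between the radius of the cube around
    [x + h] and [|h|]: it is chosen first, to make [t ^+ n] small, and [e1] after it,
    to beat [t ^- n]. *)
Lemma exponent_choice (C Q e : R) : 0 <= C -> 0 <= Q -> 0 < e -> exists t e1 : R,
  [/\ 0 < t <= 1, 0 < e1 & C * (t ^+ n * Q + 8 ^+ n * e1 * t ^- n) <= e ^+ n].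
Proof.
move=> C0 Q0 e0; have en : 0 < e ^+ n by rewrite exprn_gt0.
have CQ : 0 <= C * Q by rewrite mulr_ge0.
pose s := e ^+ n / (2 * (C * Q + 1)).
have s0 : 0 < s by rewrite divr_gt0// mulr_gt0// ltr_wpDl.
pose t := Num.min 1 s.
have t0 : 0 < t by rewrite lt_min ltr01.
have t1 : t <= 1 by rewrite ge_min lexx.
have tn : 0 < t ^+ n by rewrite exprn_gt0.
have tt : t ^+ n <= s.
  apply: (@le_trans _ _ t); last by rewrite ge_min lexx orbT.
  by rewrite -[leRHS]expr1 ler_wiXn2l// ltW.
have e8 : 0 < (8 : R) ^+ n by rewrite exprn_gt0.
have C1 : 0 < C + 1 by rewrite ltr_wpDl.
exists t, (e ^+ n / 2 * t ^+ n / (8 ^+ n * (C + 1))); split; first by rewrite t0.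
  by rewrite !(divr_gt0, mulr_gt0).
have h1 : C * (t ^+ n * Q) <= e ^+ n / 2.
  rewrite mulrCA mulrC; apply: (@le_trans _ _ (C * Q * s)); first by rewrite ler_wpM2l.
  rewrite /s mulrA ler_pdivrMr; last by rewrite mulr_gt0// ltr_wpDl.
  by have := en; nra.
have -> : C * (t ^+ n * Q + 8 ^+ n * (e ^+ n / 2 * t ^+ n / (8 ^+ n * (C + 1))) / t ^+ n) =
    C * (t ^+ n * Q) + e ^+ n / 2 * (C / (C + 1)).
  move: (t ^+ n) (e ^+ n) ((8 : R) ^+ n) (lt0r_neq0 tn) (lt0r_neq0 e8) (lt0r_neq0 C1) => T B K T1 K1 D1.
  by field; rewrite K1 T1 D1.
have h2 : C / (C + 1) <= 1 by rewrite ler_pdivrMr// mul1r lerDl.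
have h3 : e ^+ n / 2 * (C / (C + 1)) <= e ^+ n / 2 by rewrite ler_piMr// divr_ge0// ltW.
lra.
Qed.

Variables (Omega : set E) (f : 'I_n -> E -> R) (G : 'I_n -> 'I_n -> E -> R) (C : R).
Hypothesis mf : forall i, measurable_fun setT (f i).
Hypothesis C0 : 0 <= C.
Hypothesis sup_est : forall i c (x0 : E) r, 0 < r ->
  [set y : E | `|x0 - y| <= 2 * r] `<=` Omega ->
  `|f i x0 - c| ^+ n <= C * (r ^+ n + r ^- n * \int[mu]_(x in ball x0 r) (`|f i x - c| ^+ n)).
Hypothesis mean_diff : forall x d i, 0 < d -> [set y : E | `|x - y| <= d] `<=` Omega ->
  (forall j, leb_pt n (G i j) x) -> forall e, 0 < e -> \forall r \near 0^'+,
  (\int[mu]_(y in ball x r)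
    (`|f i y - f i x - lin (fun j => G i j x) (y - x)| ^+ n)%:E <= (e * r ^+ (2 * n))%:E)%E.

(** The sup estimate on the cube of radius [t * |h|] around [x + h], with the
    constant [c] equal to the affine approximation at [x + h].  This cube lies in
    the one of radius [2 * |h|] around [x], where [f i] is close in the mean to the
    affine approximation. *)
Lemma pointwise_diff x d i : 0 < d -> [set y : E | `|x - y| <= d] `<=` Omega ->
  (forall j, leb_pt n (G i j) x) -> forall e, 0 < e -> exists2 r, 0 < r &
  forall h : E, `|h| < r -> `|f i (x + h) - f i x - lin (fun j => G i j x) h| <= e * `|h|.
Proof.
move=> d0 dO Gx e e0; set a := fun j => G i j x.
pose M := n%:R * \sum_j `|a j|.
have M0 : 0 <= M by rewrite mulr_ge0// sumr_ge0.
have linM v : `|lin a v| <= M * `|v|.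
  by apply: lin_le => j; rewrite (bigD1 j)//= lerDl sumr_ge0.
have Q0 : 0 <= 1 + 4 ^+ n * M ^+ n by rewrite addr_ge0// mulr_ge0// exprn_ge0.
have [t [e1 [/andP[t0 t1] e10 key]]] := exponent_choice C0 Q0 e0.
have [r1 /= r10 hr1] := mean_diff d0 dO Gx e10.
exists (Num.min (r1 / 2) (d / 3)); first by rewrite lt_min !divr_gt0.
move=> h; rewrite lt_min => /andP[hr hd].
have [->|hn0] := eqVneq h 0.
  by rewrite addr0 subrr -(scale0r (0 : E)) linZ mul0r subrr normr0 mulr_ge0// ltW.
have h0 : 0 < `|h| by rewrite normr_gt0.
pose rho := t * `|h|.
have rho0 : 0 < rho by rewrite mulr_gt0.
have rhoh : rho <= `|h| by rewrite ler_piMl// ltW.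
pose c := f i x + lin a h.
have sub : [set y : E | `|x + h - y| <= 2 * rho] `<=` Omega.
  move=> y /= yh; apply: dO => /=.
  have -> : x - y = (x + h - y) - h by apply/matrixP => l m; rewrite !mxE; ring.
  have := ler_normB (x + h - y) h; lra.
have est := sup_est i c rho0 sub.
have mb z s : measurable (ball z s : set E) by exact: measurable_ball_cV.
have mlin : measurable_fun setT (lin a).
  by have [_ cl _] := C1grad_lin a; exact: continuous_measurable_cV.
have I_le : \int[mu]_(y in ball (x + h) rho) (`|f i y - c| ^+ n) <=
    2 ^+ n * (e1 * (2 * `|h|) ^+ (2 * n) + (M * rho) ^+ n * (2 * rho) ^+ n).
  apply: Rintegral_le_bound; first by move=> y; rewrite exprn_ge0.
  have m1 : measurable_fun setT (fun y => (`|f i y - f i x - lin a (y - x)| ^+ n)%:E).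
    apply/measurable_EFinP; apply: measurable_funX; apply: measurableT_comp => //.
    apply: measurable_funB; first exact: measurable_funB.
    exact: (measurable_translate (- x) (h := lin a)).
  apply: (@le_trans _ _ (\int[mu]_(y in ball (x + h)%R rho) ((2 ^+ n)%:E *
      ((`|f i y - f i x - lin a (y - x)| ^+ n)%:E + ((M * rho) ^+ n)%:E)))%E).
    apply: ge0_le_integral => //.
    - apply/measurable_EFinP; apply: measurable_funTS; apply: measurable_funX.
      by apply: measurableT_comp => //; exact: measurable_funB.
    - apply: measurable_funTS; apply: emeasurable_funM => //; exact: emeasurable_funD.
    move=> y /ball_normP yh; rewrite -EFinD -EFinM lee_fin.
    have Mr0 : 0 <= M * rho by rewrite mulr_ge0// ltW.
    apply: (@le_trans _ _ ((`|f i y - f i x - lin a (y - x)| + M * rho) ^+ n)); last exact: pow_add_le.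
    rewrite lerXn2r ?nnegrE ?addr_ge0//.
    have -> : f i y - c = (f i y - f i x - lin a (y - x)) + lin a (y - x - h).
      by rewrite /c !linB; ring.
    apply: le_trans (ler_normD _ _) _; rewrite lerD2l; apply: le_trans (linM _) _.
    rewrite ler_wpM2l// ltW//; move: yh; rewrite distrC.
    by have -> : y - (x + h) = y - x - h by rewrite opprD addrA.
  rewrite ge0_integralZl//; last 2 first.
  - by apply: measurable_funTS; exact: emeasurable_funD.
  - by move=> y _; rewrite -EFinD lee_fin addr_ge0// exprn_ge0// mulr_ge0// ltW.
  rewrite EFinM lee_wpmul2l ?lee_fin ?exprn_ge0//.
  rewrite ge0_integralD//; last 2 first.
  - exact: (measurable_funTS m1).
  - by move=> y _; rewrite lee_fin exprn_ge0// mulr_ge0// ltW.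
  rewrite EFinD leeD//.
    have h2 : 0 < 2 * `|h| by rewrite mulr_gt0.
    have hr2 : ball (0 : R) r1 (2 * `|h|).
      by rewrite /ball/= sub0r normrN gtr0_norm// mulrC -ltr_pdivlMr.
    apply: le_trans (hr1 _ hr2 h2); apply: ge0_subset_integral => //.
    - exact: measurable_funTS.
    - move=> y /ball_normP yh; apply/ball_normP.
      have -> : x - y = (x + h - y) - h by apply/matrixP => l m; rewrite !mxE; ring.
      have := ler_normB (x + h - y) h; lra.
  by rewrite integral_cst// [X in (_ * X)%E]lebesgue_cV_ball// -EFinM.
have fin : `|f i (x + h) - c| ^+ n <= (e * `|h|) ^+ n.
  have rn0 : 0 <= rho ^- n by rewrite invr_ge0 exprn_ge0// ltW.
  apply: le_trans est _.
  apply: (@le_trans _ _ (C * (rho ^+ n + rho ^- n * (2 ^+ n * (e1 * (2 * `|h|) ^+ (2 * n) + (M * rho) ^+ n * (2 * rho) ^+ n))))).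
    by rewrite ler_wpM2l// lerD2l ler_wpM2l.
  have key' := ler_wpM2r (exprn_ge0 n (ltW h0)) key.
  rewrite [leRHS]exprMn; apply: (le_trans _ key').
  rewrite le_eqVlt; apply/orP; left; apply/eqP.
  rewrite /rho !exprMn !(mulnC 2 n) !(exprM _ n 2).
  have -> : (4 : R) ^+ n = 2 ^+ n * 2 ^+ n by rewrite -exprMn -natrM.
  have -> : (8 : R) ^+ n = 2 ^+ n * 2 ^+ n * 2 ^+ n by rewrite -!exprMn -!natrM.
  have tn : t ^+ n != 0 by rewrite expf_neq0// gt_eqF.
  have hn : `|h| ^+ n != 0 by rewrite expf_neq0// gt_eqF.
  move: (t ^+ n) (`|h| ^+ n) (2 ^+ n : R) (M ^+ n) tn hn => T H A B T1 H1.
  by field; rewrite T1 H1.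
move: fin; rewrite ler_pXn2r ?nnegrE ?mulr_ge0 ?(ltW e0)//.
by rewrite /c opprD addrA.
Qed.

End pointwise_differentiability.

Section conclusion.
Context {R : realType} {n : nat} (n0 : (0 < n)%N).
Local Notation E := 'cV[R]_n.
Local Notation mu := (@lebesgue_cV R n).

Lemma Lfun_pow (g : E -> R) : g \in Lfun mu n%:R%:E ->
  measurable_fun setT g /\ mu.-integrable setT (EFin \o (fun x => `|g x| ^+ n)).
Proof.
move=> Lg; split; first by have := sub_Lfun_mfun Lg; rewrite inE.
have n1 : 1 <= n%:R :> R by rewrite ler1n.
congr (_.-integrable _ (_ \o _)): (Lfun_integrable n1 Lg).
by apply/funext => x /=; rewrite powR_mulrn.
Qed.

Lemma mulmx_continuous (A : 'M[R]_n) : continuous (mulmx A : E -> E).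
Proof.
apply/(linear_bounded_continuous (mulmx A : {linear E -> E})).
apply/(linear_boundedP (mulmx A : {linear E -> E})).
near=> r => x; apply: norm_cV_le; first by rewrite mulr_ge0.
move=> i; rewrite mxE; apply: (@le_trans _ _ (n%:R * (\sum_k \sum_j `|A k j|) * `|x|)).
  apply: (lin_le (a := fun j => A i j)) => j; rewrite (bigD1 i)//= (bigD1 j)//= -addrA lerDl.
  by rewrite addr_ge0 ?sumr_ge0// => k _; rewrite sumr_ge0.
by rewrite ler_wpM2r.
Unshelve. all: by end_near. Qed.

(** Norms are sup norms, so that estimates for the finitely many coordinates suffice. *)
Lemma differentiable_of_coord (f : E -> E) (A : 'M[R]_n) (x : E) :
  (forall i e, 0 < e -> exists2 r, 0 < r & forall h : E, `|h| < r ->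
    `|f (x + h) i ord0 - f x i ord0 - lin (fun j => A i j) h| <= e * `|h|) ->
  differentiable f x /\ 'd f x = mulmx A :> (E -> E).
Proof.
move=> H; have fA : f \o shift x = cst (f x) + (mulmx A : {linear E -> E}) +o_ (0 : E) id.
  apply/eqaddoP => e e0.
  have Hi : \forall h \near (0 : E), forall i,
      `|f (x + h) i ord0 - f x i ord0 - lin (fun j => A i j) h| <= e * `|h|.
    pose F i : set E := [set h | `|f (x + h) i ord0 - f x i ord0 - lin (fun j => A i j) h| <= e * `|h|].
    apply: (@filter_forall _ _ F (nbhs (0 : E)) _) => i.
    have [r r0 hr] := H i e e0.
    apply/nbhs_ballP; exists r => //= h; rewrite -ball_normE /= sub0r normrN.
    exact: hr.
  near=> h; apply: norm_cV_le; first by rewrite mulr_ge0// ltW.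
  have Hh : forall i, `|f (x + h) i ord0 - f x i ord0 - lin (fun j => A i j) h| <= e * `|h|.
    by near: h.
  by move=> i; have := Hh i; rewrite /lin !mxE /= opprD addrA [h + x]addrC.
have dE := diff_unique (mulmx_continuous (A := A)) fA.
split => //; apply/diff_locallyP; rewrite dE; split=> //; exact: mulmx_continuous.
Unshelve. all: by end_near. Qed.
End conclusion.

Theorem theorem1p2 (R : realType) (n : nat) (hn : (2 <= n)%N)
  (Omega : set 'cV[R]_n) (hO : open Omega)
  (K1 K2 : R) (hK1 : 0 < K1) (hK2 : 0 <= K2)
  (f : 'cV[R]_n -> 'cV[R]_n) (hf : quasiregular K1 K2 Omega f)
  (hfc : {within Omega, continuous f})
  (Df : 'cV[R]_n -> 'M[R]_n) (hDf : sobolev_with n%:R%:E Omega f Df) :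
  \forall x \ae lebesgue_cV n, Omega x ->
    differentiable f x /\ 'd f x = mulmx (Df x) :> ('cV[R]_n -> 'cV[R]_n).
Proof.
have n0 : (0 < n)%N by exact: leq_trans hn.
pose g i := (fun x : 'cV[R]_n => f x i ord0) \_ Omega.
pose G i j := (fun x : 'cV[R]_n => Df x i j) \_ Omega.
have mO : measurable Omega by exact: open_measurable_cV.
have [hfL hDL hw] := hDf.
have mg i : measurable_fun setT (g i) by have [] := Lfun_pow n0 (hfL i).
have ig i : (lebesgue_cV n).-integrable setT (EFin \o (fun x => `|g i x| ^+ n)).
  by have [] := Lfun_pow n0 (hfL i).
have mG i j : measurable_fun setT (G i j) by have [] := Lfun_pow n0 (hDL i j).
have iG i j : (lebesgue_cV n).-integrable setT (EFin \o (fun x => `|G i j x| ^+ n)).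
  by have [] := Lfun_pow n0 (hDL i j).
have g_loc i : locint (g i) by exact: (locint_pow n0).
have g_cont i x : Omega x -> {for x, continuous (g i)}.
  move=> Ox; have fx : {for x, continuous f}.
    by move: hfc; rewrite continuous_open_subspace// => /(_ x); apply; rewrite inE.
  have gx : {for x, continuous (fun y => f y i ord0)}.
    by apply: (@continuous_comp _ _ _ f (fun y : 'cV[R]_n => y i ord0)) => //; exact: coord_continuous.
  have gE : g i x = f x i ord0 by rewrite /g patchT ?inE.
  rewrite /prop_for /continuous_at gE.
  have nO : nbhs x Omega by exact: open_nbhs_nbhs.
  have fg : {near nbhs x, (fun y => f y i ord0) =1 g i}.
    by apply: (@filterS _ (nbhs x) _ Omega) nO => y Oy; rewrite /g patchT ?inE.
  exact: cvg_trans (near_eq_cvg fg) gx.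
have g_grad i j eps (x : 'cV[R]_n) : 0 < eps -> eps <= 1 ->
    [set y | `|x - y| <= eps] `<=` Omega -> dmol eps j (g i) x = mol eps (G i j) x.
  move=> eps0 eps1 xO; apply: dmol_mol => //.
  exact: (locint_pow n0 (mG i j) (iG i j)).
(* The zero extensions satisfy the hypotheses everywhere: outside [Omega] the
   determinant vanishes. *)
have matG x : Omega x -> \matrix_(l, j) G l j x = Df x.
  by move=> Ox; apply/matrixP => l j; rewrite mxE /G patchT ?inE.
have G0 x : ~ Omega x -> forall l j, G l j x = 0.
  by move=> Ox l j; rewrite /G patchC// inE.
have det0 x : ~ Omega x -> \det (\matrix_(l, j) G l j x) = 0.
  move=> Ox; have -> : \matrix_(l, j) G l j x = 0.
    by apply/matrixP => l j; rewrite !mxE G0.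
  by rewrite -(scale0r (1%:M : 'M[R]_n)) detZ expr0n (gtn_eqF n0) mul0r.
have [hsign hbound] := hf.2 Df hDf.
have sign : (\forall x \ae lebesgue_cV n, 0 <= \det (\matrix_(l, j) G l j x)) \/
    (\forall x \ae lebesgue_cV n, \det (\matrix_(l, j) G l j x) <= 0).
  case: hsign => hs; [left|right]; apply: filterS hs => x hx;
    (have [Ox|Ox] := pselect (Omega x); [by rewrite matG//; exact: hx|by rewrite det0]).
(* All norms of matrices are equivalent; [a] converts the operator norm. *)
pose a := ((n * n)%:R : R) ^+ n.
have a0 : 0 <= a by rewrite exprn_ge0.
have bound : \forall x \ae lebesgue_cV n,
    gsum G x ^+ n <= a * K1 * `|\det (\matrix_(l, j) G l j x)| + a * K2.
  apply: filterS hbound => x hx; have [Ox|Ox] := pselect (Omega x).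
    rewrite matG//.
    have -> : gsum G x = mxsum (fun i j => Df x i j).
      by rewrite /gsum; congr mxsum; apply/funext => i; apply/funext => j; rewrite -matG// mxE.
    rewrite -mulrA -mulrDr; apply: le_trans (ler_wpM2l a0 (hx Ox)).
    have ms0 : 0 <= mxsum (fun i j => Df x i j).
      by apply: sumr_ge0 => i _; exact: sumr_ge0.
    rewrite -exprMn lerXn2r ?nnegrE ?mxsum_opnorm//.
    exact: le_trans ms0 (mxsum_opnorm (Df x)).
  rewrite det0// normr0 mulr0 add0r.
  have -> : gsum G x = 0.
    by rewrite /gsum /mxsum big1// => i _; rewrite big1// => j _; rewrite G0// normr0.
  by rewrite expr0n -(prednK n0)/= mulr_ge0.
have aK1 : 0 <= a * K1 by rewrite mulr_ge0// ltW.
have aK2 : 0 <= a * K2 by rewrite mulr_ge0.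
have [C C0 hC] := sup_estimate n0 g_loc g_cont mG iG g_grad aK1 aK2 sign bound.
have leb : \forall x \ae lebesgue_cV n, forall i j, leb_pt n (G i j) x.
  apply: filter_forall => i; apply: filter_forall => j.
  exact: (lebesgue_points n0).
apply: filterS leb => x hx Ox.
have [d /= d0 dO] : exists2 d, 0 < d & [set y : 'cV[R]_n | `|x - y| <= d] `<=` Omega.
  have /nbhs_normP[d /= d0 hd] : nbhs x Omega by exact: open_nbhs_nbhs.
  exists (d / 2); first by rewrite divr_gt0.
  move=> y /= yd; apply: hd => /=; apply: le_lt_trans yd _.
  by rewrite ltr_pdivrMr// ltr_pMr// ltr1n.
apply: differentiable_of_coord => i e e0.
have [r r0 hr] := pointwise_diff n0 mg C0 hC
  (mean_differentiable n0 g_loc g_cont mG iG g_grad) d0 dO (hx i) e0.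
exists (Num.min r d); first by rewrite lt_min r0.
move=> h; rewrite lt_min => /andP[hhr hhd].
have Oh : Omega (x + h) by apply: dO; rewrite /= opprD addNKr normrN ltW.
have := hr h hhr; rewrite /g !patchT ?inE//.
by rewrite (_ : (fun j => G i j x) = (fun j => Df x i j))//; apply/funext => j; rewrite /G patchT ?inE.
Qed.
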